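(* Let $\mathbf s,\mathbf s'\in\mathscr S_r$. Then the simple $\mathcal H_\vartriangle(r)_v$-modules $V_{\mathbf s}$ and $V_{\mathbf s'}$ belong to the same block of the category $\widehat{\mathcal C}_r$ of finite dimensional $\mathcal H_\vartriangle(r)_v$-modules if and only if there exists $\sigma\in\mathfrak S_r$ such that $\mathbf a(\mathbf s)\sigma=\mathbf a(\mathbf s')$.
   Context: Let $v\in\mathbb C^*=\mathbb C\setminus\{0\}$ not be a root of unity and $r\ge1$. **Affine Hecke algebra.** $\mathcal H_\vartriangle(r)_v$ is the $\mathbb C$-algebra generated by $T_i$ ($1\le i\le r-1$), $X_j^{\pm1}$ ($1\le j\le r$) with relations $(T_i+1)(T_i-v^2)=0$, $T_iT_{i+1}T_i=T_{i+1}T_iT_{i+1}$, $T_iT_j=T_jT_i$ ($|i-j|>1$), $X_iX_i^{-1}=1=X_i^{-1}X_i$, $X_iX_j=X_jX_i$, $T_iX_iT_i=v^2X_{i+1}$, $X_jT_i=T_iX_j$ ($j\ne i,i+1$). $\mathcal H(r)_v$ is the subalgebra generated by the $T_i$; for a reduced expression $w=s_{i_1}\cdots s_{i_m}\in\mathfrak S_r$ put $T_w=T_{i_1}\cdots T_{i_m}$. $\widehat{\mathcal C}_r$ is the category of finite dimensional left $\mathcal H_\vartriangle(r)_v$-modules. **Segments.** A segment with center $a\in\mathbb C^*$ and length $k=|\mathsf s|$ is the sequence $\mathsf s=(av^{-k+1},av^{-k+3},\dots,av^{k-1})\in(\mathbb C^* )^k$. $\mathscr S_r$ is the set of unordered collections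 (multisets) of segments $\mathbf s=\{\mathsf s_1,\dots,\mathsf s_p\}$ of total length $|\mathsf s_1|+\cdots+|\mathsf s_p|=r$. For $\mathbf s\in\mathscr S_r$, $\mathbf a(\mathbf s)=(\mathsf s_1,\dots,\mathsf s_p)\in(\mathbb C^* )^r$ is the $r$-tuple obtained by juxtaposing the segments (in some chosen order). $\mathfrak S_r$ acts on $(\mathbb C^* )^r$ by $\mathbf bw=(b_{w(1)},\dots,b_{w(r)})$. **The modules $V_{\mathbf s}$.** For a composition $\mu=(\mu_1,\dots,\mu_p)$ of $r$ with all $\mu_i\ge1$, let $\mathfrak S_\mu\subseteq\mathfrak S_r$ be the standard Young subgroup, $w_{0,\mu}$ its longest element, and $y_\mu=\sum_{w\in\mathfrak S_\mu}(-v^2)^{-\ell(w)}T_w$. Let $E_\mu$ be the left cell module of $\mathcal H(r)_v$ defined by the Kazhdan–Lusztig $C$-basis, attached to the left cell containing $w_{0,\mu}$. One has $\mathcal H(r)_vy_\mu\cong E_\mu\oplus\bigoplus_\nu m_{\nu,\mu}E_\nu$, where $\nu$ runs over partitions of $r$ strictly larger in dominance order than the partition obtained by rearranging $\mu$. For $\mathbf b\in(\mathbb C^* )^r$ let $M_{\mathbf b}=\mathcal H_\vartriangle(r)_v/J_{\mathbf b}$, where $J_{\mathbf b}$ is the left ideal generated by $X_j-b_j$ ($1\le j\le r$). For $\mathbf s=\{\mathsf s_1,\dots,\mathsf s_p\}\in\mathscr S_r$ with $\mathsf s_i=(a_iv^{-\mu_i+1},\dots,a_iv^{\mu_i-1})$,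 put $\mu=(\mu_1,\dots,\mu_p)$, $\boldsymbol a=(a_1,\dots,a_p)$, $\mathbf b=(\mathsf s_1,\dots,\mathsf s_p)$, and $I_{\mu,\boldsymbol a}=\mathcal H_\vartriangle(r)_v\bar y_\mu\subseteq M_{\mathbf b}$, where $\bar y_\mu=y_\mu+J_{\mathbf b}$; it is isomorphic to $\mathcal H(r)_vy_\mu$ as an $\mathcal H(r)_v$-module. $V_{\mathbf s}$ is the unique composition factor of the $\mathcal H_\vartriangle(r)_v$-module $I_{\mu,\boldsymbol a}$ in which $E_\mu$ has nonzero multiplicity as an $\mathcal H(r)_v$-module. By Zelevinsky and Rogawski, the $V_{\mathbf s}$, $\mathbf s\in\mathscr S_r$, are all the finite dimensional irreducible $\mathcal H_\vartriangle(r)_v$-modules up to isomorphism, pairwise nonisomorphic. **Blocks.** Let $\mathcal C$ be an abelian category in which every object has finite length. Indecomposable objects $X_1,X_2$ are linked if there do not exist abelian subcategories $\mathcal C_1,\mathcal C_2$ with $\mathcal C=\mathcal C_1\oplus\mathcal C_2$, $X_1\in\mathcal C_1$, $X_2\in\mathcal C_2$. Linking is an equivalence relation; for each class $\alpha$ the subcategory $\mathcal C_\alpha$ of direct sums of indecomposables from $\alpha$ is a block of $\mathcal C$, and $\mathcal C=\bigoplus_\alpha\mathcal C_\alpha$. *)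

(* Defs.v *)
From HB Require Import structures.
From mathcomp Require Import all_boot all_order all_algebra all_fingroup.
From mathcomp Require Import generic_quotient ring_quotient finmap multiset.
From mathcomp Require Import boolp classical_sets reals.
From mathcomp Require Import complex.

Set Implicit Arguments.
Unset Strict Implicit.
Unset Printing Implicit Defensive.

Import GRing.Theory.

Local Open Scope ring_scope.
Local Open Scope quotient_scope.

Section Presentation.
Variables (K : comNzRingType) (G : Type).

Inductive term : Type :=
  | Cst of K
  | Gen of G
  | Add of term & term
  | Mul of term & term.

HB.instance Definition _ := gen_eqMixin term.
HB.instance Definition _ := gen_choiceMixin term.

Variable rel : term -> term -> Prop.

(* The least congruence containing [rel] whose quotient is an associative
   unital K-algebra with structure map [Cst]; the quotient is thus the free
   associative algebra on [G] modulo the two-sided ideal of [rel]. *)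
Inductive pcong : term -> term -> Prop :=
  | PCrefl x : pcong x x
  | PCsym x y : pcong x y -> pcong y x
  | PCtrans x y z : pcong x y -> pcong y z -> pcong x z
  | PCadd x x' y y' : pcong x x' -> pcong y y' -> pcong (Add x y) (Add x' y')
  | PCmul x x' y y' : pcong x x' -> pcong y y' -> pcong (Mul x y) (Mul x' y')
  | PCaddA x y z : pcong (Add x (Add y z)) (Add (Add x y) z)
  | PCaddC x y : pcong (Add x y) (Add y x)
  | PCadd0 x : pcong (Add (Cst 0) x) x
  | PCaddN x : pcong (Add (Mul (Cst (-1)) x) x) (Cst 0)
  | PCmulA x y z : pcong (Mul x (Mul y z)) (Mul (Mul x y) z)
  | PCmul1l x : pcong (Mul (Cst 1) x) x
  | PCmul1r x : pcong (Mul x (Cst 1)) x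
  | PCmulDl x y z : pcong (Mul (Add x y) z) (Add (Mul x z) (Mul y z))
  | PCmulDr x y z : pcong (Mul x (Add y z)) (Add (Mul x y) (Mul x z))
  | PCcstD a b : pcong (Cst (a + b)) (Add (Cst a) (Cst b))
  | PCcstM a b : pcong (Cst (a * b)) (Mul (Cst a) (Cst b))
  | PCcstC a x : pcong (Mul (Cst a) x) (Mul x (Cst a))
  | PCrel x y : rel x y -> pcong x y.

Definition pequiv (x y : term) : bool := `[< pcong x y >].

Lemma pequiv_is_equiv : equiv_class_of pequiv.
Proof.
split=> [x|x y|y x z]; first by apply/asboolP; exact: PCrefl.
  by apply/asboolP/asboolP => ?; exact: PCsym.
by move=> /asboolP xy /asboolP yz; apply/asboolP; exact: PCtrans xy yz.
Qed.

Canonical pequiv_equiv := EquivRelPack pequiv_is_equiv.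
Canonical pequiv_encModRel := defaultEncModRel pequiv.

Definition palg := {eq_quot pequiv}.

HB.instance Definition _ := Choice.on palg.

Definition ppi (t : term) : palg := \pi_palg t.

Lemma ppiP x y : pcong x y <-> ppi x = ppi y.
Proof.
split=> [xy|/eqP]; first by apply/eqP; rewrite piE; apply/asboolP.
by rewrite piE => /asboolP.
Qed.

Lemma ppi_repr x : ppi (repr x) = x. Proof. exact: reprK. Qed.

Definition padd (x y : palg) := ppi (Add (repr x) (repr y)).
Definition pmul (x y : palg) := ppi (Mul (repr x) (repr y)).
Definition popp (x : palg) := pmul (ppi (Cst (-1))) x.

Lemma repr_ppi x : pcong (repr (ppi x)) x.
Proof. by apply/ppiP; rewrite ppi_repr. Qed.

Lemma paddE x y : padd (ppi x) (ppi y) = ppi (Add x y).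
Proof. by apply/ppiP; apply: PCadd; exact: repr_ppi. Qed.

Lemma pmulE x y : pmul (ppi x) (ppi y) = ppi (Mul x y).
Proof. by apply/ppiP; apply: PCmul; exact: repr_ppi. Qed.

Let pE := (paddE, pmulE).

Let paddA : associative padd.
Proof.
move=> x y z; rewrite -[x]ppi_repr -[y]ppi_repr -[z]ppi_repr !pE.
by apply/ppiP; exact: PCaddA.
Qed.

Let paddC : commutative padd.
Proof. by move=> x y; apply/ppiP; exact: PCaddC. Qed.

Let padd0 : left_id (ppi (Cst 0)) padd.
Proof.
by move=> x; rewrite -[x]ppi_repr !pE; apply/ppiP; exact: PCadd0.
Qed.

Let paddN : left_inverse (ppi (Cst 0)) popp padd.
Proof.
by move=> x; rewrite /popp -[x]ppi_repr !pE; apply/ppiP; exact: PCaddN.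
Qed.

HB.instance Definition _ := GRing.isZmodule.Build palg paddA paddC padd0 paddN.

Let pmulA : associative pmul.
Proof.
move=> x y z; rewrite -[x]ppi_repr -[y]ppi_repr -[z]ppi_repr !pE.
by apply/ppiP; exact: PCmulA.
Qed.

Let pmul1l : left_id (ppi (Cst 1)) pmul.
Proof. by move=> x; rewrite -[x]ppi_repr !pE; apply/ppiP; exact: PCmul1l. Qed.

Let pmul1r : right_id (ppi (Cst 1)) pmul.
Proof. by move=> x; rewrite -[x]ppi_repr !pE; apply/ppiP; exact: PCmul1r. Qed.

Let pmulDl : left_distributive pmul +%R.
Proof.
move=> x y z; rewrite -[x]ppi_repr -[y]ppi_repr -[z]ppi_repr.
by rewrite /GRing.add /= !pE; apply/ppiP; exact: PCmulDl.
Qed.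

Let pmulDr : right_distributive pmul +%R.
Proof.
move=> x y z; rewrite -[x]ppi_repr -[y]ppi_repr -[z]ppi_repr.
by rewrite /GRing.add /= !pE; apply/ppiP; exact: PCmulDr.
Qed.

HB.instance Definition _ :=
  GRing.Zmodule_isPzRing.Build palg pmulA pmul1l pmul1r pmulDl pmulDr.

Lemma ppiD x y : ppi (Add x y) = ppi x + ppi y.
Proof. by rewrite -paddE. Qed.
Lemma ppiM x y : ppi (Mul x y) = ppi x * ppi y.
Proof. by rewrite -pmulE. Qed.
Lemma ppi1 : ppi (Cst 1) = 1. Proof. by []. Qed.
Lemma ppi0 : ppi (Cst 0) = 0. Proof. by []. Qed.

Definition pscale (a : K) (x : palg) : palg := ppi (Cst a) * x.

Let pscaleA a b x : pscale a (pscale b x) = pscale (a * b) x.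
Proof.
by rewrite /pscale mulrA -ppiM; congr (_ * _); apply/ppiP/PCsym; exact: PCcstM.
Qed.

Let pscale1 : left_id 1 pscale.
Proof. by move=> x; rewrite /pscale ppi1 mul1r. Qed.

Let pscaleDr : right_distributive pscale +%R.
Proof. by move=> a x y; rewrite /pscale mulrDr. Qed.

Let pscaleDl x : {morph pscale^~ x : a b / a + b}.
Proof.
move=> a b; rewrite /pscale -mulrDl -ppiD; congr (_ * _).
by apply/ppiP; exact: PCcstD.
Qed.

HB.instance Definition _ :=
  GRing.Zmodule_isLmodule.Build K palg pscaleA pscale1 pscaleDr pscaleDl.

Lemma palg_scaleE (a : K) (x : palg) : a *: x = ppi (Cst a) * x.
Proof. by []. Qed.

Lemma palg_scalerAl (a : K) (x y : palg) : a *: (x * y) = a *: x * y.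
Proof. by rewrite !palg_scaleE mulrA. Qed.

Lemma palg_scalerAr (a : K) (x y : palg) : a *: (x * y) = x * (a *: y).
Proof.
rewrite !palg_scaleE !mulrA; congr (_ * _).
rewrite -[x]ppi_repr -!ppiM; apply/ppiP; exact: PCcstC.
Qed.

Section Eval.
Variables (A : algType K) (f : G -> A).

Fixpoint teval (t : term) : A :=
  match t with
  | Cst a => a%:A
  | Gen g => f g
  | Add x y => teval x + teval y
  | Mul x y => teval x * teval y
  end.

Lemma teval_pcong :
  (forall x y, rel x y -> teval x = teval y) ->
  forall x y, pcong x y -> teval x = teval y.
Proof.
move=> frel x y; elim => {x y} //=.
- by move=> x y z _ -> _ ->.
- by move=> x x' y y' _ -> _ ->.
- by move=> x x' y y' _ -> _ ->.
- by move=> *; rewrite addrA.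
- by move=> *; rewrite addrC.
- by move=> *; rewrite scale0r add0r.
- by move=> x; rewrite -scalerAl mul1r scaleN1r addNr scale0r.
- by move=> *; rewrite mulrA.
- by move=> *; rewrite scale1r mul1r.
- by move=> *; rewrite scale1r mulr1.
- by move=> *; rewrite mulrDl.
- by move=> *; rewrite mulrDr.
- by move=> *; rewrite scalerDl.
- by move=> a b; rewrite -scalerAl mul1r scalerA.
- by move=> a x; rewrite -scalerAl -scalerAr mul1r mulr1.
Qed.

End Eval.
End Presentation.

Section AffineHecke.
Variables (K : fieldType) (v : K) (r : nat).

(* Indices start at 0: [TT i] with [i < r - 1], [XX j] with [j < r]. *)
Inductive hgen : Type := TT of 'I_r.-1 | XX of 'I_r | XXV of 'I_r.

Definition lo (i : 'I_r.-1) : 'I_r := widen_ord (leq_pred r) i.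

Lemma hi_subproof (i : 'I_r.-1) : (i.+1 < r)%N.
Proof. by case: i => i /=; case: (r). Qed.

Definition hi (i : 'I_r.-1) : 'I_r := Ordinal (hi_subproof i).

Let T i : term K hgen := Gen K (TT i).
Let X j : term K hgen := Gen K (XX j).
Let XV j : term K hgen := Gen K (XXV j).
Let C (a : K) : term K hgen := Cst hgen a.

Inductive hecke_rel : term K hgen -> term K hgen -> Prop :=
  | HRquad i : hecke_rel (Mul (Add (T i) (C 1)) (Add (T i) (C (- v ^+ 2)))) (C 0)
  | HRbraid (i j : 'I_r.-1) : j = i.+1 :> nat ->
      hecke_rel (Mul (Mul (T i) (T j)) (T i)) (Mul (Mul (T j) (T i)) (T j))
  | HRTT (i j : 'I_r.-1) : (i.+1 < j)%N \/ (j.+1 < i)%N ->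
      hecke_rel (Mul (T i) (T j)) (Mul (T j) (T i))
  | HRXV j : hecke_rel (Mul (X j) (XV j)) (C 1)
  | HRVX j : hecke_rel (Mul (XV j) (X j)) (C 1)
  | HRXX i j : hecke_rel (Mul (X i) (X j)) (Mul (X j) (X i))
  | HRTXT i : hecke_rel (Mul (Mul (T i) (X (lo i))) (T i))
                        (Mul (C (v ^+ 2)) (X (hi i)))
  | HRXT i j : j != lo i -> j != hi i ->
      hecke_rel (Mul (X j) (T i)) (Mul (T i) (X j)).

Definition hecke := palg hecke_rel.

HB.instance Definition _ := GRing.PzRing.on hecke.
HB.instance Definition _ := GRing.Lmodule.on hecke.

Definition hT (i : 'I_r.-1) : hecke := ppi hecke_rel (T i).
Definition hX (j : 'I_r) : hecke := ppi hecke_rel (X j).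
Definition hXV (j : 'I_r) : hecke := ppi hecke_rel (XV j).

(* T_i |-> v^2, X_j |-> v^(2j) is a one-dimensional representation. *)
Let triv_gen (g : hgen) : K^o :=
  let x (j : 'I_r) := if v == 0 then 1 else v ^+ (2 * j) in
  match g with TT _ => v ^+ 2 | XX j => x j | XXV j => (x j)^-1 end.

Let triv_rel x y : hecke_rel x y -> teval triv_gen x = teval triv_gen y.
Proof.
have sA (a : K) : (a *: (1 : K^o)) = a by rewrite /GRing.scale /= mulr1.
case=> {x y} /=.
- by move=> i; rewrite !sA addrN mulr0.
- by [].
- by [].
- move=> j; rewrite !sA; case: eqP => [_|/eqP v0]; first by rewrite mulfV ?oner_eq0.
  by rewrite mulfV // expf_neq0.
- move=> j; rewrite !sA; case: eqP => [_|/eqP v0]; first by rewrite mulVf ?oner_eq0.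
  by rewrite mulVf // expf_neq0.
- by move=> i j; rewrite mulrC.
- move=> i; rewrite !sA /=; case: eqP => [->|_]; first by rewrite expr0n /= !mul0r.
  by rewrite -!exprD; congr (_ ^+ _); rewrite mulnS addnC addnA addnAC.
- by move=> i j _ _; rewrite mulrC.
Qed.

Lemma hecke_oner_neq0 : (1 : hecke) != 0.
Proof.
apply/eqP => e.
have /ppiP/(teval_pcong triv_rel)/= : ppi hecke_rel (C 1) = ppi hecke_rel (C 0).
  exact: e.
by rewrite scale1r scale0r => /eqP; rewrite oner_eq0.
Qed.

HB.instance Definition _ :=
  GRing.PzSemiRing_isNonZero.Build hecke hecke_oner_neq0.
HB.instance Definition _ :=
  GRing.Lmodule_isLalgebra.Build K hecke
    (@palg_scalerAl K hgen hecke_rel).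
HB.instance Definition _ :=
  GRing.Lalgebra_isAlgebra.Build K hecke
    (@palg_scalerAr K hgen hecke_rel).

End AffineHecke.

Section Modules.
Variable A : pzRingType.
Implicit Types M N : lmodType A.

Definition regmod : lmodType A := A^o.

Definition lmod_iso M N : Prop := exists f : {linear M -> N}, bijective f.

Definition gensub_pred M (X : set M) : pred M :=
  fun m => `[< forall N : submodClosed M, (forall x, X x -> x \in N) -> m \in N >].

Lemma gensub_closed M (X : set M) : subsemimod_closed (gensub_pred X).
Proof.
split; first split.
- by apply/asboolP => N _; exact: rpred0.
- move=> x y /asboolP Xx /asboolP Xy; apply/asboolP => N XN.
  by apply: rpredD; [exact: Xx | exact: Xy].
- by move=> a x /asboolP Xx; apply/asboolP => N XN; apply/rpredZ/Xx.
Qed.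

HB.instance Definition _ M (X : set M) :=
  GRing.isSubSemiModClosed.Build A M (gensub_pred X) (gensub_closed X).

Definition gensub M (X : set M) : submodClosed M :=
  GRing.SubmodClosed.clone A M (gensub_pred X) _.

Definition submod M (N : submodClosed M) : Type := {x : M | x \in N}.

HB.instance Definition _ M (N : submodClosed M) := SubChoice.on (submod N).
HB.instance Definition _ M (N : submodClosed M) :=
  [SubChoice_isSubLmodule of submod N by <:].

Section Quotient.
Variables (M : lmodType A) (N : submodClosed M).

Definition quot_pred : pred M := fun x => x \in N.

Lemma quot_pred_closed : zmod_closed quot_pred.
Proof.
split; first exact: rpred0.
by move=> x y Nx Ny; rewrite /quot_pred unfold_in -scaleN1r; apply/rpredD/rpredZ.
Qed.

HB.instance Definition _ := GRing.isZmodClosed.Build M quot_pred quot_pred_closed.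

Definition quot_zmod : zmodClosed M := GRing.ZmodClosed.clone M quot_pred _.

Definition quotmod : Type := Quotient.quot quot_zmod.

HB.instance Definition _ := GRing.Zmodule.on quotmod.

Definition qpi (x : M) : quotmod := \pi_(Quotient.quot quot_zmod) x.

Lemma qpi_eq x y : (qpi x = qpi y) <-> (x - y \in N).
Proof.
have := Quotient.idealrBE quot_zmod x y.
by rewrite /qpi => e; split => [/eqP|xy]; [rewrite -e | apply/eqP; rewrite -e].
Qed.

Lemma qpi_repr (x : quotmod) : qpi (repr x) = x. Proof. exact: reprK. Qed.

Lemma qpiD x y : qpi (x + y) = qpi x + qpi y.
Proof. exact: pi_addr. Qed.

Definition qscale (a : A) (x : quotmod) : quotmod := qpi (a *: repr x).

Lemma qscaleE a x : qscale a (qpi x) = qpi (a *: x).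
Proof.
apply/qpi_eq; rewrite -scalerBr; apply: rpredZ; apply/qpi_eq; exact: qpi_repr.
Qed.

Let qscaleA a b x : qscale a (qscale b x) = qscale (a * b) x.
Proof. by rewrite -[x]qpi_repr !qscaleE scalerA. Qed.

Let qscale1 : left_id 1 qscale.
Proof. by move=> x; rewrite -[x]qpi_repr qscaleE scale1r. Qed.

Let qscaleDr : right_distributive qscale +%R.
Proof.
move=> a x y; rewrite -[x]qpi_repr -[y]qpi_repr -qpiD !qscaleE -qpiD.
by rewrite scalerDr.
Qed.

Let qscaleDl x : {morph qscale^~ x : a b / a + b}.
Proof. by move=> a b; rewrite -[x]qpi_repr !qscaleE -qpiD scalerDl. Qed.

HB.instance Definition _ :=
  GRing.Zmodule_isLmodule.Build A quotmod qscaleA qscale1 qscaleDr qscaleDl.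

End Quotient.

(* [subquot N1 N2] is N1 / (N1 \cap N2). *)
Section Subquotient.
Variables (M : lmodType A) (N1 N2 : submodClosed M).

Definition relsub_pred : pred (submod N1) := fun x => val x \in N2.

Lemma relsub_predE x : (x \in relsub_pred) = (val x \in N2).
Proof. by []. Qed.

Lemma relsub_closed : subsemimod_closed relsub_pred.
Proof.
split; first split.
- by rewrite relsub_predE raddf0 rpred0.
- by move=> x y; rewrite !relsub_predE raddfD => Nx Ny; apply: rpredD.
- by move=> a x; rewrite !relsub_predE linearZ => Nx; apply: rpredZ.
Qed.

HB.instance Definition _ :=
  GRing.isSubSemiModClosed.Build A (submod N1) relsub_pred relsub_closed.

Definition relsub : submodClosed (submod N1) :=
  GRing.SubmodClosed.clone A (submod N1) relsub_pred _.

Definition subquot : lmodType A := quotmod relsub.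

End Subquotient.

Definition simple_mod M : Prop :=
  (exists m : M, m != 0) /\
  forall N : submodClosed M, (forall m, m \in N -> m = 0) \/ (forall m, m \in N).

Definition composition_series M (n : nat) (N : nat -> submodClosed M) : Prop :=
  [/\ forall m, m \in N 0 -> m = 0,
      forall m, m \in N n,
      forall k m, (k < n)%N -> m \in N k -> m \in N k.+1 &
      forall k, (k < n)%N -> simple_mod (subquot (N k.+1) (N k))].

(* [L] has nonzero multiplicity as a composition factor of [M]. *)
Definition comp_factor L M : Prop :=
  exists n (N : nat -> submodClosed M), composition_series n N /\
    exists2 k, (k < n)%N & lmod_iso L (subquot (N k.+1) (N k)).

End Modules.

Section Subalgebras.
Variables (K : fieldType) (A : algType K).

Definition gensubalg_pred (X : set A) : pred A :=
  fun a => `[< forall S : subalgClosed A, (forall x, X x -> x \in S) -> a \in S >].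

Lemma gensubalg_closed (X : set A) : GRing.subsemialg_closed (gensubalg_pred X).
Proof.
split.
- by apply/asboolP => S _; exact: rpred1.
- split; first by apply/asboolP => S _; exact: rpred0.
  move=> x y /asboolP Xx /asboolP Xy; apply/asboolP => S XS.
  by apply: rpredD; [exact: Xx | exact: Xy].
- by move=> a x /asboolP Xx; apply/asboolP => S XS; apply/rpredZ/Xx.
- move=> x y /asboolP Xx /asboolP Xy; apply/asboolP => S XS.
  by apply: rpredM; [exact: Xx | exact: Xy].
Qed.

HB.instance Definition _ (X : set A) :=
  GRing.isSubSemiAlgClosed.Build K A (gensubalg_pred X) (gensubalg_closed X).

Definition gensubalg (X : set A) : subalgClosed A :=
  GRing.SubalgClosed.clone K A (gensubalg_pred X) _.

Lemma gensubalg_mem (X : set A) x : X x -> x \in gensubalg X.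
Proof. by move=> Xx; apply/asboolP => S; exact. Qed.

Definition subalg (S : subalgClosed A) : Type := {x : A | x \in S}.

HB.instance Definition _ (S : subalgClosed A) := SubChoice.on (subalg S).
HB.instance Definition _ (S : subalgClosed A) :=
  [SubChoice_isSubAlgebra of subalg S by <:].

Definition restrict (S : subalgClosed A) (M : lmodType A) : Type := M.

HB.instance Definition _ (S : subalgClosed A) (M : lmodType A) :=
  GRing.Zmodule.on (restrict S M).

Section Restrict.
Variables (S : subalgClosed A) (M : lmodType A).

Definition rscale (a : subalg S) (m : restrict S M) : restrict S M :=
  (val a *: (m : M) : M).

Let rscaleA a b m : rscale a (rscale b m) = rscale (a * b) m.
Proof. by rewrite /rscale scalerA. Qed.
Let rscale1 : left_id 1 rscale.
Proof. by move=> m; rewrite /rscale /= scale1r. Qed.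
Let rscaleDr : right_distributive rscale +%R.
Proof. by move=> a m n; rewrite /rscale scalerDr. Qed.
Let rscaleDl m : {morph rscale^~ m : a b / a + b}.
Proof. by move=> a b; rewrite /rscale /= scalerDl. Qed.

HB.instance Definition _ :=
  GRing.Zmodule_isLmodule.Build (subalg S) (restrict S M)
    rscaleA rscale1 rscaleDr rscaleDl.

End Restrict.
End Subalgebras.

Section Blocks.
Variables (K : fieldType) (A : algType K).

Record fdmod := FdMod {
  fd_mod :> lmodType A;
  fd_dim : exists n (e : 'I_n -> fd_mod),
    forall m, exists c : 'I_n -> K, m = \sum_i (c i)%:A *: e i
}.

Implicit Types (P : fdmod -> Prop) (M N L : fdmod).

Definition zero_mod M : Prop := forall m : M, m = 0.

(* Objects of an abelian full subcategory. Zero objects, sums, kernels and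
   cokernels are taken up to isomorphism, so that P is stable under
   isomorphisms. *)
Record abelian_subcat P : Prop := AbelianSubcat {
  absub_zero : forall M, zero_mod M -> P M;
  absub_sum : forall M N L, P M -> P N -> lmod_iso L (M * N)%type -> P L;
  absub_ker : forall M N (f : {linear M -> N}) L (i : {linear L -> M}),
    P M -> P N -> injective i -> (forall m, f m = 0 <-> exists x, i x = m) -> P L;
  absub_coker : forall M N (f : {linear M -> N}) L (p : {linear N -> L}),
    P M -> P N -> (forall y, exists n, p n = y) ->
    (forall n, p n = 0 <-> exists m, f m = n) -> P L
}.

Definition cat_sum P1 P2 : Prop :=
  [/\ forall M, exists M1 M2, [/\ P1 M1, P2 M2 & lmod_iso M (M1 * M2)%type],
      forall M1 M2 (f : {linear M1 -> M2}), P1 M1 -> P2 M2 -> forall m, f m = 0 &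
      forall M1 M2 (f : {linear M2 -> M1}), P1 M1 -> P2 M2 -> forall m, f m = 0].

Definition indecomposable M : Prop :=
  ~ zero_mod M /\
  forall M1 M2, lmod_iso M (M1 * M2)%type -> zero_mod M1 \/ zero_mod M2.

Definition linked M N : Prop :=
  ~ exists P1 P2, [/\ abelian_subcat P1, abelian_subcat P2, cat_sum P1 P2,
                      P1 M & P2 N].

(* [M] is a finite direct sum (biproduct) of the objects [N i]. *)
Definition direct_sum n (N : 'I_n -> fdmod) M : Prop :=
  exists (inj : forall i, {linear N i -> M}) (prj : forall i, {linear M -> N i}),
    [/\ forall i x, prj i (inj i x) = x,
        forall i j x, i != j -> prj j (inj i x) = 0 &
        forall m, m = \sum_i inj i (prj i m)].

(* Membership in the block of the linking class of [X]. *)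
Definition block_of X M : Prop :=
  exists n (N : 'I_n -> fdmod),
    (forall i, indecomposable (N i) /\ linked X (N i)) /\ direct_sum N M.

Definition is_block P : Prop :=
  exists2 X, indecomposable X & forall M, P M <-> block_of X M.

Definition same_block M N : Prop := exists P, [/\ is_block P, P M & P N].

End Blocks.

Section FiniteHecke.
Variables (K : fieldType) (v : K) (r : nat).

Definition finhecke_sub : subalgClosed (hecke v r) :=
  gensubalg [set h | exists i, h = hT v i]%classic.

Definition finhecke := subalg finhecke_sub.

HB.instance Definition _ := GRing.Algebra.on finhecke.

Lemma hT_in_finhecke i : hT v i \in finhecke_sub.
Proof. by apply: gensubalg_mem; exists i. Qed.

Definition fT (i : 'I_r.-1) : finhecke := Sub (hT v i) (hT_in_finhecke i).

End FiniteHecke.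

Section Coxeter.
Variable r : nat.

(* In 'S_r, s * t maps x to t (s x), the opposite of composition of functions.
   Everything below only uses 'S_r as a Coxeter group, together with the Young
   subgroups and their longest elements, which are stable under inversion, so
   that either convention gives the same modules. *)
Definition simple_refl (i : 'I_r.-1) : 'S_r := tperm (lo i) (hi i).

Definition word_perm (u : seq 'I_r.-1) : 'S_r := (\prod_(i <- u) simple_refl i)%g.

Definition is_reduced_word (w : 'S_r) (u : seq 'I_r.-1) : Prop :=
  word_perm u = w /\ forall u', word_perm u' = w -> (size u <= size u')%N.

(* Choosing one reduced expression is harmless: T_w does not depend on it. *)
Definition redword (w : 'S_r) : seq 'I_r.-1 :=
  xget [::] [set u | is_reduced_word w u]%classic.

Definition len (w : 'S_r) : nat := size (redword w).

(* Subword property: one may fix the reduced expression of [w]. *)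
Definition bruhat_le (y w : 'S_r) : Prop :=
  exists2 u, subseq u (redword w) & word_perm u = y.

(* [reshape_index mu j] is the block of the composition [mu] containing [j]. *)
Definition young (mu : seq nat) : {set 'S_r} :=
  [set w : 'S_r | [forall j : 'I_r, reshape_index mu (w j) == reshape_index mu j]].

Definition young_longest (mu : seq nat) : 'S_r :=
  [arg max_(w > 1%g in young mu) len w]%N.

End Coxeter.

Section TBasis.
Variables (K : fieldType) (v : K) (r : nat) (A : algType K) (T : 'I_r.-1 -> A).

Definition Tw (w : 'S_r) : A := \prod_(i <- redword w) T i.

(* The image of T_w under the bar involution: the product of the inverses
   T_i^-1 = v^-2 (T_i - (v^2 - 1)). *)
Definition Tw_bar (w : 'S_r) : A :=
  \prod_(i <- redword w) (v ^- 2 *: (T i - (v ^+ 2 - 1)%:A)).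

Definition y_elt (mu : seq nat) : A :=
  \sum_(w in young r mu) (- v ^+ 2) ^- len w *: Tw w.

(* The coefficient (-1)^(l(w) - l(y)) q^(l(w)/2 - l(y)) \bar{P} of T_y in C_w,
   with q = v^2 and \bar{P}(q) = P(q^-1). *)
Definition klcoef (u : K) (P : {poly int}) (y w : 'S_r) : K :=
  (-1) ^+ (len w + len y) * u ^ ((len w)%:Z - 2 * (len y)%:Z) *
  (map_poly intr P).[u ^- 2].

Definition klelt (P : {ffun 'S_r * 'S_r -> {poly int}}) (w : 'S_r) : A :=
  \sum_y klcoef v (P (y, w)) y w *: Tw y.

(* The image of [klelt P w] under the bar involution, v |-> v^-1. *)
Definition klelt_bar (P : {ffun 'S_r * 'S_r -> {poly int}}) (w : 'S_r) : A :=
  \sum_y klcoef v^-1 (P (y, w)) y w *: Tw_bar y.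

End TBasis.

Section KazhdanLusztig.
Variable r : nat.

Definition genv : {fraction {poly int}} := tofrac 'X.

(* Kazhdan and Lusztig's theorem: there is exactly one family of polynomials
   P_{y,w} satisfying these conditions, where C_w lives in the generic Hecke
   algebra over Q(v). *)
Definition is_kl_family (P : {ffun 'S_r * 'S_r -> {poly int}}) : Prop :=
  [/\ forall w, P (w, w) = 1,
      forall y w, ~ bruhat_le y w -> P (y, w) = 0,
      forall y w, bruhat_le y w -> y != w ->
        ((size (P (y, w))).*2 <= (len w - len y).+1)%N &
      forall w, klelt genv (fT genv (r := r)) P w =
                klelt_bar genv (fT genv (r := r)) P w].

Definition klpoly : {ffun 'S_r * 'S_r -> {poly int}} :=
  xget [ffun=> 0] [set P | is_kl_family P]%classic.

Definition klC (K : fieldType) (v : K) (w : 'S_r) : finhecke v r :=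
  klelt v (fT v (r := r)) klpoly w.

Definition left_step (x w : 'S_r) : Prop :=
  exists i (c : 'S_r -> {fraction {poly int}}),
    fT genv i * klC genv w = \sum_z c z *: klC genv z /\ c x != 0.

Inductive left_le : 'S_r -> 'S_r -> Prop :=
  | LLrefl w : left_le w w
  | LLstep x y w : left_step x y -> left_le y w -> left_le x w.

Definition left_lt x w : Prop := left_le x w /\ ~ left_le w x.

Variables (K : fieldType) (v : K).

(* The left cell module of the left cell containing [w]. The span of the C_x
   with x <= w is a left ideal, hence equal to the left ideal generated by
   these C_x; likewise for x < w. *)
Definition cell_module (w : 'S_r) : lmodType (finhecke v r) :=
  let le : set (regmod (finhecke v r)) :=
    [set h | exists2 x, left_le x w & h = klC v x]%classic in
  let lt : set (regmod (finhecke v r)) :=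
    [set h | exists2 x, left_lt x w & h = klC v x]%classic in
  subquot (gensub le) (gensub lt).

Definition E_mod (mu : seq nat) : lmodType (finhecke v r) :=
  cell_module (young_longest r mu).

End KazhdanLusztig.

Section Segments.
Variables (K : fieldType) (v : K) (r : nat).

(* A segment is encoded by its center in K^* and its length >= 1. *)
Definition segment := {x : K * nat | (x.1 != 0) && (0 < x.2)%N}.

Definition seg_center (s : segment) : K := (val s).1.
Definition seg_len (s : segment) : nat := (val s).2.

Definition seg_seq (s : segment) : seq K :=
  mkseq (fun i : nat => seg_center s * v ^ (1 - (seg_len s)%:Z + 2 * i%:Z)) (seg_len s).

Record multisegment := Multisegment {
  mseg :> {mset segment}%mset;
  mseg_total : (\sum_(s <- enum_mset mseg) seg_len s)%N = r
}.

(* Juxtaposition of a list of segments of total length [r]. *)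
Definition juxt (t : seq segment) : {ffun 'I_r -> K} :=
  [ffun j : 'I_r => nth 0 (flatten (map seg_seq t)) j].

Definition perm_tuple (b : {ffun 'I_r -> K}) (w : 'S_r) : {ffun 'I_r -> K} :=
  [ffun j => b (w j)].

(* a(s), for the order of the segments given by [enum_mset]. *)
Definition mseg_tuple (s : multisegment) : {ffun 'I_r -> K} := juxt (enum_mset s).

Definition J_ideal (b : {ffun 'I_r -> K}) : submodClosed (regmod (hecke v r)) :=
  gensub (M := regmod (hecke v r)) [set h | exists j, h = hX v j - (b j)%:A]%classic.

Definition M_mod (b : {ffun 'I_r -> K}) : lmodType (hecke v r) := quotmod (J_ideal b).

(* I_{mu,a}, for a list of segments with lengths mu and centers a. *)
Definition I_mod (t : seq segment) : lmodType (hecke v r) :=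
  let b := juxt t in
  let ybar : M_mod b := qpi (J_ideal b) (y_elt v (hT v (r := r)) (map seg_len t)) in
  submod (gensub [set ybar]%classic).

(* V is isomorphic to V_s: the composition factor of I_{mu,a} in which E_mu has
   nonzero multiplicity is unique, and independent of the order chosen for the
   segments of s. *)
Definition is_V (s : multisegment) (V : lmodType (hecke v r)) : Prop :=
  exists t : seq segment,
    [/\ perm_eq t (enum_mset s),
        comp_factor V (I_mod t) &
        comp_factor (E_mod r v (map seg_len t)) (restrict (finhecke_sub v r) V)].

End Segments.

Arguments is_V {K} v {r} s V.

(* Main.v *)
(** Simple modules with different central characters are separated by a central element
    [\prod_j (z - X_j)]: by Cayley-Hamilton (Fitting), every module is the direct sum of a part
    where this element minus a scalar is nilpotent and a part where it is bijective.

    Conversely, let [V] and [V'] have weights [b o w] and [b o w']. Deform [b] to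
    [beta_j = b_j + t^(j+1)] over [K(t)]; the functions on the orbit of [beta] form an irreducible
    module over [K(t)], in which every weight vector generates a lattice over the localization
    [O] of [K[t]] at 0. The lattice generated by the weight vector [w] reduces to [M_(b o w)]
    modulo t. A natural idempotent acts on a weight vector of the lattice modulo t^N by a scalar
    close to 0 or 1, so that these reductions lie in a single summand of any decomposition of the
    category; the lattices of [w] and [w'] being commensurable, it is the same summand. As [V] and
    [V'] are subquotients of [M_(b o w)] and [M_(b o w')], they cannot be separated. *)
Require Import Defs.
From HB Require Import structures.
From mathcomp Require Import all_boot all_order all_algebra all_fingroup.
From mathcomp Require Import boolp classical_sets reals complex.
From mathcomp Require Import generic_quotient fraction multiset ring zify.
Import GRing.Theory.
Local Open Scope ring_scope.
Set Implicit Arguments.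
Unset Strict Implicit.
Unset Printing Implicit Defensive.

(** * Modules, subquotients and decompositions of the category *)

(** A nonzero morphism between [M_(b o w)] and [M_(b o w')] would link only some of their
    indecomposable summands; what has to be excluded is that one of these modules is split between
    the two subcategories. Intertwiners alone give no control over this when two weights coincide or
    have ratio [v^2], and consecutive entries of a segment have exactly that ratio. After the
    deformation no ratio of two distinct [beta_j] is a constant, so that all off-diagonal
    coefficients of [T_i] are nonzero over K(t). The projection onto a summand is natural, hence
    commutes with multiplication by elements of [O], which is an endomorphism of each reduction
    modulo t^N. It thus behaves like an O-linear map, but weights can coincide modulo t, so the
    argument is run modulo t^N and divided back. Each division, by a difference of weights or by an
    off-diagonal coefficient, and each passage between a lattice and coordinates costs at most t^k,
    with one k that does not depend on N; the estimates keep account of this loss, which is made up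
    for by starting from a larger exponent. *)

Section LinearMaps.
Variable A : pzRingType.
Implicit Types L M N : lmodType A.

Lemma linear_of M N (f : M -> N) :
  (forall a x y, f (a *: x + y) = a *: f x + f y) -> exists h : {linear M -> N}, h =1 f.
Proof.
move=> lf; pose m := GRing.isLinear.Build A M N *:%R f lf.
pose h : {linear M -> N} := HB.pack f m.
by exists h.
Qed.

Lemma linear_comp L M N (f : {linear L -> M}) (g : {linear M -> N}) :
  exists h : {linear L -> N}, h =1 g \o f.
Proof. by apply: linear_of => a x y /=; rewrite !linearP. Qed.

Lemma linear_inv M N (f : {linear M -> N}) : bijective f ->
  exists2 g : {linear N -> M}, cancel f g & cancel g f.
Proof.
case=> g fK gK.
have [|h hE] := @linear_of N M g.
  by move=> a x y; apply: (can_inj fK); rewrite linearP !gK.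
by exists h => x; rewrite hE.
Qed.

Lemma lmod_iso_bij M N (f : M -> N) :
  (forall a x y, f (a *: x + y) = a *: f x + f y) ->
  injective f -> (forall y, exists x, f x = y) -> lmod_iso M N.
Proof.
move=> /linear_of[h hE] fi fs; exists h.
have [g gK] := choice fs.
exists g => x; first by apply: fi; rewrite gK hE.
by rewrite hE gK.
Qed.

Lemma submod_of M (S : M -> Prop) :
  S 0 -> (forall a x y, S x -> S y -> S (a *: x + y)) ->
  exists N : submodClosed M, forall m, m \in N <-> S m.
Proof.
move=> S0 Sl; pose p : pred M := fun m => `[< S m >].
have pc : subsemimod_closed p.
  split; first split.
  - exact/asboolP.
  - by move=> x y /asboolP Sx /asboolP Sy; apply/asboolP; rewrite -[x]scale1r; exact: Sl.
  - by move=> a x /asboolP Sx; apply/asboolP; rewrite -[_ *: _]addr0; exact: Sl.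
pose m := GRing.isSubSemiModClosed.Build A M p pc.
pose N : submodClosed M := HB.pack p m.
by exists N => x; split => /asboolP.
Qed.

Lemma lmod_iso_sym M N : lmod_iso M N -> lmod_iso N M.
Proof. by case=> f /linear_inv[g fK gK]; exists g, f. Qed.

Lemma quot_lift M (N : submodClosed M) (L : lmodType A) (g : {linear M -> L}) :
  (forall x, x \in N -> g x = 0) ->
  exists h : {linear quotmod N -> L}, forall x, h (qpi N x) = g x.
Proof.
move=> g0; pose h (q : quotmod N) : L := g (repr q).
have hE x : h (qpi N x) = g x.
  apply/eqP; rewrite -subr_eq0 -linearB; apply/eqP/g0.
  by apply/qpi_eq; exact: qpi_repr.
have [|h' h'E] := @linear_of (quotmod N) L h; last by exists h' => x; rewrite h'E hE.
move=> a p q; rewrite -[p]qpi_repr -[q]qpi_repr.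
by rewrite -[a *: _]/(qscale a _) qscaleE -qpiD !hE linearP.
Qed.

Variables (M : lmodType A) (N1 N2 : submodClosed M).

(** Extended from [N1] to all of [M] by the class of 0, so that terms contain no membership proofs;
    the lemmas below ask for membership where it matters. *)
Definition sqpi (m : M) : subquot N1 N2 := qpi (relsub N1 N2) (insubd 0 m).

Lemma sqpi_insubd a (x y : M) : x \in N1 -> y \in N1 ->
  (insubd (0 : submod N1) (a *: x + y)) = a *: insubd 0 x + insubd 0 y.
Proof.
move=> Nx Ny; apply: val_inj; rewrite linearP /=.
by rewrite !insubdK //; apply: rpredD => //; apply: rpredZ.
Qed.

Lemma sqpiP a (x y : M) : x \in N1 -> y \in N1 ->
  sqpi (a *: x + y) = a *: sqpi x + sqpi y.
Proof.
move=> Nx Ny; rewrite /sqpi sqpi_insubd // qpiD; congr (_ + _).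
by rewrite -[LHS]qscaleE.
Qed.

Lemma sqpi0 : sqpi 0 = 0.
Proof. by have := sqpiP (-1) (rpred0 N1) (rpred0 N1); rewrite scaler0 addr0 scaleN1r addNr. Qed.

Lemma sqpiD (x y : M) : x \in N1 -> y \in N1 -> sqpi (x + y) = sqpi x + sqpi y.
Proof. by move=> Nx Ny; have := sqpiP 1 Nx Ny; rewrite !scale1r. Qed.

Lemma sqpiZ a (x : M) : x \in N1 -> sqpi (a *: x) = a *: sqpi x.
Proof. by move=> Nx; have := sqpiP a Nx (rpred0 N1); rewrite sqpi0 !addr0. Qed.

Lemma sqpi_sum I (s : seq I) (F : I -> M) : (forall i, F i \in N1) ->
  sqpi (\sum_(i <- s) F i) = \sum_(i <- s) sqpi (F i).
Proof.
move=> FN; elim: s => [|i s IH]; first by rewrite !big_nil sqpi0.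
by rewrite !big_cons sqpiD ?IH //; apply: rpred_sum.
Qed.

Lemma sqpi_eq0 (x : M) : x \in N1 -> (sqpi x = 0 <-> x \in N2).
Proof.
move=> Nx; rewrite -sqpi0 /sqpi qpi_eq relsub_predE.
by rewrite raddfB /= !insubdK ?rpred0 // subr0.
Qed.

Lemma sqpi_eq (x y : M) : x \in N1 -> y \in N1 -> (sqpi x = sqpi y <-> x - y \in N2).
Proof.
move=> Nx Ny; rewrite /sqpi qpi_eq relsub_predE.
by rewrite raddfB /= !insubdK.
Qed.

Lemma sqpi_surj (q : subquot N1 N2) : exists2 m, m \in N1 & sqpi m = q.
Proof.
exists (val (repr q)); first exact: valP.
by rewrite /sqpi valKd qpi_repr.
Qed.

Lemma sq_lift (L : lmodType A) (g : M -> L) :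
  (forall a x y, x \in N1 -> y \in N1 -> g (a *: x + y) = a *: g x + g y) ->
  (forall x, x \in N1 -> x \in N2 -> g x = 0) ->
  exists h : {linear subquot N1 N2 -> L}, forall x, x \in N1 -> h (sqpi x) = g x.
Proof.
move=> gl g0.
have gB x y : x \in N1 -> y \in N1 -> g (x - y) = g x - g y.
  by move=> Nx Ny; rewrite addrC -scaleN1r gl // scaleN1r addrC.
pose h (q : subquot N1 N2) : L := g (val (repr q)).
have hE x : x \in N1 -> h (sqpi x) = g x.
  move=> Nx; have [y Ny] : exists2 y, y \in N1 & val (repr (sqpi x)) = y.
    by exists (val (repr (sqpi x))) => //; exact: valP.
  rewrite /h => e; rewrite e; apply/eqP; rewrite -subr_eq0 -gB //.
  apply/eqP/g0; first by rewrite -scaleN1r; apply/rpredD/rpredZ.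
  by apply/(sqpi_eq Ny Nx); rewrite -e /sqpi valKd qpi_repr.
have [|h' h'E] := @linear_of _ _ h; last first.
  by exists h' => x Nx; rewrite h'E hE.
move=> a p q; have [x Nx <-] := sqpi_surj p; have [y Ny <-] := sqpi_surj q.
by rewrite -sqpiP // !hE ?gl //; apply: rpredD => //; apply: rpredZ.
Qed.

End LinearMaps.

Arguments sqpi {A M} N1 N2 m.

(** * Finite dimensional modules over an algebra *)

Section FiniteDimension.
Variables (K : fieldType) (A : algType K).
Implicit Types M N L : lmodType A.

Definition fin_dim M : Prop :=
  exists n (e : 'I_n -> M), forall m, exists c : 'I_n -> K, m = \sum_i (c i)%:A *: e i.

Lemma fin_dim_fin (I : finType) M (e : I -> M) :
  (forall m, exists c : I -> K, m = \sum_i (c i)%:A *: e i) -> fin_dim M.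
Proof.
move=> eM; exists #|I|, (e \o enum_val) => m.
have [c ->] := eM m; exists (c \o enum_val).
by rewrite (reindex (@enum_val _ I)) //; exact/onW_bij/enum_val_bij.
Qed.

Lemma alg_scaleA M (a b : K) (m : M) : a%:A *: (b%:A *: m) = (a * b)%:A *: m.
Proof. by rewrite scalerA -scalerAl mul1r scalerA. Qed.

Lemma alg_cst_comm (k : K) (a : A) : k%:A * a = a * k%:A.
Proof. by rewrite -scalerAl -scalerAr mulr1 mul1r. Qed.

Lemma alg_scaleC M (k : K) (a : A) (m : M) : a *: (k%:A *: m) = k%:A *: (a *: m).
Proof. by rewrite !scalerA alg_cst_comm. Qed.

(* Elimination of the last generator. *)
Lemma fin_dim_subspace M n (e : 'I_n -> M) (S : M -> Prop) :
  S 0 -> (forall (a : K) x y, S x -> S y -> S (a%:A *: x + y)) ->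
  (forall m, S m -> exists c : 'I_n -> K, m = \sum_i (c i)%:A *: e i) ->
  exists e' : 'I_n -> M, (forall i, S (e' i)) /\
    forall m, S m -> exists c : 'I_n -> K, m = \sum_i (c i)%:A *: e' i.
Proof.
elim: n e S => [|n IH] e S S0 Sl SE; first by exists e; split => [[]|].
pose S' m := S m /\ exists c : 'I_n -> K, m = \sum_i (c i)%:A *: e (lift ord_max i).
have [| | | e' [e'S e'E]] := IH (e \o lift ord_max) S'.
- by split=> //; exists (fun=> 0); rewrite big1 // => i _; rewrite !scale0r.
- move=> a x y [Sx [c xE]] [Sy [d yE]]; split; first exact: Sl.
  exists (fun i => a * c i + d i); rewrite xE yE scaler_sumr -big_split /=.
  by apply: eq_bigr => i _; rewrite alg_scaleA scalerDl scalerDl.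
- by move=> m [_ [c ->]]; exists c.
have e'SS i : S (e' i) by have [] := e'S i.
(* An [x] in [S] that involves the last generator serves as pivot and takes the last slot of the new
   family. If there is none, all of [S] satisfies [S'] and the slot is filled with 0. *)
have [[x [Sx [c [c0 xE]]]]|nS] := pselect (exists x, S x /\
    exists c : 'I_n.+1 -> K, c ord_max != 0 /\ x = \sum_i (c i)%:A *: e i); last first.
  exists (fun i => odflt 0 (omap e' (unlift ord_max i))); split.
    by move=> i; case: (unlift _ _) => [j|] /=; [exact: e'SS | exact: S0].
  move=> m Sm; have [|c ->] := e'E m; last first.
    exists (fun i => odflt 0 (omap c (unlift ord_max i))).
    rewrite big_ord_recr /= unlift_none /= scaler0 addr0.
    by apply: eq_bigr => i _; rewrite (_ : widen_ord _ i = lift ord_max i)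
      ?liftK //; apply: val_inj; rewrite /= /bump leqNgt ltn_ord.
  split=> //; have [c mE] := SE m Sm.
  have c0 : c ord_max = 0.
    by apply/eqP/negPn/negP => c0; apply: nS; exists m; split=> //; exists c.
  exists (c \o lift ord_max); rewrite mE big_ord_recr /= c0 !scale0r addr0.
  apply: eq_bigr => i _; rewrite (_ : widen_ord _ i = lift ord_max i) //.
  by apply: val_inj; rewrite /= /bump leqNgt ltn_ord.
exists (fun i => odflt x (omap e' (unlift ord_max i))); split.
  by move=> i; case: (unlift _ _) => [j|] /=; [exact: e'SS | exact: Sx].
move=> m Sm; have [d mE] := SE m Sm; pose k := d ord_max / c ord_max.
have [|d' d'E] := e'E (m - k%:A *: x).
  split; first by rewrite addrC -[X in X + _]scaleNr -scaleNr; exact: Sl.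
  exists (fun i => d (lift ord_max i) - k * c (lift ord_max i)).
  rewrite mE xE !big_ord_recr /= scalerDr alg_scaleA /k divfK // opprD addrACA subrr addr0.
  rewrite scaler_sumr -sumrB; apply: eq_bigr => i _.
  rewrite (_ : widen_ord _ i = lift ord_max i).
    by rewrite alg_scaleA !scalerBl.
  by apply: val_inj; rewrite /= /bump leqNgt ltn_ord.
exists (fun i => odflt k (omap d' (unlift ord_max i))).
rewrite big_ord_recr /= unlift_none /=.
apply/eqP; rewrite -subr_eq; apply/eqP; rewrite d'E.
apply: eq_bigr => i _; rewrite (_ : widen_ord _ i = lift ord_max i) ?liftK //.
by apply: val_inj; rewrite /= /bump leqNgt ltn_ord.
Qed.

Lemma fin_dim_inj M N (i : {linear N -> M}) : injective i -> fin_dim M -> fin_dim N.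
Proof.
move=> ii [n [e eM]].
have [| | | e' [e'S e'E]] := @fin_dim_subspace M n e (fun m => exists x, i x = m).
- by exists 0; rewrite linear0.
- by move=> a _ _ [x <-] [y <-]; exists (a%:A *: x + y); rewrite linearP.
- by move=> m _; exact: eM.
have [f fE] := choice e'S; exists n, f => x.
have [|c xE] := e'E (i x); first by exists x.
exists c; apply: ii; rewrite xE linear_sum.
by apply: eq_bigr => j _; rewrite linearZ fE.
Qed.

End FiniteDimension.

(** * Decompositions of the category into two summands, and blocks *)

Section Categories.
Variables (K : fieldType) (A : algType K).
Implicit Types (P : fdmod A -> Prop) (M N L : fdmod A).

Lemma cat_sum_sym P1 P2 : cat_sum P1 P2 -> cat_sum P2 P1.
Proof.
case=> D H12 H21; split=> [M|M1 M2 f p1 p2|M1 M2 f p1 p2].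
- have [M1 [M2 [p1 p2 [f /linear_inv[g fK gK]]]]] := D M.
  exists M2, M1; split=> //.
  apply: (@lmod_iso_bij _ M (M2 * M1)%type (fun m => ((f m).2, (f m).1))).
  + by move=> a x y; rewrite linearP.
  + move=> x y [e1 e2]; apply: (can_inj fK).
    by rewrite [f x]surjective_pairing [f y]surjective_pairing e1 e2.
  + by move=> [y1 y2]; exists (g (y2, y1)); rewrite gK.
- exact: H21.
- exact: H12.
Qed.

Section Summand.
Variables (P1 P2 : fdmod A -> Prop) (a1 : abelian_subcat P1) (sum12 : cat_sum P1 P2).

(** An isomorphism onto [M] is a kernel of the zero endomorphism of [M]. *)
Lemma absub_iso M L : P1 M -> lmod_iso L M -> P1 L.
Proof.
move=> pM [f fb]; have [z zE] : exists z : {linear M -> M}, z =1 fun=> 0.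
  by apply: linear_of => a x y; rewrite scaler0 addr0.
apply: (absub_ker a1 (f := z) (i := f)) => //; first exact: bij_inj.
by move=> m; rewrite zE; split=> // _; have [g _ gK] := fb; exists (g m).
Qed.

Lemma fd_split M : exists M1 M2 (i1 : {linear M1 -> M}) (i2 : {linear M2 -> M})
    (p1 : {linear M -> M1}) (p2 : {linear M -> M2}),
  [/\ P1 M1 /\ P2 M2, cancel i1 p1 /\ cancel i2 p2,
      (forall x, p2 (i1 x) = 0) /\ (forall x, p1 (i2 x) = 0) &
      forall m, m = i1 (p1 m) + i2 (p2 m)].
Proof.
have [D _ _] := sum12; have [M1 [M2 [P1M P2M [f /linear_inv[g fK gK]]]]] := D M.
have [|i1 i1E] := @linear_of A M1 M (fun x => g (x, 0)).
  move=> a x y; rewrite -linearP; congr (g _).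
  by apply: injective_projections; rewrite /= ?scaler0 ?addr0.
have [|i2 i2E] := @linear_of A M2 M (fun x => g (0, x)).
  move=> a x y; rewrite -linearP; congr (g _).
  by apply: injective_projections; rewrite /= ?scaler0 ?addr0.
have [|p1 p1E] := @linear_of A M M1 (fun x => (f x).1).
  by move=> a x y; rewrite linearP.
have [|p2 p2E] := @linear_of A M M2 (fun x => (f x).2).
  by move=> a x y; rewrite linearP.
exists M1, M2, i1, i2, p1, p2; split=> //.
- by split=> x; rewrite ?p1E ?p2E ?i1E ?i2E gK.
- by split=> x; rewrite ?p1E ?p2E ?i1E ?i2E gK.
- move=> m; rewrite i1E i2E p1E p2E -raddfD /= -[LHS]fK; congr (g _).
  by apply: injective_projections; rewrite /= ?addr0 ?add0r.
Qed.

(** No nonzero morphism joins the two subcategories, so the off-diagonal entries of [h] vanish. This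
    is the naturality of the projection. *)
Lemma fd_split_natural M M1 M2 (i1 : {linear M1 -> M}) (i2 : {linear M2 -> M})
    (p1 : {linear M -> M1}) (p2 : {linear M -> M2}) (h : {linear M -> M}) :
  P1 M1 -> P2 M2 -> (forall m, m = i1 (p1 m) + i2 (p2 m)) ->
  forall m, h (i1 (p1 m)) = i1 (p1 (h m)).
Proof.
move=> P1M P2M ME m; have [_ H12 H21] := sum12.
have [|h12 h12E] := @linear_of A M1 M2 (p2 \o h \o i1).
  by move=> a x y /=; rewrite !linearP.
have [|h21 h21E] := @linear_of A M2 M1 (p1 \o h \o i2).
  by move=> a x y /=; rewrite !linearP.
have e12 x : p2 (h (i1 x)) = 0 by rewrite -[LHS]h12E; exact: H12.
have e21 x : p1 (h (i2 x)) = 0 by rewrite -[LHS]h21E; exact: H21.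
rewrite [X in _ = i1 (p1 (h X))]ME !linearD e21 linear0 addr0.
by rewrite [LHS]ME e12 linear0 addr0.
Qed.

Lemma summand_both M : P1 M -> P2 M -> zero_mod M.
Proof.
move=> p1 p2 m; have [_ H _] := sum12.
have [h hE] := @linear_of A M M id (fun _ _ _ => erefl).
by rewrite -[m]hE (H M M h).
Qed.

(** Closure under subobjects is not among the axioms of [abelian_subcat]; it comes from the
    decomposition, since the [P2]-part of [L] maps by zero to [M] and at the same time
    injectively. *)
Lemma summand_sub M L (i : {linear L -> M}) : injective i -> P1 M -> P1 L.
Proof.
move=> ii pM; have [L1 [L2 [i1 [i2 [p1 [p2 [[P1L P2L] [i1K i2K] [_ p12] LE]]]]]]] := fd_split L.
have [_ _ H] := sum12.
have [|h hE] := @linear_of A L2 M (i \o i2).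
  by move=> a x y /=; rewrite !linearP.
have z x : i2 x = 0.
  by apply: ii; rewrite linear0 -[LHS]hE; exact: H.
apply: (absub_iso P1L); exists p1; exists i1 => // x.
by rewrite [RHS]LE z addr0.
Qed.

Lemma summand_quot M L (p : {linear M -> L}) : (forall y, exists x, p x = y) ->
  P1 M -> P1 L.
Proof.
move=> ps pM; have [L1 [L2 [i1 [i2 [p1 [p2 [[P1L P2L] [i1K i2K] [_ p12] LE]]]]]]] := fd_split L.
have [_ H _] := sum12.
have [|h hE] := @linear_of A M L2 (p2 \o p).
  by move=> a x y /=; rewrite !linearP.
have z y : p2 y = 0.
  by have [x <-] := ps y; rewrite -[LHS]hE; exact: H.
apply: (absub_iso P1L); exists p1; exists i1 => // x.
by rewrite [RHS]LE z linear0 addr0.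
Qed.

End Summand.

(** The hypothesis is applied to the projection onto the [P1]-part of [M]. If [rho] kills its image,
    [N] is a quotient of the [P2]-part, otherwise of the [P1]-part. The module [M] itself may be
    split; only its quotient [N] is claimed to lie on one side. *)
Lemma summand_idempotent P1 P2 M N (rho : {linear M -> N}) :
  abelian_subcat P1 -> abelian_subcat P2 -> cat_sum P1 P2 ->
  (forall y, exists x, rho x = y) ->
  (forall e : {linear M -> M}, (forall x, e (e x) = e x) ->
    (forall (h : {linear M -> M}) x, h (e x) = e (h x)) ->
    (forall x, rho (e x) = 0) \/ (forall x, rho (e x) = rho x)) ->
  P1 N \/ P2 N.
Proof.
move=> a1 a2 s12 rho_surj H.
have [M1 [M2 [i1 [i2 [p1 [p2 [[P1M P2M] [i1K i2K] [p21 p12] ME]]]]]]] := fd_split s12 M.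
have [e eE] := linear_comp p1 i1.
case: (H e) => [x|h x|re|re].
- by rewrite !eE /= i1K.
- by rewrite !eE; exact: fd_split_natural s12 _ _ _ _ _ _ _ h P1M P2M ME x.
- right; have [h hE] := linear_comp i2 rho.
  apply: (summand_quot a2 (cat_sum_sym s12) (p := h) _ P2M) => y.
  have [x <-] := rho_surj y; exists (p2 x); rewrite hE /=.
  by rewrite [in RHS](ME x) linearD -[i1 _]eE re add0r.
left; have [h hE] := linear_comp i1 rho.
apply: (summand_quot a1 s12 (p := h) _ P1M) => y.
by have [x <-] := rho_surj y; exists (p1 x); rewrite hE /= -[i1 _]eE re.
Qed.

Lemma simple_indecomposable M : simple_mod M -> indecomposable M.
Proof.
case=> [[m0 m0_neq0] simM]; split=> [z|M1 M2 [f /linear_inv[g fK gK]]].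
  by rewrite (z m0) eqxx in m0_neq0.
have [| |N NE] := @submod_of A M (fun m => (f m).1 = 0).
- by rewrite linear0.
- by move=> a x y x0 y0; rewrite linearP /= x0 y0 scaler0 addr0.
have [N0|NT] := simM N; [right | left] => y.
  have /N0/(congr1 (fun m => (f m).2)) : g (0, y) \in N by apply/NE; rewrite gK.
  by rewrite gK linear0.
by have /NE := NT (g (y, 0)); rewrite gK.
Qed.

Lemma direct_sum_id M : direct_sum (fun _ : 'I_1 => M) M.
Proof.
have [h hE] := @linear_of A M M id (fun _ _ _ => erefl).
exists (fun _ => h), (fun _ => h); split=> [i x|i j x|m].
- by rewrite !hE.
- by rewrite !ord1.
- by rewrite big_ord1 !hE.
Qed.

(** As [linked] means that no decomposition separates the two objects, the block of [M] contains
    both. *)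
Lemma same_block_simple M N : simple_mod M -> simple_mod N ->
  (forall P1 P2, abelian_subcat P1 -> abelian_subcat P2 -> cat_sum P1 P2 ->
    P1 M -> P2 N -> False) ->
  same_block M N.
Proof.
move=> sM sN H; have [iM iN] := (simple_indecomposable sM, simple_indecomposable sN).
have blockM L : indecomposable L -> linked M L -> block_of M L.
  by move=> iL lL; exists 1, (fun=> L); split=> //; exact: direct_sum_id.
exists (block_of M); split; first by exists M.
  apply: blockM => // -[P1 [P2 [a1 a2 s12 p1 p2]]].
  exact: iM.1 (summand_both s12 p1 p2).
by apply: blockM => // -[P1 [P2 [a1 a2 s12 p1 p2]]]; exact: H p1 p2.
Qed.

Lemma indecomposable_summand P1 P2 M :
  abelian_subcat P1 -> abelian_subcat P2 -> cat_sum P1 P2 ->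
  indecomposable M -> P1 M \/ P2 M.
Proof.
move=> a1 a2 s12 [_ ind].
have [M1 [M2 [i1 [i2 [p1 [p2 [[P1M P2M] [i1K i2K] [p21 p12] ME]]]]]]] := fd_split s12 M.
have [|z|z] := ind M1 M2.
- apply: (@lmod_iso_bij A M (M1 * M2)%type (fun m => (p1 m, p2 m))).
  + by move=> a x y; rewrite !linearP.
  + by move=> x y [e1 e2]; rewrite [x]ME [y]ME e1 e2.
  + move=> [y1 y2]; exists (i1 y1 + i2 y2).
    by rewrite !linearD i1K i2K p21 p12 addr0 add0r.
- right; apply: (absub_iso a2 P2M); exists p2; exists i2 => // m.
  by rewrite [RHS]ME (z (p1 m)) linear0 add0r.
- left; apply: (absub_iso a1 P1M); exists p1; exists i1 => // m.
  by rewrite [RHS]ME (z (p2 m)) linear0 addr0.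
Qed.

Lemma direct_sum_injective n (N : 'I_n -> fdmod A) M i :
  direct_sum N M -> exists h : {linear N i -> M}, injective h.
Proof.
case=> inj [prj [K1 _ _]]; exists (inj i).
exact: can_inj (K1 i).
Qed.

Lemma direct_sum_zero (N : 'I_0 -> fdmod A) M : direct_sum N M -> zero_mod M.
Proof. by case=> inj [prj [_ _ E]] m; rewrite [m]E big_ord0. Qed.

(** The indecomposable [X] that defines the block lies in [P1] or in [P2]. The opposite side
    contains a summand of [N] or of [M] respectively, which is therefore not linked to [X]. *)
Lemma not_same_block P1 P2 M N :
  abelian_subcat P1 -> abelian_subcat P2 -> cat_sum P1 P2 ->
  ~ zero_mod M -> ~ zero_mod N -> P1 M -> P2 N -> ~ same_block M N.
Proof.
move=> a1 a2 s12 M0 N0 p1 p2 [P [[X iX PE] /PE [m [Ms [MsX dM]]] /PE [n [Ns [NsX dN]]]]].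
have s21 := cat_sum_sym s12.
(* The empty direct sum belongs to every block; it is excluded because [M] and [N] are nonzero. *)
case: m Ms MsX dM => [|m] Ms MsX dM; first exact: M0 (direct_sum_zero dM).
case: n Ns NsX dN => [|n] Ns NsX dN; first exact: N0 (direct_sum_zero dN).
have [pX|pX] := indecomposable_summand a1 a2 s12 iX.
  have [_] := NsX ord0; apply; exists P1, P2; split=> //.
  by have [h hi] := direct_sum_injective ord0 dN; exact: summand_sub a2 s21 _ _ _ hi p2.
have [_] := MsX ord0; apply; exists P2, P1; split=> //.
by have [h hi] := direct_sum_injective ord0 dM; exact: summand_sub a1 s12 _ _ _ hi p1.
Qed.

End Categories.

(** * Fitting decomposition along a central element *)

Section Fitting.
Variables (K : fieldType) (A : algType K) (c : A).
Hypothesis c_central : forall a, c * a = a * c.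
Implicit Types M N L : fdmod A.

Definition nilpotent_on M : Prop := exists k, forall m : M, c ^+ k *: m = 0.

Definition bijective_on M : Prop :=
  (forall m : M, c *: m = 0 -> m = 0) /\ (forall m : M, exists m', m = c *: m').

Lemma bijective_on_exp M k : bijective_on M ->
  (forall m : M, c ^+ k *: m = 0 -> m = 0) /\ (forall m : M, exists m', m = c ^+ k *: m').
Proof.
case=> ci cs; elim: k => [|k [IHi IHs]].
  by split=> m; [rewrite scale1r | exists m; rewrite scale1r].
split=> m; first by rewrite exprS -scalerA => /ci/IHi.
have [m' ->] := cs m; have [m'' ->] := IHs m'.
by exists m''; rewrite exprS scalerA.
Qed.

Lemma nilpotent_on_leq M k l : (k <= l)%N ->
  (forall m : M, c ^+ k *: m = 0) -> forall m : M, c ^+ l *: m = 0.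
Proof. by move=> kl ck m; rewrite -(subnK kl) exprD -scalerA ck scaler0. Qed.

Lemma nilpotent_subcat : abelian_subcat nilpotent_on.
Proof.
split.
- by move=> M M0; exists 0 => m; rewrite (M0 m) scaler0.
- move=> M N L [k ck] [l cl] [f [g fK _]]; exists (maxn k l) => m.
  apply: (can_inj fK); rewrite linearZ_LR linear0.
  by apply: injective_projections => /=;
    [apply: nilpotent_on_leq ck _; rewrite leq_maxl
    |apply: nilpotent_on_leq cl _; rewrite leq_maxr].
- move=> M N f L i [k ck] _ ii _; exists k => x.
  by apply: ii; rewrite linearZ_LR ck linear0.
- move=> M N f L p _ [k ck] ps _; exists k => y.
  by have [x <-] := ps y; rewrite -linearZ_LR ck linear0.
Qed.

Lemma bijective_subcat : abelian_subcat bijective_on.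
Proof.
split.
- move=> M M0; split=> [m _|m]; first exact: M0.
  by exists 0; rewrite (M0 m) scaler0.
- move=> M N L [ci cs] [di ds] [f [g fK gK]]; split=> m.
    move=> /(congr1 f); rewrite linearZ_LR linear0 => -[/ci e1 /di e2].
    by apply: (can_inj fK); rewrite linear0; apply: injective_projections.
  have [[m1 e1] [m2 e2]] := (cs (f m).1, ds (f m).2).
  exists (g (m1, m2)); apply: (can_inj fK); rewrite linearZ_LR gK.
  by apply: injective_projections; rewrite /= ?e1 ?e2.
- move=> M N f L i [ci cs] [di _] ii iE; split=> x.
    by move=> cx; apply: ii; rewrite linear0; apply: ci; rewrite -linearZ_LR cx linear0.
  have [m mE] := cs (i x).
  have [|y yE] := (iE m).1; last by exists y; apply: ii; rewrite linearZ_LR yE.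
  by apply: di; rewrite -linearZ_LR -mE; apply/iE; exists x.
- move=> M N f L p [_ cs] [di ds] ps pE; split=> y; have [x <-] := ps y.
    rewrite -linearZ_LR => /pE[m]; have [m' ->] := cs m.
    rewrite linearZ_LR => /eqP; rewrite -subr_eq0 -scalerBr => /eqP/di/eqP.
    by rewrite subr_eq0 => /eqP xE; apply/pE; exists m'.
  by have [x' ->] := ds x; exists (p x'); rewrite linearZ_LR.
Qed.

(** The [e i] only generate, so [Bm] is one of possibly many matrices describing [c]. It suffices
    that the surjection [f] from row vectors carries multiplication by [Bm] to the action of [c]:
    Cayley-Hamilton for [Bm] is then pushed forward along [f]. *)
Lemma horner_alg_annihilates M :
  exists2 p : {poly K}, p != 0 & forall m : M, horner_alg c p *: m = 0.
Proof.
have [[|n] [e eM]] := fd_dim M.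
  exists 1; first exact: oner_neq0.
  by move=> m; have [d ->] := eM m; rewrite big_ord0 scaler0.
have [B BE] := choice (fun i => eM (c *: e i)).
pose Bm : 'M[K]_n.+1 := \matrix_(i, j) B i j.
pose f (x : 'rV[K]_n.+1) : M := \sum_j (x 0 j)%:A *: e j.
have fD a x y : f (a *: x + y) = a%:A *: f x + f y.
  rewrite /f scaler_sumr -big_split; apply: eq_bigr => j _ /=.
  by rewrite alg_scaleA !mxE scalerDl scalerDl.
have cf x : c *: f x = f (x *m Bm).
  transitivity (\sum_i \sum_j (x 0 i * B i j)%:A *: e j).
    rewrite scaler_sumr; apply: eq_bigr => i _.
    rewrite scalerA c_central -scalerA BE scaler_sumr.
    by apply: eq_bigr => j _; rewrite alg_scaleA.
  rewrite exchange_big; apply: eq_bigr => j _; rewrite mxE scaler_suml scaler_suml.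
  by apply: eq_bigr => i _; rewrite !mxE.
have pf p x : horner_alg c p *: f x = f (x *m horner_mx Bm p).
  elim/poly_ind: p x => [|p a IH] x.
    rewrite !rmorph0 scale0r mulmx0 /f.
    by rewrite big1 // => j _; rewrite mxE scale0r scale0r.
  rewrite rmorphD rmorphM /= horner_algX horner_algC scalerDl -scalerA cf IH.
  rewrite commr_polyX rmorphD rmorphM /= horner_mx_X horner_mx_C mulmxDr mul_mx_scalar.
  by rewrite [X in _ = f X]addrC fD addrC mulmxA.
exists (char_poly Bm); first by rewrite monic_neq0 // char_poly_monic.
move=> m; have [d mE] := eM m.
have -> : m = f (\row_j d j) by rewrite mE; apply: eq_bigr => j _; rewrite mxE.
rewrite pf Cayley_Hamilton mulmx0 /f.
by rewrite big1 // => j _; rewrite mxE scale0r scale0r.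
Qed.

Lemma horner_alg_central p a : horner_alg c p * a = a * horner_alg c p.
Proof.
elim/poly_ind: p => [|p k IH]; first by rewrite rmorph0 mul0r mulr0.
rewrite rmorphD rmorphM /= horner_algX horner_algC mulrDl mulrDr -mulrA c_central !mulrA IH.
by rewrite -scalerAl -scalerAr mul1r mulr1.
Qed.

Lemma ker_central M (a : A) : (forall b, a * b = b * a) ->
  exists L (i : {linear L -> M}), injective i /\ forall m, (exists x, i x = m) <-> a *: m = 0.
Proof.
move=> ac; have [| |N NE] := @submod_of A M (fun m => a *: m = 0).
- exact: scaler0.
- by move=> b x y x0 y0; rewrite scalerDr y0 addr0 scalerA ac -scalerA x0 scaler0.
have [|i iE] := @linear_of A (submod N) M val; first by move=> b x y; rewrite linearP.
have ii : injective i by move=> x y; rewrite !iE; exact: val_inj.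
exists (FdMod (fin_dim_inj ii (fd_dim M))), i; split=> // m; split.
  by case=> x <-; apply/NE; rewrite iE; exact: valP.
by move=> /NE mN; exists (Sub m mN); rewrite iE.
Qed.

(** An annihilating polynomial is written as q X^k with q(0) nonzero. The Bezout relation u X^k + w
    q = 1 splits [M] into the kernels of c^k and of q(c). On the latter [c] is invertible: with q =
    q1 X + d the inverse is - q1(c) / d. *)
Lemma nilpotent_bijective_sum : cat_sum nilpotent_on bijective_on.
Proof.
split=> [M|M N f [k ck] bN m|M N f [k ck] bN m]; last 2 first.
- by apply: (bijective_on_exp k bN).1; rewrite -linearZ_LR ck linear0.
- by have [m' ->] := (bijective_on_exp k bN).2 m; rewrite linearZ_LR ck.
have [p p0 pM] := horner_alg_annihilates M.
have [k [q]] := multiplicity_XsubC p 0; rewrite p0 /= subr0 => q0 pE.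
have [[u w] /= uw] : exists x, x.1 * 'X ^+ k + x.2 * q = 1.
  apply/Bezout_eq1_coprimepP/coprimep_expl.
  by rewrite coprimep_sym -['X]subr0 coprimep_XsubC.
pose h := horner_alg c.
have hXk : h ('X ^+ k) = c ^+ k by rewrite /h rmorphXn /= horner_algX.
have [M1 [i1 [i1i i1E]]] := ker_central M (horner_alg_central ('X ^+ k)).
have [M2 [i2 [i2i i2E]]] := ker_central M (horner_alg_central q).
have i1_0 x : h ('X ^+ k) *: i1 x = 0 by apply/i1E; exists x.
have i2_0 x : h q *: i2 x = 0 by apply/i2E; exists x.
have kq m : h ('X ^+ k) *: (h q *: m) = 0 :> M.
  by rewrite /h scalerA -rmorphM mulrC -pE.
have uwE m : m = h u *: (h ('X ^+ k) *: m) + h w *: (h q *: m) :> M.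
  by rewrite /h !scalerA -!rmorphM -scalerDl -rmorphD uw rmorph1 scale1r.
exists M1, M2; split.
- exists k => x; apply: i1i; rewrite linearZ_LR linear0.
  by rewrite -[RHS](i1_0 x) hXk.
- have [d [q1 [d0 q1E]]] : exists d q1, d != 0 /\ q = q1 * 'X + d%:P.
    move: q0; elim/poly_ind: (q) => [|q1 d _]; first by rewrite root0.
    by rewrite rootE hornerMXaddC mulr0 add0r => d0; exists d, q1.
  have dE x : x = c *: ((- d^-1)%:A *: (h q1 *: x)) :> M2.
    have : h q *: x = 0 by apply: i2i; rewrite linearZ_LR i2_0 linear0.
    rewrite q1E /h rmorphD rmorphM /= horner_algX horner_algC scalerDl => /eqP.
    rewrite addr_eq0 -c_central -scalerA => /eqP e.
    have -> : c *: ((- d^-1)%:A *: (h q1 *: x)) = (- d^-1)%:A *: (c *: (h q1 *: x)).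
      by rewrite !scalerA c_central.
    by rewrite -/h e scalerN scaleNr scaleNr opprK alg_scaleA mulVf // scale1r scale1r.
  split=> x; last by eexists; exact: dE.
  move=> cx; rewrite (dE x) !scalerA.
  by rewrite -mulrA c_central -scalerA cx scaler0.
- apply: lmod_iso_sym.
  apply: (@lmod_iso_bij A (M1 * M2)%type M (fun x => i1 x.1 + i2 x.2)).
  + by move=> a x y; rewrite /= !linearP scalerDr addrACA.
  + move=> [x1 x2] [y1 y2] /= /eqP; rewrite -subr_eq0 opprD addrACA -!linearB => /eqP e.
    have z1 : i1 (x1 - y1) = 0.
      rewrite [LHS]uwE i1_0 scaler0 add0r.
      by rewrite -[i1 _](addrK (i2 (x2 - y2))) e sub0r scalerN i2_0 oppr0 scaler0.
    move: e; rewrite z1 add0r -[RHS](linear0 i2) => /i2i/eqP; rewrite subr_eq0 => /eqP->.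
    by move: z1; rewrite -[RHS](linear0 i1) => /i1i/eqP; rewrite subr_eq0 => /eqP->.
  (* The Bezout terms cross over: the term with [q] is killed by X^k and the term with X^k is killed
     by [q]. *)
  + move=> m; have [|x1 x1E] := (i1E (h w *: (h q *: m))).2.
      by rewrite -/h scalerA -horner_alg_central -scalerA kq ?scaler0.
    have [|x2 x2E] := (i2E (h u *: (h ('X ^+ k) *: m))).2.
      have qk : h q * h ('X ^+ k) = h ('X ^+ k) * h q by rewrite horner_alg_central.
      by rewrite -/h scalerA horner_alg_central -scalerA [h q *: _]scalerA qk -scalerA kq ?scaler0.
    by exists (x1, x2); rewrite /= x1E x2E addrC -uwE.
Qed.

End Fitting.

(** * The affine Hecke algebra *)

Lemma prod_commuting_rem (R : pzRingType) (I : eqType) (F : I -> R) (s : seq I) i :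
  (forall j k, GRing.comm (F j) (F k)) -> i \in s ->
  \prod_(j <- s) F j = F i * \prod_(j <- rem i s) F j.
Proof.
move=> cF; elim: s => // j s IH; rewrite inE /=.
have [->|ji] := eqVneq j i; first by rewrite big_cons.
by rewrite /= => /IH e; rewrite !big_cons e mulrA cF -mulrA.
Qed.

Section QuadraticCommutation.
Variables (K : fieldType) (A : algType K) (q : K) (T X X' : A).
Hypotheses (q_neq0 : q != 0) (Tsq : T * T = (q - 1) *: T + q%:A) (TXT : T * X * T = q *: X').

(** Expanding [T * T] in [T * (T * X * T)] isolates [X * T] without inverting [T]; multiplying on
    the right instead gives the companion rule. *)
Lemma quad_commute_lo : X * T = T * X' - (q - 1) *: X'.
Proof.
apply: (scalerI q_neq0).
have -> : q *: (X * T) = T * (T * X * T) - (q - 1) *: (T * X * T).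
  by rewrite !mulrA Tsq [_ * X]mulrDl [_ * T in RHS]mulrDl -!scalerAl mul1r addrAC subrr add0r.
by rewrite TXT -scalerAr scalerBr !scalerA [q * _]mulrC.
Qed.

Lemma quad_commute_hi : X' * T = T * X + (q - 1) *: X'.
Proof.
apply: (scalerI q_neq0); rewrite scalerAl -TXT -[LHS]mulrA Tsq mulrDr -!scalerAr mulr1 TXT.
by rewrite scalerDr !scalerA [q * _]mulrC addrC.
Qed.

End QuadraticCommutation.

Section HeckeRelations.
Variables (K : fieldType) (v : K) (r : nat).
Hypothesis v_neq0 : v != 0.
Local Notation A := (hecke v r).
Local Notation T := (@hT K v r).
Local Notation X := (@hX K v r).
Local Notation XV := (@hXV K v r).
Local Notation q := (v ^+ 2).

Lemma ppi_cst (a : K) : ppi (@hecke_rel K v r) (Cst _ a) = (a%:A : A).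
Proof. by rewrite palg_scaleE mulr1. Qed.

Lemma hecke_ind (P : A -> Prop) :
  (forall a, P a%:A) -> (forall i, P (T i)) -> (forall j, P (X j)) -> (forall j, P (XV j)) ->
  (forall a b, P a -> P b -> P (a + b)) -> (forall a b, P a -> P b -> P (a * b)) ->
  forall a, P a.
Proof.
move=> Pc PT PX PXV PD PM a; rewrite -[a]ppi_repr.
elim: (repr a) => [c|[i|j|j]|x IHx y IHy|x IHx y IHy].
- by rewrite ppi_cst.
- exact: PT.
- exact: PX.
- exact: PXV.
- by rewrite ppiD; exact: PD.
- by rewrite ppiM; exact: PM.
Qed.

Lemma hecke_relE x y : hecke_rel v x y ->
  ppi (@hecke_rel K v r) x = ppi (@hecke_rel K v r) y.
Proof. by move=> xy; apply/ppiP; exact: PCrel. Qed.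

Lemma hT_sq i : T i * T i = (q - 1) *: T i + q%:A.
Proof.
have : (T i + 1%:A) * (T i + (- q)%:A) = 0%:A :> A.
  by rewrite -!ppi_cst; have := hecke_relE (HRquad v i); rewrite ppiM !ppiD.
rewrite scale1r scale0r mulrDl !mulrDr -!scalerAr !mulr1 !mul1r => e.
apply/eqP; rewrite -subr_eq0 -[X in _ == X]e opprD scalerBl opprB scale1r !scaleNr -!addrA.
by rewrite [X in _ + X]addrCA.
Qed.

Lemma hT_braid (i j : 'I_r.-1) : j = i.+1 :> nat -> T i * T j * T i = T j * T i * T j.
Proof. by move=> ij; have := hecke_relE (HRbraid v ij); rewrite !ppiM. Qed.

Lemma hT_comm (i j : 'I_r.-1) : (i.+1 < j)%N \/ (j.+1 < i)%N -> T i * T j = T j * T i.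
Proof. by move=> ij; have := hecke_relE (HRTT v ij); rewrite !ppiM. Qed.

Lemma hXXV j : X j * XV j = 1.
Proof. by have := hecke_relE (HRXV v j); rewrite !ppiM ppi_cst scale1r. Qed.

Lemma hXVX j : XV j * X j = 1.
Proof. by have := hecke_relE (HRVX v j); rewrite !ppiM ppi_cst scale1r. Qed.

Lemma hXX i j : X i * X j = X j * X i.
Proof. by have := hecke_relE (HRXX v i j); rewrite !ppiM. Qed.

Lemma hXT i j : j != lo i -> j != hi i -> X j * T i = T i * X j.
Proof. by move=> jl jh; have := hecke_relE (HRXT v jl jh); rewrite !ppiM. Qed.

Lemma hTXT i : T i * X (lo i) * T i = q *: X (hi i).
Proof. by have := hecke_relE (HRTXT v i); rewrite !ppiM. Qed.

Lemma q_neq0 : q != 0. Proof. by rewrite expf_neq0. Qed.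

Lemma hXT_lo i : X (lo i) * T i = T i * X (hi i) - (q - 1) *: X (hi i).
Proof. exact: (quad_commute_lo q_neq0 (hT_sq i) (hTXT i)). Qed.

Lemma hXT_hi i : X (hi i) * T i = T i * X (lo i) + (q - 1) *: X (hi i).
Proof. exact: (quad_commute_hi q_neq0 (hT_sq i) (hTXT i)). Qed.

Lemma hXVT_lo i : XV (lo i) * T i = T i * XV (hi i) + (q - 1) *: XV (lo i).
Proof.
have : XV (lo i) * (X (lo i) * T i) * XV (hi i) =
       XV (lo i) * (T i * X (hi i) - (q - 1) *: X (hi i)) * XV (hi i) by rewrite hXT_lo.
rewrite mulrA hXVX mul1r mulrBr mulrBl -scalerAr -scalerAl -!mulrA hXXV !mulr1 => ->.
by rewrite addrNK.
Qed.

Lemma hXVT_hi i : XV (hi i) * T i = T i * XV (lo i) - (q - 1) *: XV (lo i).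
Proof.
have : XV (hi i) * (X (hi i) * T i) * XV (lo i) =
       XV (hi i) * (T i * X (lo i) + (q - 1) *: X (hi i)) * XV (lo i) by rewrite hXT_hi.
rewrite mulrA hXVX mul1r mulrDr mulrDl -scalerAr -scalerAl hXVX mul1r -!mulrA hXXV !mulr1 => ->.
by rewrite addrK.
Qed.

Lemma hXVT i j : j != lo i -> j != hi i -> XV j * T i = T i * XV j.
Proof.
move=> jl jh; rewrite -[LHS]mulr1 -(hXXV j) !mulrA -[_ * X j]mulrA -(hXT jl jh).
by rewrite mulrA hXVX mul1r.
Qed.

(** The spanning argument needs no more than this shape: a letter [X] crosses [T i] up to a term
    that no longer contains [T i]. *)
Lemma hXT_ex i j : exists j' j'' (k : K), X j * T i = T i * X j' + k *: X j''.
Proof.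
have [->|jl] := eqVneq j (lo i).
  by exists (hi i), (hi i), (- (q - 1)); rewrite scaleNr hXT_lo.
have [->|jh] := eqVneq j (hi i); first by exists (lo i), (hi i), (q - 1); rewrite hXT_hi.
by exists j, j, 0; rewrite scale0r addr0 hXT.
Qed.

Lemma hXVT_ex i j : exists j' j'' (k : K), XV j * T i = T i * XV j' + k *: XV j''.
Proof.
have [->|jl] := eqVneq j (lo i).
  by exists (hi i), (lo i), (q - 1); rewrite hXVT_lo.
have [->|jh] := eqVneq j (hi i).
  by exists (lo i), (lo i), (- (q - 1)); rewrite scaleNr hXVT_hi.
by exists j, j, 0; rewrite scale0r addr0 hXVT.
Qed.

Lemma lo_neq_hi (i : 'I_r.-1) : lo i != hi i.
Proof. by rewrite -val_eqE /= neq_ltn ltnSn. Qed.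

(** The sum and the product of [X (lo i)] and [X (hi i)] commute with [T i], and the two factors
    multiply to a polynomial in these. *)
Lemma hXhX_hT (z : K) i :
  T i * ((z%:A - X (lo i)) * (z%:A - X (hi i))) =
  (z%:A - X (lo i)) * (z%:A - X (hi i)) * T i.
Proof.
have XX : T i * (X (lo i) * X (hi i)) = X (lo i) * X (hi i) * T i.
  rewrite -[RHS]mulrA hXT_hi mulrDr -scalerAr [X (lo i) * (_ * _)]mulrA hXT_lo mulrBl -scalerAl.
  by rewrite -[T i * _ * _]mulrA [X (hi i) * _]hXX addrNK.
have XD : T i * (X (lo i) + X (hi i)) = (X (lo i) + X (hi i)) * T i.
  by rewrite mulrDr mulrDl hXT_lo hXT_hi [X in _ = _ - _ + X]addrC addrA addrNK addrC.
have -> : (z%:A - X (lo i)) * (z%:A - X (hi i)) =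
    (z * z)%:A - z *: (X (lo i) + X (hi i)) + X (lo i) * X (hi i).
  rewrite mulrBl !mulrBr -scalerAl mul1r scalerA -scalerAl mul1r -scalerAr mulr1.
  by rewrite scalerDr !opprD opprK !addrA; congr (_ + _); rewrite addrAC.
by rewrite mulrDr mulrDl mulrBr mulrBl alg_cst_comm XX -[T i * (z *: _)]scalerAr XD -scalerAl.
Qed.

Definition char_X (z : K) : A := \prod_j (z%:A - X j).

Lemma char_X_central z a : char_X z * a = a * char_X z.
Proof.
have cF j k : GRing.comm (z%:A - X j) (z%:A - X k).
  apply: commrB; first by apply: commr_sym; exact: alg_cst_comm.
  apply: commr_sym; apply: commrB; last exact: hXX.
  by apply: commr_sym; exact: alg_cst_comm.
have cX j : GRing.comm (X j) (char_X z).
  apply: commr_prod => k _; apply: commrB; last exact: hXX.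
  by apply: commr_sym; exact: alg_cst_comm.
elim/hecke_ind: a => [c|i|j|j|a b IHa IHb|a b IHa IHb].
- by rewrite alg_cst_comm.
(* The factors at [lo i] and [hi i] are brought to the front and cross [T i] as a pair; each
   remaining factor commutes with [T i]. *)
- rewrite /char_X (prod_commuting_rem cF (mem_index_enum (lo i))).
  have hi_rem : hi i \in rem (lo i) (index_enum 'I_r).
    by rewrite mem_rem_uniq ?index_enum_uniq // !inE mem_index_enum eq_sym lo_neq_hi.
  rewrite (prod_commuting_rem cF hi_rem) mulrA mulrA hXhX_hT -!mulrA; do 2!congr (_ * _).
  apply: commr_sym; rewrite big_seq; apply: commr_prod => j.
  rewrite !mem_rem_uniq ?rem_uniq ?index_enum_uniq // !inE => /andP[jh].
  rewrite mem_rem_uniq ?index_enum_uniq // !inE => /andP[jl _].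
  apply: commrB; first by apply: commr_sym; exact: alg_cst_comm.
  by apply: commr_sym; exact: hXT.
- exact: (esym (cX j)).
- rewrite -[LHS]mul1r -(hXVX j) -!mulrA; congr (_ * _).
  by rewrite [LHS]mulrA [X j * _](cX j) -mulrA hXXV mulr1.
- by rewrite mulrDl mulrDr IHa IHb.
- by rewrite mulrA IHa -mulrA IHb mulrA.
Qed.

(* Out of range, [nT i] has the junk value 1. *)
Definition nT (i : nat) : A := if insub i is Some k then T k else 1.

Lemma nT_ord (i : 'I_r.-1) : nT i = T i.
Proof. by rewrite /nT valK. Qed.

Lemma nT_lt i (ir : (i < r.-1)%N) : nT i = T (Ordinal ir).
Proof. exact: nT_ord (Ordinal ir). Qed.

Lemma nT_sq i : (i < r.-1)%N -> nT i * nT i = (q - 1) *: nT i + q%:A.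
Proof. by move=> ir; rewrite (nT_lt ir) hT_sq. Qed.

Lemma nT_braid i : (i.+1 < r.-1)%N -> nT i * nT i.+1 * nT i = nT i.+1 * nT i * nT i.+1.
Proof.
move=> ir; have jr := ltnW ir.
by rewrite (nT_lt ir) (nT_lt jr) hT_braid.
Qed.

Lemma nT_comm i j : (i.+1 < j)%N -> (j < r.-1)%N -> nT i * nT j = nT j * nT i.
Proof.
move=> ij jr; have ir : (i < r.-1)%N by rewrite (ltn_trans _ jr) // ltnW.
by rewrite (nT_lt ir) (nT_lt jr) hT_comm //; left.
Qed.

Definition chain (j k : nat) : A := \prod_(j <= i < k) nT i.

Lemma chain_comm i j k : (i.+1 < j)%N -> (k <= r.-1)%N ->
  nT i * chain j k = chain j k * nT i.
Proof.
move=> ij kr; rewrite /chain big_seq; apply: commr_prod => l.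
rewrite mem_index_iota => /andP[jl lk]; apply: nT_comm; first exact: leq_trans jl.
exact: leq_trans kr.
Qed.

(** The chain contains T_(i-1) T_i. Once T_i has moved next to it, the braid relation turns T_i
    T_(i-1) T_i into T_(i-1) T_i T_(i-1), whose last factor commutes with the rest of the chain. *)
Lemma chain_shift i j k : (j < i)%N -> (i < k)%N -> (k <= r.-1)%N ->
  nT i * chain j k = chain j k * nT i.-1.
Proof.
case: i => // i ji ik kr; rewrite ltnS in ji; have ik' := ltnW ik.
rewrite /= [chain j k](big_cat_nat (n := i)) //=; last exact: ltnW.
rewrite (big_ltn ik') (big_ltn ik) -/(chain j i) -/(chain i.+2 k).
have c1 : nT i.+1 * chain j i = chain j i * nT i.+1.
  apply: commr_sym; rewrite /chain big_seq.
  apply: commr_sym; apply: commr_prod => l.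
  rewrite mem_index_iota => /andP[_ li]; apply: commr_sym; apply: nT_comm => //.
  exact: leq_trans ik kr.
have c2 : nT i * chain i.+2 k = chain i.+2 k * nT i by apply: chain_comm.
rewrite mulrA c1 -!mulrA; congr (_ * _).
by rewrite -c2 !mulrA nT_braid // (leq_trans ik).
Qed.

(* With [H_k] generated by [T_0, .., T_(k-2)], one has
   [H_(k+1) = \sum_(j <= k) T_j T_(j+1) .. T_(k-1) H_k], which gives k! generators of [H_k]. *)
Fixpoint normal_forms (k : nat) : seq A :=
  if k is k'.+1 then [seq chain j k' * x | j <- iota 0 k, x <- normal_forms k'] else [:: 1].

Lemma size_normal_forms k : size (normal_forms k) = k`!.
Proof.
elim: k => // k IH.
by rewrite {1}/normal_forms -/normal_forms size_allpairs IH size_iota factS.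
Qed.

Lemma normal_formsP k x : reflect (exists j y, [/\ (j <= k)%N, y \in normal_forms k & x = chain j k * y])
  (x \in normal_forms k.+1).
Proof.
apply: (iffP allpairsP) => [[[j y] [jk yk ->]]|[j [y [jk yk ->]]]].
  by exists j, y; split=> //; rewrite mem_iota in jk.
by exists (j, y); split=> //; rewrite mem_iota.
Qed.

Inductive kspan (s : seq A) : A -> Prop :=
  | kspan0 : kspan s 0
  | kspanD (c : K) x y : x \in s -> kspan s y -> kspan s (c *: x + y).

Lemma kspan_mem s x : x \in s -> kspan s x.
Proof. by move=> xs; rewrite -[x]addr0 -[x]scale1r; apply: kspanD => //; exact: kspan0. Qed.

Lemma kspan_add s x y : kspan s x -> kspan s y -> kspan s (x + y).
Proof.
move=> sx sy; elim: sx => [|c z w zs _ IH]; first by rewrite add0r.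
by rewrite -addrA; exact: kspanD.
Qed.

Lemma kspan_scale s (c : K) x : kspan s x -> kspan s (c *: x).
Proof.
elim=> [|d z w zs _ IH]; first by rewrite scaler0; exact: kspan0.
by rewrite scalerDr scalerA; exact: kspanD.
Qed.

Lemma kspan_mul s s' a : (forall x, x \in s -> kspan s' (a * x)) ->
  forall x, kspan s x -> kspan s' (a * x).
Proof.
move=> H x; elim=> [|d z w zs _ IH]; first by rewrite mulr0; exact: kspan0.
by rewrite mulrDr -scalerAr; apply: kspan_add => //; apply: kspan_scale; exact: H.
Qed.

Lemma kspan_sum s a : kspan s a -> exists c : nat -> K, a = \sum_(i < size s) c i *: s`_i.
Proof.
elim=> [|d x y xs _ [c ->]].
  by exists (fun=> 0); rewrite big1 // => i _; rewrite scale0r.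
exists (fun i => c i + (if i == index x s then d else 0)).
have xi : (index x s < size s)%N by rewrite index_mem.
under [RHS]eq_bigr do rewrite scalerDl.
rewrite big_split /= addrC; congr (_ + _).
rewrite (bigD1 (Ordinal xi)) //= eqxx nth_index // big1 ?addr0 // => i.
by rewrite -val_eqE /= => /negPf->; rewrite scale0r.
Qed.

(** Four positions of [i] against the start [j] of the chain. For i > j or i + 1 < j the generator
    passes through and acts on the factor in [normal_forms k], by induction; for i + 1 = j it
    lengthens the chain; for i = j the quadratic relation leaves the chains starting at i and at i +
    1. *)
Lemma normal_forms_nT k : (k <= r)%N -> forall i x, (i.+1 < k)%N ->
  x \in normal_forms k -> kspan (normal_forms k) (nT i * x).
Proof.
elim: k => // k IH kr i x ik /normal_formsP[j [y [jk yk ->]]].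
have kr' : (k <= r.-1)%N by rewrite -ltnS (ltn_predK kr).
have chainN l z : (l <= k)%N -> kspan (normal_forms k) z ->
    kspan (normal_forms k.+1) (chain l k * z).
  move=> lk; apply: kspan_mul => w wk. refine (kspan_mem _).
  by apply/normal_formsP; exists l, w.
rewrite ltnS in ik; rewrite mulrA.
have [ij|ji|ji] := ltngtP i j; last 2 first.
- rewrite chain_shift // -mulrA; apply: chainN => //; apply: IH => //; first exact: ltnW.
  by case: (i) ji ik.
- have e : nT i * chain i k = (q - 1) *: chain i k + q *: chain i.+1 k.
    rewrite /chain (big_ltn ik) -/(chain i.+1 k) mulrA nT_sq ?(leq_trans ik) //.
    by rewrite mulrDl -[(_ *: nT i) * _]scalerAl -[q%:A * _]scalerAl mul1r.
  rewrite -ji e mulrDl -[(_ *: chain i k) * _]scalerAl -[(_ *: chain i.+1 k) * _]scalerAl.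
  apply: kspan_add; apply: kspan_scale; apply: chainN; rewrite ?(ltnW ik) //; exact: kspan_mem.
have [ij'|ij'] := ltnP i.+1 j.
  rewrite chain_comm // -mulrA; apply: chainN => //; apply: IH => //; first exact: ltnW.
  exact: leq_trans ij' jk.
have -> : j = i.+1 by apply/eqP; rewrite eqn_leq ij' ij.
rewrite /chain -big_ltn //; apply: chainN; first exact: ltnW.
exact: kspan_mem.
Qed.

Lemma normal_forms1 k : 1 \in normal_forms k.
Proof.
elim: k => [|k IH]; first by rewrite inE.
by apply/normal_formsP; exists k, 1; rewrite /chain big_geq ?mulr1.
Qed.

Lemma normal_forms_word k x : (k <= r)%N -> x \in normal_forms k ->
  exists u : seq 'I_r.-1, x = \prod_(i <- u) T i.
Proof.
elim: k x => [|k IH] x kr.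
  by rewrite inE => /eqP->; exists [::]; rewrite big_nil.
move=> /normal_formsP[j [y [_ yk ->]]].
have [u ->] := IH y (ltnW kr) yk.
have kr' : (k <= r.-1)%N by rewrite -ltnS (ltn_predK kr).
exists (pmap insub (index_iota j k) ++ u); rewrite big_cat; congr (_ * _).
rewrite /chain; elim: (index_iota j k) => [|l s IHs]; first by rewrite !big_nil.
rewrite big_cons IHs /= /nT; case: insubP => [l' _ _|_] /=; last by rewrite mul1r.
by rewrite big_cons.
Qed.

Definition nf (l : nat) : A := (normal_forms r)`_l.

Lemma nf_mem (l : 'I_r`!) : nf l \in normal_forms r.
Proof. by rewrite mem_nth // size_normal_forms. Qed.

(** * Modules spanned by normal forms applied to a weight space *)

Section Spanning.
Variables (M : lmodType A) (E : M -> Prop).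
Hypotheses (E0 : E 0) (Elin : forall (a : K) x y, E x -> E y -> E (a%:A *: x + y)).
Hypotheses (EX : forall j x, E x -> E (X j *: x)) (EXV : forall j x, E x -> E (XV j *: x)).

(** The coefficients are elements of [E] instead of scalars, so that one argument covers both a line
    over K in [M_mod] and a rank one O-module in the seminormal module. *)
Definition nf_span (m : M) : Prop :=
  exists2 y : nat -> M, (forall l, E (y l)) & m = \sum_(l < r`!) nf l *: y l.

Lemma nf_span_lin (a : K) x y : nf_span x -> nf_span y -> nf_span (a%:A *: x + y).
Proof.
case=> f fE -> [g gE ->]; exists (fun l => a%:A *: f l + g l); first by move=> l; exact: Elin.
rewrite scaler_sumr -big_split; apply: eq_bigr => l _ /=.
by rewrite scalerDr !scalerA alg_cst_comm.
Qed.

Lemma nf_span0 : nf_span 0.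
Proof. by exists (fun=> 0) => //; rewrite big1 // => l _; rewrite scaler0. Qed.

Lemma scale_algE (k : K) (a : A) (m : M) : (k *: a) *: m = k%:A *: (a *: m).
Proof. by rewrite scalerA -scalerAl mul1r. Qed.

Lemma nf_spanD x y : nf_span x -> nf_span y -> nf_span (x + y).
Proof. by move=> sx sy; rewrite -[x]scale1r -(scale1r 1); exact: nf_span_lin. Qed.

Lemma nf_spanZ (a : K) x : nf_span x -> nf_span (a%:A *: x).
Proof. by move=> sx; rewrite -[_ *: _]addr0; apply: nf_span_lin => //; exact: nf_span0. Qed.

Lemma nf_span_sum I (s : seq I) (F : I -> M) :
  (forall i, nf_span (F i)) -> nf_span (\sum_(i <- s) F i).
Proof.
move=> FE; elim: s => [|i s IH]; first by rewrite big_nil; exact: nf_span0.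
by rewrite big_cons; exact: nf_spanD.
Qed.

Lemma nf_span_kspan a x : kspan (normal_forms r) a -> E x -> nf_span (a *: x).
Proof.
move=> /kspan_sum[c ->] Ex; rewrite size_normal_forms.
exists (fun l => (c l)%:A *: x).
  by move=> l; rewrite -[_ *: _]addr0; exact: Elin.
by rewrite scaler_suml; apply: eq_bigr => l _; rewrite scalerA -alg_cst_comm -scalerAl mul1r.
Qed.

Lemma nf_span_base x : E x -> nf_span x.
Proof.
by move=> Ex; rewrite -[x]scale1r; apply: nf_span_kspan => //; apply/kspan_mem/normal_forms1.
Qed.

Lemma nf_span_hT i m : nf_span m -> nf_span (T i *: m).
Proof.
case=> y yE ->; rewrite scaler_sumr; apply: nf_span_sum => l.
rewrite scalerA; apply: nf_span_kspan => //; rewrite -nT_ord.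
apply: normal_forms_nT => //; last exact: nf_mem.
by case: i => i /=; case: (r).
Qed.

(** Induction on the word: crossing its first letter leaves an [X] or an [XV] in front of a shorter
    word, up to a multiple by that letter, and [E] takes care of the empty word. *)
Lemma nf_span_word_X (u : seq 'I_r.-1) x : E x ->
  (forall j, nf_span (X j *: ((\prod_(i <- u) T i) *: x))) /\
  (forall j, nf_span (XV j *: ((\prod_(i <- u) T i) *: x))).
Proof.
move=> Ex; elim: u => [|i u [IH1 IH2]].
  by rewrite big_nil scale1r; split=> j; apply: nf_span_base; [exact: EX | exact: EXV].
rewrite big_cons -scalerA; split=> j; rewrite scalerA.
  have [j' [j'' [k ->]]] := hXT_ex i j; rewrite scalerDl -scalerA.
  apply: nf_spanD; first exact: nf_span_hT.
  by rewrite scale_algE; exact: nf_spanZ.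
have [j' [j'' [k ->]]] := hXVT_ex i j; rewrite scalerDl -scalerA.
apply: nf_spanD; first exact: nf_span_hT.
by rewrite scale_algE; exact: nf_spanZ.
Qed.

Lemma nf_span_stable a m : nf_span m -> nf_span (a *: m).
Proof.
elim/hecke_ind: a m => [c|i|j|j|a b IHa IHb|a b IHa IHb] m sm.
- exact: nf_spanZ.
- exact: nf_span_hT.
- case: sm => y yE ->; rewrite scaler_sumr; apply: nf_span_sum => l.
  have [u ->] := normal_forms_word (leqnn r) (nf_mem l).
  exact: (nf_span_word_X u (yE l)).1.
- case: sm => y yE ->; rewrite scaler_sumr; apply: nf_span_sum => l.
  have [u ->] := normal_forms_word (leqnn r) (nf_mem l).
  exact: (nf_span_word_X u (yE l)).2.
- by rewrite scalerDl; apply: nf_spanD; [exact: IHa | exact: IHb].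
- by rewrite -scalerA; apply: IHa; exact: IHb.
Qed.

End Spanning.

End HeckeRelations.

(** * Seminormal modules *)

Section Representations.
Variables (K : fieldType) (v : K) (r : nat) (F : fieldType) (iota : {rmorphism K -> F}).
Variable U : lmodType F.

Fixpoint act (op : hgen r -> U -> U) (t : term K (hgen r)) (u : U) : U :=
  match t with
  | Cst a => iota a *: u
  | Gen g => op g u
  | Add x y => act op x u + act op y u
  | Mul x y => act op x (act op y u)
  end.

Record rep := Rep {
  rep_op : hgen r -> U -> U;
  rep_lin : forall g a x y, rep_op g (a *: x + y) = a *: rep_op g x + rep_op g y;
  rep_rel : forall x y, hecke_rel v x y -> forall u, act rep_op x u = act rep_op y u
}.

(** The carrier keeps its F-structure, but [*:] on [repmod] is the action of the Hecke algebra over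
    K; [rep_scaleC] relates the two. *)
Definition repmod (rho : rep) : Type := U.

Variable rho : rep.
Local Notation op := (rep_op rho).

Lemma act_lin t a x y : act op t (a *: x + y) = a *: act op t x + act op t y.
Proof.
elim: t x y => [c|g|t IHt t' IHt'|t IHt t' IHt'] x y /=.
- by rewrite scalerDr !scalerA mulrC.
- exact: rep_lin.
- by rewrite IHt IHt' scalerDr addrACA.
- by rewrite IHt' IHt.
Qed.

Lemma actD t x y : act op t (x + y) = act op t x + act op t y.
Proof. by have := act_lin t 1 x y; rewrite !scale1r. Qed.

Lemma act0 t : act op t 0 = 0.
Proof. by have := act_lin t (-1) 0 0; rewrite scaler0 addr0 scaleN1r addNr. Qed.

Lemma actZ t a x : act op t (a *: x) = a *: act op t x.
Proof. by have := act_lin t a x 0; rewrite act0 !addr0. Qed.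

Lemma act_pcong s t : pcong (@hecke_rel K v r) s t -> forall u, act op s u = act op t u.
Proof.
elim => {s t} /=.
- by [].
- by move=> x y _ IH u; rewrite IH.
- by move=> x y z _ IH1 _ IH2 u; rewrite IH1 IH2.
- by move=> x x' y y' _ IH1 _ IH2 u; rewrite IH1 IH2.
- by move=> x x' y y' _ IH1 _ IH2 u; rewrite IH2 IH1.
- by move=> *; rewrite addrA.
- by move=> *; rewrite addrC.
- by move=> *; rewrite rmorph0 scale0r add0r.
- by move=> x u; rewrite rmorphN1 rmorph0 scaleN1r addNr scale0r.
- by [].
- by move=> *; rewrite rmorph1 scale1r.
- by move=> *; rewrite rmorph1 scale1r.
- by [].
- by move=> *; rewrite actD.
- by move=> *; rewrite rmorphD scalerDl.
- by move=> *; rewrite rmorphM scalerA.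
- by move=> *; rewrite actZ.
- by move=> x y xy u; exact: rep_rel.
Qed.

HB.instance Definition _ := GRing.Zmodule.on (repmod rho).

Definition rep_scale (a : hecke v r) (u : repmod rho) : repmod rho := act op (repr a) u.

Lemma rep_scaleE t u : rep_scale (ppi (@hecke_rel K v r) t) u = act op t u.
Proof. by apply: act_pcong; exact: repr_ppi. Qed.

Let rep_scaleA a b u : rep_scale a (rep_scale b u) = rep_scale (a * b) u.
Proof. by rewrite -[a]ppi_repr -[b]ppi_repr -ppiM !rep_scaleE. Qed.

Let rep_scale1 : left_id 1 rep_scale.
Proof. by move=> u; rewrite rep_scaleE /= rmorph1 scale1r. Qed.

Let rep_scaleDr : right_distributive rep_scale +%R.
Proof. by move=> a x y; exact: actD. Qed.

Let rep_scaleDl u : {morph rep_scale^~ u : a b / a + b}.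
Proof. by move=> a b; rewrite -[a]ppi_repr -[b]ppi_repr -ppiD !rep_scaleE. Qed.

HB.instance Definition _ :=
  GRing.Zmodule_isLmodule.Build (hecke v r) (repmod rho) rep_scaleA rep_scale1 rep_scaleDr rep_scaleDl.

Lemma rep_hT i (u : repmod rho) : hT v i *: u = op (TT i) u.
Proof. exact: rep_scaleE. Qed.

Lemma rep_hX j (u : repmod rho) : hX v j *: u = op (XX j) u.
Proof. exact: rep_scaleE. Qed.

Lemma rep_hXV j (u : repmod rho) : hXV v j *: u = op (XXV j) u.
Proof. exact: rep_scaleE. Qed.

Lemma rep_cst (a : K) (u : repmod rho) : (a%:A : hecke v r) *: u = iota a *: (u : U).
Proof. by rewrite -ppi_cst; exact: rep_scaleE. Qed.

Lemma rep_scaleC (x : F) (a : hecke v r) (u : repmod rho) :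
  a *: ((x *: (u : U) : U) : repmod rho) = x *: ((a *: u : repmod rho) : U).
Proof. exact: actZ. Qed.

End Representations.

Arguments repmod {K v r F iota U} rho.

Section Seminormal.
Variables (K : fieldType) (v : K) (r : nat) (F : fieldType) (iota : {rmorphism K -> F}).
Variables (beta : 'I_r -> F).
Hypotheses (beta_neq0 : forall j, beta j != 0) (beta_inj : injective beta).
Local Notation q := (iota v ^+ 2).
Local Notation U := {ffun 'S_r -> F^o}.
Local Notation s := (@simple_refl r).

(* Demazure-Lusztig operators on the functions on the orbit of [beta]: with
   [a = cdiag C D] one has [T_i - q = (q - a) (s_i - 1)]. Any [a] with
   [a (C - D) = - (q - 1) D] is forced by the relation [T_i X_i T_i = q X_(i+1)]. *)
Definition cdiag (C D : F) : F := (q - 1) * D / (D - C).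

Definition seminormal_op (g : hgen r) (f : U) : U :=
  match g with
  | TT i => [ffun w : 'S_r =>
      let a := cdiag (beta (w (lo i))) (beta (w (hi i))) in
      a * f w + (q - a) * f (s i * w)%g]
  | XX j => [ffun w : 'S_r => beta (w j) * f w]
  | XXV j => [ffun w : 'S_r => (beta (w j))^-1 * f w]
  end.

Lemma seminormal_lin g (a : F) (x y : U) :
  seminormal_op g (a *: x + y) = a *: seminormal_op g x + seminormal_op g y.
Proof.
case: g => [i|j|j]; apply/ffunP => w; rewrite !ffunE /= /GRing.scale /= ; [|ring|ring].
by ring.
Qed.

Lemma beta_neq (w : 'S_r) j k : j != k -> beta (w j) - beta (w k) != 0.
Proof. by move=> jk; rewrite subr_eq0 (inj_eq beta_inj) (inj_eq perm_inj). Qed.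

Lemma simple_reflL i : s i (lo i) = hi i. Proof. exact: tpermL. Qed.
Lemma simple_reflR i : s i (hi i) = lo i. Proof. exact: tpermR. Qed.
Lemma simple_reflK i : (s i * s i)%g = 1%g. Proof. exact: tperm2. Qed.
Lemma simple_reflD i j : j != lo i -> j != hi i -> s i j = j.
Proof. by move=> jl jh; apply: tpermD; rewrite eq_sym. Qed.

Lemma simple_refl_comm (i j : 'I_r.-1) : (i.+1 < j)%N \/ (j.+1 < i)%N ->
  [/\ lo i != lo j, lo i != hi j, hi i != lo j & hi i != hi j].
Proof. by rewrite -!val_eqE /=; case=> ij; split; lia. Qed.

(** Evaluated at a permutation, each relation becomes a rational identity in two or three distinct
    weights and the values of [u]. *)
Lemma seminormal_rel x y : hecke_rel v x y ->
  forall u : U, act iota seminormal_op x u = act iota seminormal_op y u.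
Proof.
case=> {x y}.
- move=> i u; apply/ffunP => w; rewrite /= !ffunE /= !permM.
  rewrite simple_reflL simple_reflR mulgA simple_reflK mul1g.
  rewrite rmorphN rmorph1 rmorph0 rmorphXn /cdiag.
  have := beta_neq w (lo_neq_hi i).
  move: (beta (w (lo i))) (beta (w (hi i))) (u w) (u _) => C D x y CD.
  have DC : D - C != 0 by rewrite subr_eq0 eq_sym -subr_eq0.
  rewrite /GRing.scale /=.
  by field; rewrite CD DC.
- move=> i j ij u.
  (* Only the three positions [lo i], [hi i = lo j] and [hi j] are involved. Transporting them
     through the reflections puts both sides in terms of the same three weights and the same values
     of [u]. *)
  have mE : lo j = hi i by apply: val_inj.
  have [pm pn mn] : [/\ lo i != hi i, lo i != hi j & hi i != hi j].
    by rewrite -!val_eqE /= ij; split; lia.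
  have ip : s i (lo i) = hi i := simple_reflL i.
  have im : s i (hi i) = lo i := simple_reflR i.
  have ni : s i (hi j) = hi j by rewrite simple_reflD // eq_sym.
  have jm : s j (hi i) = hi j by rewrite -mE simple_reflL.
  have jn : s j (hi j) = hi i by rewrite simple_reflR.
  have pj : s j (lo i) = lo i by rewrite simple_reflD ?mE.
  have br : (s i * s j * s i = s j * s i * s j)%g.
    apply/permP => k; rewrite !permM.
    have [->|kp] := eqVneq k (lo i); first by rewrite ip jm ni pj ip jm.
    have [->|km] := eqVneq k (hi i); first by rewrite im pj ip jm ni jn.
    have [->|kn] := eqVneq k (hi j); first by rewrite ni jn im pj.
    have ik : s i k = k by rewrite simple_reflD.
    have jk : s j k = k by rewrite simple_reflD ?mE.
    by rewrite !(ik, jk).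
  apply/ffunP => w; rewrite /= !ffunE /= !permM !mE.
  rewrite !(ip, im, ni, jm, jn, pj) !mulgA br !simple_reflK !mul1g.
  have := beta_neq w pm; have := beta_neq w pn; have := beta_neq w mn; rewrite /cdiag.
  move: (beta (w (lo i))) (beta (w (hi i))) (beta (w (hi j))) => C D E DE CE CD.
  have DC : D - C != 0 by rewrite subr_eq0 eq_sym -subr_eq0.
  have EC : E - C != 0 by rewrite subr_eq0 eq_sym -subr_eq0.
  have ED : E - D != 0 by rewrite subr_eq0 eq_sym -subr_eq0.
  by field; rewrite ?CD ?DC ?DE ?ED ?CE ?EC.
- move=> i j ij u; have [ll lh hl hh] := simple_refl_comm ij.
  have co : (s i * s j = s j * s i)%g.
    by rewrite [RHS]conjgC tpermJ !simple_reflD // eq_sym.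
  apply/ffunP => w; rewrite /= !ffunE /= !permM !mulgA co.
  by rewrite !simple_reflD // ?[lo j == _]eq_sym ?[hi j == _]eq_sym //; ring.
- move=> j u; apply/ffunP => w; rewrite /= !ffunE mulrA mulfV ?beta_neq0 //.
  by rewrite rmorph1 mul1r scale1r.
- move=> j u; apply/ffunP => w; rewrite /= !ffunE mulrA mulVf ?beta_neq0 //.
  by rewrite rmorph1 mul1r scale1r.
- by move=> i j u; apply/ffunP => w; rewrite /= !ffunE mulrCA.
- move=> i u; apply/ffunP => w; rewrite /= !ffunE /= !permM.
  rewrite simple_reflL simple_reflR mulgA simple_reflK mul1g rmorphXn /cdiag.
  have := beta_neq w (lo_neq_hi i).
  move: (beta (w (lo i))) (beta (w (hi i))) (u w) (u _) => C D x y CD.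
  have DC : D - C != 0 by rewrite subr_eq0 eq_sym -subr_eq0.
  rewrite /GRing.scale /=.
  by field; rewrite CD DC.
- move=> i j jl jh u; apply/ffunP => w; rewrite /= !ffunE /= permM simple_reflD //.
  by ring.
Qed.

End Seminormal.

(** * Discrete valuation rings and the deformation of weights *)

(** A discrete valuation ring of F, with uniformizer t and a copy of K mapping onto the residue
    field. It is a predicate on F, so that all computations stay inside a field. By [dvr_total] an
    element or else its inverse is integral, the inverse then lying in the maximal ideal; by
    [dvr_bound] inverting t gives all of F. *)
Record dvr (K F : fieldType) := Dvr {
  dvr_inj :> {rmorphism K -> F};
  dvr_t : F;
  dvr_ring : F -> Prop;
  dvr_cst : forall k, dvr_ring (dvr_inj k);
  dvrD : forall x y, dvr_ring x -> dvr_ring y -> dvr_ring (x + y);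
  dvrM : forall x y, dvr_ring x -> dvr_ring y -> dvr_ring (x * y);
  dvr_ringt : dvr_ring dvr_t;
  dvr_t_neq0 : dvr_t != 0;
  dvr_tV : ~ dvr_ring dvr_t^-1;
  dvr_total : forall x, dvr_ring x \/ exists2 y, dvr_ring y & x^-1 = dvr_t * y;
  dvr_bound : forall x, exists n, dvr_ring (dvr_t ^+ n * x);
  dvr_residue : forall x, dvr_ring x -> exists k y, dvr_ring y /\ x = dvr_inj k + dvr_t * y
}.

Section DvrTheory.
Variables (K F : fieldType) (D : dvr K F).
Local Notation t := (dvr_t D).
Local Notation O := (dvr_ring D).

Lemma dvr0 : O 0. Proof. by rewrite -(rmorph0 D); exact: dvr_cst. Qed.
Lemma dvr1 : O 1. Proof. by rewrite -(rmorph1 D); exact: dvr_cst. Qed.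
Lemma dvrN x : O x -> O (- x).
Proof. by move=> Ox; rewrite -mulN1r -(rmorphN1 D); apply: dvrM => //; exact: dvr_cst. Qed.
Lemma dvrB x y : O x -> O y -> O (x - y).
Proof. by move=> Ox Oy; apply: dvrD => //; exact: dvrN. Qed.
Lemma dvrX x n : O x -> O (x ^+ n).
Proof. by move=> Ox; elim: n => [|n IH]; [exact: dvr1 | rewrite exprS; exact: dvrM]. Qed.
Lemma dvr_tX n : O (t ^+ n). Proof. exact/dvrX/dvr_ringt. Qed.
Lemma tX_neq0 n : t ^+ n != 0. Proof. by rewrite expf_neq0 // dvr_t_neq0. Qed.

(** Otherwise the element would lie in tO, hence so would the nonzero constant [k], and t would be
    invertible in O. *)
Lemma dvr_unit (k : K) y : k != 0 -> O y -> O (D k + t * y)^-1.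
Proof.
move=> k0 Oy; have [//|[z Oz]] := dvr_total D (D k + t * y)^-1.
rewrite invrK => e; case: (dvr_tV (d := D)).
have kE : D k = t * (z - y) by rewrite mulrBr -e addrK.
have -> : t^-1 = (z - y) * D k^-1.
  have k0' : D k != 0 by rewrite fmorph_eq0.
  by apply: (mulfI k0'); rewrite fmorphV mulrCA divff // mulr1 kE mulrAC divff ?mul1r // dvr_t_neq0.
by apply: dvrM; [exact: dvrB | exact: dvr_cst].
Qed.

Lemma dvr_cst_tO (k : K) y : O y -> D k = t * y -> k = 0.
Proof.
move=> Oy e; apply/eqP/negPn/negP => k0.
have := dvr_unit k0 (dvrN Oy); rewrite mulrN e subrr invr0 => _.
case: (dvr_tV (d := D)); have -> : t^-1 = y * D k^-1.
  have k0' : D k != 0 by rewrite fmorph_eq0.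
  by apply: (mulfI k0'); rewrite fmorphV mulrCA divff // mulr1 e mulrAC divff ?mul1r // dvr_t_neq0.
by apply: dvrM => //; exact: dvr_cst.
Qed.

Definition tO (n : nat) (x : F) : Prop := exists2 y, O y & x = t ^+ n * y.

Lemma tO0 n : tO n 0. Proof. by exists 0; [exact: dvr0 | rewrite mulr0]. Qed.

Lemma tO_O x : O x -> tO 0 x. Proof. by move=> Ox; exists x; rewrite ?mul1r. Qed.

Lemma O_tO n x : tO n x -> O x.
Proof. by case=> y Oy ->; apply: dvrM => //; exact: dvr_tX. Qed.

Lemma tOD n x y : tO n x -> tO n y -> tO n (x + y).
Proof. by case=> a Oa -> [b Ob ->]; exists (a + b); [exact: dvrD | rewrite mulrDr]. Qed.

Lemma tOM m n x y : tO m x -> tO n y -> tO (m + n) (x * y).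
Proof. by case=> a Oa -> [b Ob ->]; exists (a * b); [exact: dvrM | rewrite exprD mulrACA]. Qed.

Lemma tOMl n x y : O x -> tO n y -> tO n (x * y).
Proof. by move=> /tO_O Ox ny; rewrite -[n]add0n; exact: tOM. Qed.

Lemma tO_leq m n x : (m <= n)%N -> tO n x -> tO m x.
Proof.
move=> mn [y Oy ->]; exists (t ^+ (n - m) * y); first by apply: dvrM => //; exact: dvr_tX.
by rewrite mulrA -exprD subnKC.
Qed.

Lemma tO_cancel m n x : tO (m + n) (t ^+ m * x) -> tO n x.
Proof.
by case=> y Oy; rewrite exprD -mulrA => /(mulfI (tX_neq0 m)) ->; exists y.
Qed.

Lemma tO_tX m n : tO m (t ^+ n) -> (m <= n)%N.
Proof.
case=> y Oy e; rewrite leqNgt; apply/negP => nm; case: (dvr_tV (d := D)).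
have tnz := tX_neq0 n.
have : t ^+ n * 1 = t ^+ n * (t ^+ (m - n) * y) by rewrite mulr1 mulrA -exprD subnKC // ltnW.
move=> /(mulfI tnz) e1.
have -> : t^-1 = t ^+ (m - n).-1 * y; last by apply: dvrM => //; exact: dvr_tX.
apply: (mulfI (dvr_t_neq0 D)); rewrite divff ?dvr_t_neq0 // e1 mulrA -exprS prednK //.
by rewrite subn_gt0.
Qed.

(** If p had a pole, p^2 would have a worse one, so p is integral. As O is local, p or 1 - p is a
    unit, and dividing p (1 - p) by it loses no power of t. *)
Lemma idempotent_tO n p : tO n (p - p ^+ 2) -> O p /\ (tO n p \/ tO n (1 - p)).
Proof.
move=> np; have Op : O p.
  have [//|[y Oy pV]] := dvr_total D p.
  have [->|p0] := eqVneq p 0; first exact: dvr0.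
  case: (dvr_tV (d := D)).
  have y0 : y != 0 by apply: contra_neq p0 => y0; rewrite -[p]invrK pV y0 mulr0 invr0.
  have Opp := O_tO np.
  have e : (t * y) ^+ 2 * (p - p ^+ 2) = t * y - 1.
    by rewrite -pV; field.
  have -> : t^-1 = y - t * y ^+ 2 * (p - p ^+ 2).
    apply: (mulfI (dvr_t_neq0 D)); rewrite divff ?dvr_t_neq0 //.
    apply/eqP; rewrite -subr_eq0; apply/eqP.
    by transitivity (1 - t * y + (t * y) ^+ 2 * (p - p ^+ 2)); [ring | rewrite e; ring].
  by apply: dvrB => //; do 2?apply: dvrM => //; [exact: dvr_ringt | exact: dvrX].
split=> //; have [k [y [Oy pE]]] := dvr_residue Op.
have [k0|k0] := eqVneq k 0.
  left; have u := dvr_unit (oner_neq0 K) (dvrN Oy).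
  have pE' : D 1 + t * - y = 1 - p by rewrite rmorph1 mulrN pE k0 rmorph0 add0r.
  have -> : p = (1 - p)^-1 * (p - p ^+ 2).
    have : 1 - p != 0.
      apply/eqP => e; case: (dvr_tV (d := D)); have -> : t^-1 = y; last by [].
      apply: (mulfI (dvr_t_neq0 D)); rewrite divff ?dvr_t_neq0 //.
      by apply/eqP; rewrite -subr_eq0 -[X in _ == X]e pE k0 rmorph0 add0r.
    by move=> np1; field.
  by apply: tOMl => //; rewrite -pE'.
right; have u := dvr_unit k0 Oy; rewrite -pE in u.
have p0 : p != 0.
  apply: contra_neq k0 => p0; apply: (@dvr_cst_tO _ (- y)); first exact: dvrN.
  by apply/eqP; rewrite mulrN -subr_eq0 opprK -pE p0.
have -> : 1 - p = p^-1 * (p - p ^+ 2) by field.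
exact: tOMl.
Qed.

Variables (r : nat) (b : 'I_r -> K).
Hypothesis b_neq0 : forall j, b j != 0.

(* Distinct powers of the uniformizer keep the weights generic whatever the residues [b]. *)
Definition deform (j : 'I_r) : F := D (b j) + t ^+ j.+1.

Lemma deform_O j : O (deform j).
Proof. by apply: dvrD; [exact: dvr_cst | exact: dvr_tX]. Qed.

Lemma deformV_O j : O (deform j)^-1.
Proof. by rewrite /deform exprS; apply: dvr_unit => //; exact: dvr_tX. Qed.

Lemma cst_tX (k : K) m n : k != 0 -> D k * t ^+ m = t ^+ n -> m = n.
Proof.
move=> k0 e; have Dk0 : D k != 0 by rewrite fmorph_eq0.
apply/eqP; rewrite eqn_leq; apply/andP; split; apply: tO_tX.
  by exists (D k); [exact: dvr_cst | rewrite mulrC].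
exists (D k^-1); first exact: dvr_cst.
by rewrite -e mulrC mulrA -rmorphM mulVf // rmorph1 mul1r.
Qed.

(** Modulo t an equality gives b_i = k b_j; what remains equates two powers of t up to a constant,
    which forces i = j. The case k = 1 separates the weights, and k = v^2 gives [cdiag_neq]. *)
Lemma deform_generic (k : K) i j : k != 0 -> i != j -> deform i != D k * deform j.
Proof.
move=> k0 ij; apply/eqP; rewrite /deform mulrDr => e.
have e' : D (b i - k * b j) = t * (D k * t ^+ j - t ^+ i).
  rewrite rmorphB rmorphM /=; apply/eqP; rewrite subr_eq mulrBr mulrCA -!exprS addrAC.
  by rewrite -subr_eq opprK e addrC.
have z := dvr_cst_tO (dvrB (dvrM (dvr_cst D k) (dvr_tX j)) (dvr_tX i)) e'.
move: e'; rewrite z rmorph0 => /esym/eqP; rewrite mulf_eq0 (negPf (dvr_t_neq0 D)) /= subr_eq0.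
by move=> /eqP/(cst_tX k0)/ord_inj ji; rewrite ji eqxx in ij.
Qed.

Lemma deform_neq0 j : deform j != 0.
Proof.
apply/eqP => e; have := deformV_O j; have := b_neq0 j.
have e' : D (b j) = t * - t ^+ j by apply/eqP; rewrite mulrN -exprS -subr_eq0 opprK; apply/eqP.
by rewrite (dvr_cst_tO (dvrN (dvr_tX j)) e') eqxx.
Qed.

Lemma deform_inj : injective deform.
Proof.
move=> i j e; apply/eqP/negPn/negP => ij.
by have := deform_generic (oner_neq0 K) ij; rewrite rmorph1 mul1r e eqxx.
Qed.

End DvrTheory.

(** * Lattices in the seminormal module *)

Section Lattices.
Variables (K : fieldType) (v : K) (r : nat) (F : fieldType) (D : dvr K F) (b : 'I_r -> K).
Hypotheses (v_neq0 : v != 0) (b_neq0 : forall j, b j != 0).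
Local Notation A := (hecke v r).
Local Notation t := (dvr_t D).
Local Notation O := (dvr_ring D).
Local Notation beta := (deform D b).
Local Notation q := (D v ^+ 2).
Local Notation U := {ffun 'S_r -> F^o}.

Definition seminormal_rep : rep v r D U :=
  Rep (@seminormal_lin K v r F D beta)
      (seminormal_rel D (deform_neq0 D b_neq0) (@deform_inj K F D r b)).

Local Notation M := (repmod seminormal_rep).

Definition coord (m : M) (u : 'S_r) : F := (m : U) u.
(** On [M] the notation [*:] is taken by the Hecke action, so scaling by F has its own name. *)
Definition fscale (x : F) (m : M) : M := x *: (m : U).
Definition wvec (w : 'S_r) : M := [ffun u : 'S_r => (u == w)%:R : F^o].

Lemma coord_inj m n : coord m =1 coord n -> m = n.
Proof. by move=> e; apply/ffunP. Qed.
Lemma coordD m n u : coord (m + n) u = coord m u + coord n u.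
Proof. by rewrite /coord ffunE. Qed.
Lemma coord0 u : coord 0 u = 0. Proof. by rewrite /coord ffunE. Qed.
Lemma coordN m u : coord (- m) u = - coord m u.
Proof. by apply/eqP; rewrite -addr_eq0 -coordD addNr coord0. Qed.
Lemma coord_sum I (s : seq I) (f : I -> M) u : coord (\sum_(i <- s) f i) u = \sum_(i <- s) coord (f i) u.
Proof. by elim: s => [|i s IH]; rewrite ?big_nil ?coord0 // !big_cons coordD IH. Qed.
Lemma coord_fscale x m u : coord (fscale x m) u = x * coord m u.
Proof. by rewrite /coord /fscale ffunE. Qed.
Lemma coord_wvec w u : coord (wvec w) u = (u == w)%:R. Proof. by rewrite /coord ffunE. Qed.

Lemma fscaleD x m n : fscale x (m + n) = fscale x m + fscale x n. Proof. exact: (@scalerDr _ U). Qed.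
Lemma fscaleDl x y m : fscale (x + y) m = fscale x m + fscale y m. Proof. exact: (@scalerDl _ U). Qed.
Lemma fscaleA x y m : fscale x (fscale y m) = fscale (x * y) m. Proof. exact: (@scalerA _ U). Qed.
Lemma fscale1 m : fscale 1 m = m. Proof. exact: (@scale1r _ U). Qed.
Lemma fscale0l m : fscale 0 m = 0. Proof. exact: (@scale0r _ U). Qed.
Lemma fscale_sum I (s : seq I) (f : I -> M) x :
  fscale x (\sum_(i <- s) f i) = \sum_(i <- s) fscale x (f i).
Proof. exact: (@scaler_sumr _ U). Qed.
Lemma fscaleC x (a : A) m : a *: fscale x m = fscale x (a *: m). Proof. exact: rep_scaleC. Qed.
Lemma fscale_cst (k : K) m : (k%:A : A) *: m = fscale (D k) m. Proof. exact: rep_cst. Qed.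
Lemma fscale_lin x (a : A) m n : fscale x (a *: m + n) = a *: fscale x m + fscale x n.
Proof. by rewrite fscaleD fscaleC. Qed.

Lemma coord_X j m w : coord (hX v j *: m) w = beta (w j) * coord m w.
Proof. by rewrite /coord rep_hX ffunE. Qed.
Lemma coord_XV j m w : coord (hXV v j *: m) w = (beta (w j))^-1 * coord m w.
Proof. by rewrite /coord rep_hXV ffunE. Qed.
Lemma coord_T i m w : coord (hT v i *: m) w =
  cdiag v D (beta (w (lo i))) (beta (w (hi i))) * coord m w +
  (q - cdiag v D (beta (w (lo i))) (beta (w (hi i)))) * coord m (simple_refl i * w)%g.
Proof. by rewrite /coord rep_hT ffunE. Qed.

Opaque coord fscale wvec.

Lemma hX_wvec j w x : hX v j *: fscale x (wvec w) = fscale (beta (w j) * x) (wvec w).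
Proof.
apply: coord_inj => u; rewrite coord_X !coord_fscale coord_wvec.
by have [->|_] := eqVneq u w; rewrite ?mulr0 // mulrA.
Qed.

Lemma hXV_wvec j w x : hXV v j *: fscale x (wvec w) = fscale ((beta (w j))^-1 * x) (wvec w).
Proof.
apply: coord_inj => u; rewrite coord_XV !coord_fscale coord_wvec.
by have [->|_] := eqVneq u w; rewrite ?mulr0 // mulrA.
Qed.

(* [lat w n] is [t^n] times the [O]-form of the seminormal module generated by [wvec w]. *)
Definition lat_base (w : 'S_r) (n : nat) (m : M) : Prop :=
  exists2 x, tO D n x & m = fscale x (wvec w).

Lemma lat_base0 w n : lat_base w n 0.
Proof. by exists 0; rewrite ?fscale0l //; exact: tO0. Qed.

Lemma lat_base_lin w n (a : K) m m' : lat_base w n m -> lat_base w n m' ->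
  lat_base w n ((a%:A : A) *: m + m').
Proof.
case=> x nx -> [y ny ->]; exists (D a * x + y); last by rewrite fscale_cst fscaleA fscaleDl.
by apply: tOD => //; apply: tOMl => //; exact: dvr_cst.
Qed.

Lemma lat_base_X w n j m : lat_base w n m -> lat_base w n (hX v j *: m).
Proof.
case=> x nx ->; exists (beta (w j) * x); last exact: hX_wvec.
by apply: tOMl => //; exact: deform_O.
Qed.

Lemma lat_base_XV w n j m : lat_base w n m -> lat_base w n (hXV v j *: m).
Proof.
case=> x nx ->; exists ((beta (w j))^-1 * x); last exact: hXV_wvec.
by apply: tOMl => //; exact: deformV_O.
Qed.

Lemma lat_ex w n : exists N : submodClosed M, forall m, m \in N <-> nf_span (lat_base w n) m.
Proof.
apply: submod_of; first exact/nf_span0/lat_base0.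
move=> a x y sx sy; apply: (nf_spanD (@lat_base_lin w n)) => //.
apply: nf_span_stable => //; [exact: lat_base0|exact: lat_base_lin|exact: lat_base_X|exact: lat_base_XV].
Qed.

Definition lat w n : submodClosed M := projT1 (cid (lat_ex w n)).

Lemma latP w n m : m \in lat w n <->
  exists2 x : nat -> F, (forall l, tO D n (x l)) & m = \sum_(l < r`!) nf v r l *: fscale (x l) (wvec w).
Proof.
rewrite /lat; case: (cid _) => N /= ->; split=> [[y yE ->]|[x xO ->]].
  have [x xE] := choice (fun l => let: ex_intro2 x nx e := yE l in
    ex_intro (fun x => tO D n x /\ y l = fscale x (wvec w)) x (conj nx e)).
  exists x; first by move=> l; have [] := xE l.
  by apply: eq_bigr => l _; have [_ ->] := xE l.
exists (fun l => fscale (x l) (wvec w)) => // l.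
by exists (x l).
Qed.

Lemma lat_base_lat w n x : tO D n x -> fscale x (wvec w) \in lat w n.
Proof.
move=> nx; rewrite /lat; case: (cid _) => N /= NE; apply/NE.
by apply: nf_span_base; [exact: lat_base0 | exact: lat_base_lin | exists x].
Qed.

Lemma lat_fs w m n x a : tO D m x -> a \in lat w n -> fscale x a \in lat w (m + n).
Proof.
move=> mx /latP[y ny ->]; apply/latP; exists (fun l => x * y l).
  by move=> l; exact: tOM.
by rewrite fscale_sum; apply: eq_bigr => l _; rewrite -fscaleC fscaleA.
Qed.

Lemma lat_O w n x a : O x -> a \in lat w n -> fscale x a \in lat w n.
Proof. by move=> /tO_O; exact: lat_fs. Qed.

Lemma lat_div w n a : a \in lat w n -> exists2 a', a' \in lat w 0 & a = fscale (t ^+ n) a'.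
Proof.
case/latP=> x nx ->.
have [y yE] := choice (fun l => let: ex_intro2 y Oy e := nx l in
    ex_intro (fun y => O y /\ x l = t ^+ n * y) y (conj Oy e)).
exists (\sum_(l < r`!) nf v r l *: fscale (y l) (wvec w)).
  by apply/latP; exists y => // l; apply: tO_O; have [] := yE l.
by rewrite fscale_sum; apply: eq_bigr => l _; rewrite -fscaleC fscaleA; have [_ ->] := yE l.
Qed.

Lemma lat_leq w m n a : (m <= n)%N -> a \in lat w n -> a \in lat w m.
Proof.
move=> mn /latP[x nx ->]; apply/latP; exists x => // l.
exact: tO_leq (nx l).
Qed.

Lemma uniform_bound (I : finType) (P : I -> nat -> Prop) :
  (forall i m n, (m <= n)%N -> P i m -> P i n) -> (forall i, exists n, P i n) ->
  exists n, forall i, P i n.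
Proof.
move=> mono /choice[f fP]; exists (\max_i f i) => i.
by apply: mono (fP i); exact: leq_bigmax.
Qed.

Lemma O_leq m n x : (m <= n)%N -> O (t ^+ m * x) -> O (t ^+ n * x).
Proof.
move=> mn Ox; rewrite -(subnK mn) exprD -mulrA.
by apply: dvrM => //; exact: dvr_tX.
Qed.

(** The normal forms applied to weight vectors have finitely many coordinates, so one power of t
    clears all denominators, whatever [n]. *)
Lemma lat_coord : exists k, forall w n m u, m \in lat w (n + k) -> tO D n (coord m u).
Proof.
have [k kP] := @uniform_bound ('S_r * 'S_r * 'I_r`!)%type
  (fun p k => O (t ^+ k * coord (nf v r p.2 *: wvec p.1.1) p.1.2))
  (fun _ _ _ => @O_leq _ _ _) (fun _ => dvr_bound D _).
exists k => w n m u /latP[x nx ->]; rewrite coord_sum.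
apply: (@big_ind _ (tO D n)); [exact: tO0 | by move=> *; exact: tOD | move=> l _].
rewrite fscaleC coord_fscale; have [y Oy ->] := nx l.
rewrite exprD -!mulrA mulrCA mulrA; exists (t ^+ k * (y * coord (nf v r l *: wvec w) u)).
  by rewrite mulrCA; apply: dvrM => //; exact: (kP (w, u, l)).
by ring.
Qed.

(** Adjacent transpositions generate: a longer transposition is the conjugate of a shorter one by a
    simple reflection. *)
Lemma perm_simple_ind (P : 'S_r -> Prop) w :
  P w -> (forall i u, P u -> P (simple_refl i * u)%g) -> forall u, P u.
Proof.
move=> Pw Ps.
pose G z := forall u, P u -> P (z * u)%g.
have GM x y : G x -> G y -> G (x * y)%g.
  by move=> Gx Gy u Pu; rewrite -mulgA; apply/Gx/Gy.
have Gadj n (i j : 'I_r) : (j = i + n :> nat)%N -> G (tperm i j).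
  elim: n i j => [|n IH] i j ij.
    rewrite (_ : j = i) ?tperm1 => [u|]; first by rewrite mul1g.
    by apply: val_inj; rewrite /= ij addn0.
  have jr : (j.-1 < r.-1)%N by have := ltn_ord j; lia.
  pose k := Ordinal jr.
  have hk : hi k = j by apply: val_inj; move: ij => /=; lia.
  have [n0|n0] := posnP n.
    have -> : tperm i j = simple_refl k.
      rewrite /simple_refl hk; congr (tperm _ _); apply: val_inj => /=.
      by move: ij; rewrite n0; lia.
    exact: Ps.
  have -> : tperm i j = (simple_refl k * (tperm i (lo k) * simple_refl k))%g.
    have e : (tperm i (lo k) ^ simple_refl k = tperm i j)%g.
      by rewrite tpermJ simple_reflL hk simple_reflD // -val_eqE /=; lia.
    by rewrite -e conjgE /simple_refl tpermV.
  apply: (GM); first exact: Ps.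
  apply: (GM); last exact: Ps.
  by apply: IH => /=; lia.
have Gt i j : G (tperm i j).
  have [ij|ji] := leqP i j; first by apply: (Gadj (j - i)%N); rewrite subnKC.
  by rewrite tpermC; apply: (Gadj (i - j)%N); rewrite subnKC // ltnW.
have GT z : G z.
  have [ts -> _] := prod_tpermP z; elim: ts => [|p ts IH].
    by rewrite big_nil => u; rewrite mul1g.
  by rewrite big_cons; apply: GM.
by move=> u; have := GT (u * w^-1)%g w Pw; rewrite mulgKV.
Qed.

(** The coefficient equals (E - q C) / (E - C) for the weights C and E at the two positions, so that
    it vanishes only at the ratio q, which [deform_generic] excludes. Irreducibility over K(t)
    enters in this form. *)
Lemma cdiag_neq i (u : 'S_r) :
  q - cdiag v D (beta (u (lo i))) (beta (u (hi i))) != 0.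
Proof.
have q0 : (v ^+ 2)^-1 != 0 by rewrite invr_neq0 // expf_neq0.
have hl : u (hi i) != u (lo i) by rewrite (inj_eq perm_inj) eq_sym lo_neq_hi.
have h1 := deform_generic D b (expf_neq0 2 v_neq0) hl.
have h2 := deform_generic D b (oner_neq0 K) hl.
rewrite rmorph1 mul1r in h2; rewrite rmorphXn in h1.
move: h1 h2; rewrite /cdiag -/(deform D b).
set C := beta (u (lo i)); set E := beta (u (hi i)) => h1 h2.
have EC : E - C != 0 by rewrite subr_eq0.
have -> : q - (q - 1) * E / (E - C) = (E - q * C) / (E - C) by field.
by rewrite mulf_neq0 ?invr_neq0 // subr_eq0.
Qed.

(** In [T_i wvec u = a wvec u + g wvec (s_i u)] the coefficient [g] is nonzero; solving for the new
    weight vector carries the claim from [u] to its neighbour. *)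
Lemma lat_absorb1 w u : exists k, forall x, O x -> fscale (t ^+ k * x) (wvec u) \in lat w 0.
Proof.
apply: (@perm_simple_ind (fun u => exists k, forall x, O x ->
    fscale (t ^+ k * x) (wvec u) \in lat w 0) w);
  last move=> i {}u [k kP].
  by exists 0 => x Ox; rewrite mul1r; apply/lat_base_lat/tO_O.
pose s := simple_refl i.
have ss : (s * (s * u))%g = u by rewrite mulgA simple_reflK mul1g.
pose a := cdiag v D (beta (u (lo i))) (beta (u (hi i))).
pose g := q - cdiag v D (beta ((s * u)%g (lo i))) (beta ((s * u)%g (hi i))).
have g0 : g != 0 := cdiag_neq i (s * u)%g.
have TE : hT v i *: wvec u = fscale a (wvec u) + fscale g (wvec (s * u)%g).
  apply: coord_inj => z; rewrite coord_T coordD !coord_fscale !coord_wvec.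
  have su : (s * u == u)%g = false.
    apply/eqP => /permP/(_ (lo i)); rewrite permM simple_reflL => /perm_inj/esym/eqP.
    by rewrite (negPf (lo_neq_hi i)).
  have e : (s * z == u)%g = (z == s * u)%g by rewrite -(inj_eq (mulgI s)) mulgA simple_reflK mul1g.
  rewrite e; have [->|zu] := eqVneq z u; first by rewrite [u == _]eq_sym su !mulr0 !addr0.
  by have [->|_] := eqVneq z (s * u)%g; rewrite !(mulr0, mulr1, addr0, add0r).
have [m mP] := dvr_bound D a; have [n nP] := dvr_bound D g^-1.
(* Here [k] comes from [u], while t^m and t^n clear the denominators of [a] and of the inverse of
   [g]. *)
exists (k + m + n)%N => x Ox.
have -> : fscale (t ^+ (k + m + n) * x) (wvec (s * u)%g) =
    hT v i *: fscale (t ^+ k * (t ^+ m * (t ^+ n * g^-1) * x)) (wvec u) -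
    fscale (t ^+ k * ((t ^+ m * a) * (t ^+ n * g^-1) * x)) (wvec u).
  rewrite fscaleC TE fscaleD !fscaleA !exprD.
  apply: coord_inj => z; rewrite !(coordD, coordN, coord_fscale); field.
  by rewrite g0.
rewrite -scaleN1r; apply: rpredD; last apply: rpredZ.
  apply: rpredZ; apply: kP; apply: dvrM => //; apply: dvrM => //; exact: dvr_tX.
by apply: kP; apply: dvrM => //; apply: dvrM.
Qed.

Lemma lat_absorb : exists k, forall w u n x, tO D (n + k) x -> fscale x (wvec u) \in lat w n.
Proof.
have [|k kP] := @uniform_bound ('S_r * 'S_r)%type
  (fun p k => forall x, O x -> fscale (t ^+ k * x) (wvec p.2) \in lat p.1 0) _
  (fun p => lat_absorb1 p.1 p.2).
  move=> p m n mn H x Ox; rewrite -(subnKC mn) exprD -mulrA.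
  by apply: H; apply: dvrM => //; exact: dvr_tX.
exists k => w u n x [y Oy ->].
rewrite exprD -mulrA -fscaleA -[n]addn0; apply: lat_fs.
  by exists 1; rewrite ?mulr1 ?addn0 //; exact: dvr1.
exact: kP (w, u) _ Oy.
Qed.

Lemma M_expand m : m = \sum_u fscale (coord m u) (wvec u).
Proof.
apply: coord_inj => u; rewrite coord_sum (bigD1 u) //= coord_fscale coord_wvec eqxx mulr1.
rewrite big1 ?addr0 // => z zu.
by rewrite coord_fscale coord_wvec eq_sym (negPf zu) mulr0.
Qed.

(* The r! normal forms span a space of dimension r! when applied to [wvec w]. *)
Lemma nf_wvec_free w (x : nat -> F) :
  \sum_(l < r`!) nf v r l *: fscale (x l) (wvec w) = 0 -> forall l, (l < r`!)%N -> x l = 0.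
Proof.
move=> x0.
pose N : 'M[F]_(r`!, #|{: 'S_r}|) := \matrix_(l, u) coord (nf v r l *: wvec w) (enum_val u).
have [k kP] := lat_absorb.
have dlE u : exists c : nat -> F, wvec u = \sum_(l < r`!) nf v r l *: fscale (c l) (wvec w).
  have /latP[y _ yE] : fscale (t ^+ k) (wvec u) \in lat w 0.
    by apply: kP; exists 1; [exact: dvr1 | rewrite mulr1].
  exists (fun l => (t ^+ k)^-1 * y l).
  transitivity (fscale (t ^+ k)^-1 (fscale (t ^+ k) (wvec u))).
    by rewrite fscaleA mulVf ?fscale1 // tX_neq0.
  by rewrite yE fscale_sum; apply: eq_bigr => l _; rewrite -fscaleC fscaleA.
have [c cE] := choice dlE.
pose C : 'M[F]_(#|{: 'S_r}|, r`!) := \matrix_(u, l) c (enum_val u) l.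
have CN : C *m N = 1%:M.
  apply/matrixP => i j; rewrite mxE [RHS]mxE -(inj_eq enum_val_inj) eq_sym -coord_wvec cE.
  rewrite [RHS](coord_sum (index_enum _)).
  by under eq_bigr do rewrite !mxE -coord_fscale -fscaleC.
have Nfree : row_free N.
  have : row_full N by apply/row_fullP; exists C.
  by rewrite /row_full /row_free => /eqP->; rewrite card_Sn.
have : (\row_l x l) *m N = 0.
  apply/rowP => u; rewrite mxE [RHS]mxE -[RHS](coord0 (enum_val u)) -[X in _ = coord X _]x0 coord_sum.
  by apply: eq_bigr => l _; rewrite !mxE fscaleC coord_fscale.
move/eqP; rewrite (mulmx_free_eq0 _ Nfree) => /eqP/rowP z l lr.
by have := z (Ordinal lr); rewrite !mxE.
Qed.

(** Coefficients in normal forms are unique by freeness, so integrality can be read off any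
    expansion over F. *)
Lemma nf_wvec_lat w n (x : nat -> F) :
  \sum_(l < r`!) nf v r l *: fscale (x l) (wvec w) \in lat w n -> forall l, (l < r`!)%N -> tO D n (x l).
Proof.
case/latP=> y ny xy l lr.
have : \sum_(l < r`!) nf v r l *: fscale (x l - y l) (wvec w) = 0.
  under eq_bigr do rewrite fscaleDl scalerDr.
  rewrite big_split /= xy -big_split /= big1 // => i _.
  by rewrite -scalerDr -fscaleDl subrr fscale0l scaler0.
by move/(@nf_wvec_free w (fun l => x l - y l))/(_ l lr)/eqP; rewrite subr_eq0 => /eqP->.
Qed.

(** * Reductions of the lattices modulo t^N *)

Definition latq w N : lmodType A := subquot (lat w 0) (lat w N).

Definition latq_pi w N (m : M) : latq w N := sqpi (lat w 0) (lat w N) m.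

Lemma latq_pi_eq w N m m' : m \in lat w 0 -> m' \in lat w 0 ->
  (latq_pi w N m = latq_pi w N m' <-> m - m' \in lat w N).
Proof. exact: sqpi_eq. Qed.

Lemma latq_pi_eq0 w N m : m \in lat w 0 -> (latq_pi w N m = 0 <-> m \in lat w N).
Proof. exact: sqpi_eq0. Qed.

Lemma latq_piD w N m m' : m \in lat w 0 -> m' \in lat w 0 ->
  latq_pi w N (m + m') = latq_pi w N m + latq_pi w N m'.
Proof. exact: sqpiD. Qed.

Lemma latq_piZ w N a m : m \in lat w 0 -> latq_pi w N (a *: m) = a *: latq_pi w N m.
Proof. exact: sqpiZ. Qed.

Lemma latq_pi_sum w N I (s : seq I) (f : I -> M) : (forall i, f i \in lat w 0) ->
  latq_pi w N (\sum_(i <- s) f i) = \sum_(i <- s) latq_pi w N (f i).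
Proof. exact: sqpi_sum. Qed.

Lemma latq_pi_surj w N (x : latq w N) : exists2 m, m \in lat w 0 & latq_pi w N m = x.
Proof. exact: sqpi_surj. Qed.

Lemma latq_lift w N (L : lmodType A) (g : M -> L) :
  (forall a x y, x \in lat w 0 -> y \in lat w 0 -> g (a *: x + y) = a *: g x + g y) ->
  (forall x, x \in lat w 0 -> x \in lat w N -> g x = 0) ->
  exists h : {linear latq w N -> L}, forall x, x \in lat w 0 -> h (latq_pi w N x) = g x.
Proof. exact: sq_lift. Qed.

Opaque lat latq latq_pi.

Lemma lat_nf w n (x : nat -> F) m : (forall l, O (x l)) -> m \in lat w n ->
  \sum_(l < r`!) nf v r l *: fscale (x l) m \in lat w n.
Proof. by move=> Ox mn; apply: rpred_sum => l _; apply: rpredZ; exact: lat_O. Qed.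

Lemma latB w n m m' : m \in lat w n -> m' \in lat w n -> m - m' \in lat w n.
Proof. by move=> mn mn'; rewrite -scaleN1r; apply/rpredD/rpredZ. Qed.

Lemma wvec_lat w : wvec w \in lat w 0.
Proof. by rewrite -[wvec w]fscale1; apply: lat_base_lat; exact/tO_O/dvr1. Qed.

Lemma lat0P w m : m \in lat w 0 ->
  exists2 x : nat -> F, (forall l, O (x l)) & m = \sum_(l < r`!) nf v r l *: fscale (x l) (wvec w).
Proof. by case/latP=> x xO ->; exists x => // l; exact: O_tO (xO l). Qed.

Lemma dvr_expand N x : O x -> exists (k : nat -> K) y,
  O y /\ x = \sum_(j < N) D (k j) * t ^+ j + t ^+ N * y.
Proof.
move=> Ox; elim: N => [|N [k [y [Oy xE]]]].
  by exists (fun=> 0), x; rewrite big_ord0 add0r mul1r.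
have [c [z [Oz yE]]] := dvr_residue Oy.
exists (fun j => if j == N then c else k j), z; split=> //.
rewrite xE yE big_ord_recr /= eqxx -addrA mulrDr mulrA -exprSr [t ^+ N * D c]mulrC.
by congr (_ + _); apply: eq_bigr => j _; rewrite ltn_eqF.
Qed.

(** Truncated t-adic expansion of the coefficients: the products of t^j, j < N, with the normal
    forms of [wvec w] generate over K. *)
Lemma latq_fin_dim w N : fin_dim (latq w N).
Proof.
apply: (@fin_dim_fin _ _ ('I_r`! * 'I_N)%type _
  (fun p => latq_pi w N (nf v r p.1 *: fscale (t ^+ p.2) (wvec w)))) => x.
have [m m0 <-] := latq_pi_surj x; have [y Oy mE] := lat0P m0.
have [k kE] := choice (fun l => dvr_expand N (Oy l)).
have [z zE] := choice kE.
have base l j : nf v r l *: fscale (t ^+ j) (wvec w) \in lat w 0.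
  by apply: rpredZ; apply: lat_O; [exact: dvr_tX | exact: wvec_lat].
exists (fun p : 'I_r`! * 'I_N => k p.1 p.2).
transitivity (latq_pi w N (\sum_(p : 'I_r`! * 'I_N)
  (k p.1 p.2)%:A *: (nf v r p.1 *: fscale (t ^+ p.2) (wvec w)))); last first.
  rewrite latq_pi_sum; last by move=> p; exact/rpredZ/base.
  by apply: eq_bigr => p _; rewrite latq_piZ //; exact: base.
have sum0 : \sum_(p : 'I_r`! * 'I_N)
    (k p.1 p.2)%:A *: (nf v r p.1 *: fscale (t ^+ p.2) (wvec w)) \in lat w 0.
  by apply: rpred_sum => p _; exact/rpredZ/base.
apply/(latq_pi_eq _ m0 sum0).
have -> : m - \sum_(p : 'I_r`! * 'I_N) (k p.1 p.2)%:A *: (nf v r p.1 *: fscale (t ^+ p.2) (wvec w)) =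
    \sum_(l < r`!) nf v r l *: fscale (z l) (fscale (t ^+ N) (wvec w)).
  apply/eqP; rewrite subr_eq; apply/eqP; rewrite mE.
  rewrite -(pair_bigA _ (fun (l : 'I_r`!) (j : 'I_N) =>
    (k l j)%:A *: (nf v r l *: fscale (t ^+ j) (wvec w)))) -big_split.
  apply: eq_bigr => l _ /=; rewrite (zE l).2 fscaleDl addrC scalerDr fscaleA [t ^+ N * _]mulrC.
  congr (_ + _); apply: coord_inj => u; rewrite fscaleC coord_fscale coord_sum mulr_suml.
  by apply: eq_bigr => j _; rewrite fscale_cst coord_fscale fscaleC coord_fscale mulrA.
apply: lat_nf; first by move=> l; exact: (zE l).1.
by apply: lat_base_lat; exists 1; rewrite ?mulr1 //; exact: dvr1.
Qed.

Definition latq_fd w N : fdmod A := FdMod (latq_fin_dim w N).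

Lemma latq_map w w' N N' x :
  (forall m, m \in lat w 0 -> fscale x m \in lat w' 0) ->
  (forall m, m \in lat w 0 -> m \in lat w N -> fscale x m \in lat w' N') ->
  exists h : {linear latq w N -> latq w' N'},
    forall m, m \in lat w 0 -> h (latq_pi w N m) = latq_pi w' N' (fscale x m).
Proof.
move=> x0 xN; apply: (@latq_lift w N (latq w' N') (fun m => latq_pi w' N' (fscale x m))).
  move=> a m m' m0 m0'; rewrite fscale_lin latq_piD ?latq_piZ //;
    by [apply: rpredZ; apply: x0 | apply: x0].
move=> m m0 mN; apply/latq_pi_eq0; first exact: x0.
exact: xN.
Qed.

Lemma latq_scale w N x : O x ->
  exists h : {linear latq w N -> latq w N},
    forall m, m \in lat w 0 -> h (latq_pi w N m) = latq_pi w N (fscale x m).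
Proof. by move=> Ox; apply: latq_map => m *; exact: lat_O. Qed.

Lemma bounds : exists k,
  [/\ forall w n m u, m \in lat w (n + k) -> tO D n (coord m u),
      forall w u n x, tO D (n + k) x -> fscale x (wvec u) \in lat w n &
      forall i j, i != j -> O (t ^+ k * (beta i - beta j)^-1)].
Proof.
have [k1 H1] := lat_coord; have [k2 H2] := lat_absorb.
have [k3 H3] := @uniform_bound ('I_r * 'I_r)%type
  (fun p k => O (t ^+ k * (beta p.1 - beta p.2)^-1))
  (fun _ _ _ => @O_leq _ _ _) (fun _ => dvr_bound D _).
exists (k1 + k2 + k3)%N; split=> [w n m u mn|w u n x nx|i j _].
- by apply: (H1 w); apply: lat_leq mn; lia.
- by apply: H2; apply: tO_leq nx; lia.
- by apply: (@O_leq k3); [lia | exact: (H3 (i, j))].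
Qed.

(** If the generator lay in t times the lattice, the lattice would equal its own multiple by t and
    lie in all t^n multiples, against the bounded denominators of [lat_coord]. *)
Lemma wvec_notin1 w : wvec w \notin lat w 1.
Proof.
apply/negP => d1; have [k [kc _ _]] := bounds.
have step n m : m \in lat w n -> m \in lat w n.+1.
  case/lat_div=> m' /lat0P[x Ox ->] ->; rewrite -addn1; apply: lat_fs; last exact: lat_nf.
  by exists 1; rewrite ?mulr1 //; exact: dvr1.
have dn n : wvec w \in lat w n by elim: n => [|n IH]; [exact: wvec_lat | exact: step].
have := kc w 1 (wvec w) w (dn _); rewrite coord_wvec eqxx => /(@tO_tX _ _ D 1 0).
by [].
Qed.

(* A natural idempotent maps the weight vector [wvec w] to a scalar multiple of itself up to a
   high power of t; the scalar is idempotent up to a high power of t, hence close to 0 or 1. *)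
Lemma latq_idempotent w N : exists2 N', (N <= N')%N &
  forall e : {linear latq w N' -> latq w N'}, (forall x, e (e x) = e x) ->
  (forall (h : {linear latq w N' -> latq w N'}) x, h (e x) = e (h x)) ->
  (forall m, m \in lat w 0 -> exists2 m', m' \in lat w N & e (latq_pi w N' m) = latq_pi w N' m') \/
  (forall m, m \in lat w 0 -> exists2 m', m' \in lat w N & e (latq_pi w N' m) = latq_pi w N' (m + m')).
Proof.
have [k [kc ka kb]] := bounds.
(* Five losses of t^k: passing to coordinates, dividing by a difference of weights, returning to the
   lattice, passing to coordinates again, and cancelling a factor t^k. *)
have [N' [n1 n4]] : exists N', (N + 4 * k + k <= N')%N /\ (N + 2 * k <= N')%N.
  by exists (N + 5 * k)%N; split; lia.
have n2 : (k + (N + 3 * k) <= N + 4 * k)%N by lia.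
have n3 : (N + 2 * k + k <= N + 3 * k)%N by lia.
have n5 : (N + k + k <= N + 2 * k)%N by lia.
have n6 : (N <= N + 2 * k)%N by lia.
have n7 : (N <= N')%N := leq_trans n6 n4.
exists N' => // e ee e_nat.
have [mu mu0 muE] := latq_pi_surj (e (latq_pi w N' (wvec w))).
(* Multiplication by [x] in O is an endomorphism of the reduction, and naturality makes [e] commute
   with it. *)
have e_fs x m m' : O x -> m \in lat w 0 -> m' \in lat w 0 ->
    e (latq_pi w N' m) = latq_pi w N' m' -> e (latq_pi w N' (fscale x m)) = latq_pi w N' (fscale x m').
  move=> Ox m0 m0' em; have [h hE] := latq_scale w N' Ox.
  by rewrite -hE // -e_nat em hE.
(* Thus [mu], a lift of the image of [wvec w], is still a weight vector modulo t^N', and its other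
   coordinates are small. *)
have weight j : hX v j *: mu - fscale (beta (w j)) mu \in lat w N'.
  have bm0 : fscale (beta (w j)) mu \in lat w 0 by apply: lat_O => //; exact: deform_O.
  have Xm0 : hX v j *: mu \in lat w 0 by apply: rpredZ.
  apply/(latq_pi_eq _ Xm0 bm0).
  rewrite latq_piZ // muE -linearZ_LR -[_ *: latq_pi _ _ _]latq_piZ ?wvec_lat //.
  rewrite -[wvec w in LHS]fscale1 hX_wvec mulr1; apply: e_fs => //; [exact: deform_O | exact: wvec_lat].
have off u : u != w -> tO D (N + 3 * k) (coord mu u).
  move=> uw; have [j uj] : exists j, u j != w j.
    apply/existsP; rewrite -negb_forall; apply: contra uw => /forallP uE.
    by apply/eqP/permP => j; apply/eqP.
  have := kc w (N + 4 * k)%N _ u (lat_leq _ (weight j)).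
  rewrite coordD coordN coord_X coord_fscale -mulrBl => /(_ n1) H.
  apply: (@tO_cancel _ _ D k); apply: (tO_leq n2).
  have b0 : beta (u j) - beta (w j) != 0 by rewrite subr_eq0 (inj_eq (@deform_inj _ _ _ _ _)).
  have -> : t ^+ k * coord mu u =
    (t ^+ k * (beta (u j) - beta (w j))^-1) * ((beta (u j) - beta (w j)) * coord mu u) by field.
  by apply: tOMl H; exact: kb.
pose p := coord mu w; pose nu := mu - fscale p (wvec w).
have nuN : nu \in lat w (N + 2 * k).
  rewrite /nu {1}[mu]M_expand (bigD1 w) //= addrAC subrr add0r.
  apply: rpred_sum => u uw; apply: ka; exact: tO_leq n3 (off u uw).
have nu0 : nu \in lat w 0 by exact: lat_leq (leq0n _) nuN.
(* So far [p] may have a denominator, so that multiplication by [p] itself need not preserve the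
   lattice. *)
have Otp : O (t ^+ k * p).
  rewrite -coord_fscale; apply: (@O_tO _ _ _ 0); apply: (kc w); rewrite addnC; apply: lat_fs => //.
  by exists 1; rewrite ?mulr1 //; exact: dvr1.
have emu : e (latq_pi w N' mu) = latq_pi w N' mu by rewrite muE ee.
(* Apply [e] to t^k mu = t^k p wvec + t^k nu. The left side is fixed, the first term becomes t^k p
   mu, and the last stays in [lat w (N + 2 * k)] because [nu] is t^(N + 2k) times a lattice
   vector. *)
have key : fscale (t ^+ k) mu - fscale (t ^+ k * p) mu \in lat w (N + 2 * k).
  have [nu' nu'0 nuE] := lat_div nuN.
  have [nu2 nu20 nu2E] := latq_pi_surj (e (latq_pi w N' nu')).
  have [Ok ON] := (dvr_tX D k, dvr_tX D (N + 2 * k)).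
  have tmu0 : fscale (t ^+ k) mu \in lat w 0 by apply: lat_O.
  have tpmu0 : fscale (t ^+ k * p) mu \in lat w 0 by apply: lat_O.
  have tnu20 : fscale (t ^+ k * t ^+ (N + 2 * k)) nu2 \in lat w 0.
    by apply: lat_O => //; exact: dvrM.
  have : fscale (t ^+ k) mu -
      (fscale (t ^+ k * p) mu + fscale (t ^+ k * t ^+ (N + 2 * k)) nu2) \in lat w N'.
    apply/(latq_pi_eq _ tmu0 (rpredD tpmu0 tnu20)).
    apply: etrans (esym (latq_piD _ tpmu0 tnu20)).
    have E1 := e_fs _ _ _ Ok mu0 mu0 emu.
    have E2 := e_fs _ _ _ Otp (wvec_lat w) mu0 (esym muE).
    have E3 := e_fs _ _ _ (dvrM Ok ON) nu'0 nu20 (esym nu2E).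
    apply: etrans (esym E1) _; apply: etrans (congr2 +%R E2 E3).
    apply: etrans (linearD e _ _); congr (e _).
    have d0 : fscale (t ^+ k * p) (wvec w) \in lat w 0 by apply: lat_O => //; exact: wvec_lat.
    have n0 : fscale (t ^+ k * t ^+ (N + 2 * k)) nu' \in lat w 0 by apply: lat_O => //; exact: dvrM.
    apply: etrans (latq_piD _ d0 n0); congr (latq_pi w N' _).
    by rewrite -!fscaleA -fscaleD -nuE /nu addrC subrK.
  move=> H; have H1 := lat_leq (_ : (N + 2 * k <= N')%N) H.
  have H2 : fscale (t ^+ k * t ^+ (N + 2 * k)) nu2 \in lat w (N + 2 * k).
    rewrite -fscaleA; apply: lat_O => //; rewrite -[X in lat w X]addn0; apply: lat_fs => //.
    by exists 1; rewrite ?mulr1 //; exact: dvr1.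
  move: (H1 n4) H2.
  move: (fscale (_ * t ^+ _) nu2) (fscale (t ^+ k) mu) (fscale (t ^+ k * p) mu) => x y z yzx xN.
  by rewrite -[y - z](subrK x); apply: rpredD => //; rewrite -addrA -opprD.
(* The coordinate of [key] at [w]. *)
have : tO D N (p - p ^+ 2).
  apply: (@tO_cancel _ _ D k); rewrite addnC.
  have := kc w (N + k)%N _ w (lat_leq n5 key); rewrite coordD coordN !coord_fscale -/p.
  by rewrite (_ : t ^+ k * p - t ^+ k * p * p = t ^+ k * (p - p ^+ 2)) //; ring.
case/idempotent_tO => Op pN.
have nuN' : nu \in lat w N by exact: lat_leq n6 nuN.
have e_sum x : (forall l, O (x l)) ->
    e (latq_pi w N' (\sum_(l < r`!) nf v r l *: fscale (x l) (wvec w))) =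
    latq_pi w N' (\sum_(l < r`!) nf v r l *: fscale (x l) mu).
  move=> Ox; rewrite !latq_pi_sum; last 2 first.
  - by move=> l; apply/rpredZ/lat_O.
  - by move=> l; apply/rpredZ/lat_O => //; exact: wvec_lat.
  rewrite linear_sum; apply: eq_bigr => l _.
  rewrite !latq_piZ ?lat_O ?wvec_lat // linearZ_LR; congr (_ *: _).
  by apply: e_fs => //; exact: wvec_lat.
case: pN => pN; [left | right] => m /lat0P[x Ox ->]; rewrite e_sum //.
  exists (\sum_(l < r`!) nf v r l *: fscale (x l) mu) => //; apply: lat_nf => //.
  by rewrite -[mu](subrK (fscale p (wvec w))); apply: rpredD => //; exact: lat_base_lat.
exists (\sum_(l < r`!) nf v r l *: fscale (x l) (mu - wvec w)).
  apply: lat_nf => //; have -> : mu - wvec w = nu - fscale (1 - p) (wvec w).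
    by apply: coord_inj => u; rewrite /nu !(coordD, coordN, coord_fscale); ring.
  by apply: latB => //; exact: lat_base_lat.
rewrite -big_split; congr (latq_pi w N' _); apply: eq_bigr => l _ /=.
by rewrite -scalerDr -fscaleD addrC subrK.
Qed.

Section Linking.
Variables (P1 P2 : fdmod A -> Prop).
Hypotheses (a1 : abelian_subcat P1) (a2 : abelian_subcat P2) (sum12 : cat_sum P1 P2).

Lemma latq_proj w N N' : (N <= N')%N -> exists h : {linear latq w N' -> latq w N},
  (forall m, m \in lat w 0 -> h (latq_pi w N' m) = latq_pi w N m) /\ (forall y, exists x, h x = y).
Proof.
move=> NN'; have [||h hE] := @latq_map w w N' N 1.
- by move=> m; rewrite fscale1.
- by move=> m _; rewrite fscale1; exact: lat_leq.
have hE' m (m0 : m \in lat w 0) : h (latq_pi w N' m) = latq_pi w N m.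
  exact: etrans (hE _ m0) (congr1 _ (fscale1 _)).
exists h; split=> // y; have [m m0 <-] := latq_pi_surj y.
by exists (latq_pi w N' m); exact: hE'.
Qed.

(** The idempotents of the reduction modulo t^N' are trivial only modulo t^N, which is what the
    criterion asks of the surjection between the two reductions. *)
Lemma latq_summand w N : P1 (latq_fd w N) \/ P2 (latq_fd w N).
Proof.
have [N' NN' N'e] := latq_idempotent w N.
have [rho [rhoE rho_surj]] := latq_proj w NN'.
apply: (@summand_idempotent _ _ P1 P2 (latq_fd w N') (latq_fd w N) rho a1 a2 sum12 rho_surj).
move=> e ee e_nat; have [eN|eN] := N'e e ee e_nat; [left|right] => x.
  have [m m0 <-] := latq_pi_surj x; have [m' m'N ->] := eN m m0.
  have m'0 : m' \in lat w 0 := lat_leq (leq0n _) m'N.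
  by rewrite (rhoE _ m'0); apply/(latq_pi_eq0 N m'0).
have [m m0 <-] := latq_pi_surj x; have [m' m'N ->] := eN m m0.
have m'0 : m' \in lat w 0 := lat_leq (leq0n _) m'N.
rewrite (rhoE _ m0) (rhoE _ (rpredD m0 m'0)).
by apply/(latq_pi_eq N (rpredD m0 m'0) m0); rewrite addrC addKr.
Qed.

Lemma latq_neq0 w : ~ zero_mod (latq_fd w 1).
Proof.
by move=> z; have /(latq_pi_eq0 1 (wvec_lat w)) := z (latq_pi w 1 (wvec w)); apply/negP/wvec_notin1.
Qed.

Lemma latq_summand_quot w N : (1 <= N)%N -> P1 (latq_fd w N) -> P1 (latq_fd w 1).
Proof.
move=> N1; have [rho [_ rho_surj]] := latq_proj w N1.
exact: (summand_quot a1 sum12 (M := latq_fd w N) (L := latq_fd w 1) rho_surj).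
Qed.

End Linking.

(* Multiplication by a power of t is a nonzero morphism between the reductions
   modulo t^N, for N large, of the lattices generated by [wvec w] and [wvec w']. *)
Lemma latq_linked w w' P1 P2 : abelian_subcat P1 -> abelian_subcat P2 -> cat_sum P1 P2 ->
  P1 (latq_fd w 1) -> P2 (latq_fd w' 1) -> False.
Proof.
move=> a1 a2 s12 pw pw'; have s21 := cat_sum_sym s12.
(* The factor t^(2k) carries [lat w 0] into [lat w' 0]. Were the image of [wvec w] zero modulo t^N
   with N = 3k + 1, its coordinate t^(2k) would be divisible by t^(2k + 1). *)
have [k [kc ka _]] := bounds; pose N := (3 * k + 1)%N.
have N1 : (1 <= N)%N by rewrite /N; lia.
have N2k : N = (2 * k + 1 + k)%N by rewrite /N; lia.
clearbody N.
(* The reduction modulo t^N is on one side, necessarily that of its nonzero quotient modulo t. *)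
have pwN : P1 (latq_fd w N).
  have [//|/(latq_summand_quot a2 s21 N1) pw2] := latq_summand a1 a2 s12 w N.
  by case: (latq_neq0 (summand_both s12 pw pw2)).
have pwN' : P2 (latq_fd w' N).
  have [/(latq_summand_quot a1 s12 N1) pw2|//] := latq_summand a1 a2 s12 w' N.
  by case: (latq_neq0 (summand_both s12 pw2 pw')).
have m0P m : m \in lat w 0 -> fscale (t ^+ (2 * k)) m \in lat w' 0.
  move=> m0; rewrite mul2n -addnn exprD -fscaleA [fscale _ m]M_expand fscale_sum.
  apply: rpred_sum => u _; rewrite fscaleA; apply: ka; rewrite add0n -[k in tO _ k]addn0.
  apply: tOM; first by exists 1; rewrite ?mulr1 //; exact: dvr1.
  apply: (kc w); rewrite add0n -[X in lat w X]addn0; apply: lat_fs => //.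
  by exists 1; rewrite ?mulr1 //; exact: dvr1.
have [|m m0 /lat_div[m' m'0 ->]|h hE] := @latq_map w w' N N (t ^+ (2 * k)).
- exact: m0P.
- rewrite fscaleA mulrC -fscaleA -[X in lat w' X]addn0; apply: lat_fs; last exact: m0P.
  by exists 1; rewrite ?mulr1 //; exact: dvr1.
have [_ H _] := s12.
have := hE _ (wvec_lat w); rewrite (H (latq_fd w N) (latq_fd w' N) h pwN pwN').
move/esym/(latq_pi_eq0 N (m0P _ (wvec_lat w))); rewrite N2k => /(kc _ _ _ w).
by rewrite coord_fscale coord_wvec eqxx mulr1 => /tO_tX; lia.
Qed.

(** * The modules M_(b o w) inside the reductions modulo t *)

Section WeightModule.
Variables (w : 'S_r) (c : {ffun 'I_r -> K}).
Hypothesis cE : forall j, c j = b (w j).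

Local Notation g := (qpi (J_ideal v c) (1 : regmod A)).

Lemma M_mod_gen (a : A) : a *: g = qpi (J_ideal v c) (a : regmod A).
Proof. by rewrite -[LHS]/(qscale a _) qscaleE; congr (qpi _ _); exact: mulr1. Qed.

Lemma M_mod_X j : hX v j *: g = (c j)%:A *: g.
Proof.
rewrite !M_mod_gen; apply/qpi_eq/asboolP => N; apply.
by exists j.
Qed.

Lemma M_mod_XV j : hXV v j *: g = (c j)^-1%:A *: g.
Proof.
have cj : c j != 0 by rewrite cE.
transitivity ((hXV v j * hX v j) *: ((c j)^-1%:A *: g)); last by rewrite hXVX scale1r.
rewrite -scalerA; congr (_ *: _); rewrite alg_scaleC M_mod_X alg_scaleA.
by rewrite mulVf // scale1r scale1r.
Qed.

Definition line (m : M_mod v c) : Prop := exists k : K, m = k%:A *: g.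

Lemma line0 : line 0.
Proof. by exists 0; rewrite scale0r scale0r. Qed.

Lemma line_lin (a : K) m m' : line m -> line m' -> line ((a%:A : A) *: m + m').
Proof.
by case=> k -> [l ->]; exists (a * k + l); rewrite alg_scaleA scalerDl scalerDl.
Qed.

Lemma line_X j m : line m -> line (hX v j *: m).
Proof.
case=> k ->; exists (k * c j).
by rewrite alg_scaleC M_mod_X alg_scaleA.
Qed.

Lemma line_XV j m : line m -> line (hXV v j *: m).
Proof.
case=> k ->; exists (k * (c j)^-1).
by rewrite alg_scaleC M_mod_XV alg_scaleA.
Qed.

Lemma M_mod_span (m : M_mod v c) :
  exists k : nat -> K, m = \sum_(l < r`!) nf v r l *: ((k l)%:A *: g).
Proof.
rewrite -[m]qpi_repr -M_mod_gen.
have lg : nf_span line g.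
  by apply: nf_span_base; [exact: line0 | exact: line_lin | exists 1; rewrite scale1r scale1r].
have [y yE ->] := nf_span_stable v_neq0 line0 line_lin line_X line_XV (repr m : A) lg.
have [k kE] := choice yE; exists k.
by apply: eq_bigr => l _; rewrite kE.
Qed.

Lemma M_mod_fin_dim : fin_dim (M_mod v c).
Proof.
exists (r`!), (fun l => nf v r l *: g) => m.
have [k ->] := M_mod_span m; exists (fun l => k l).
by apply: eq_bigr => l _; rewrite alg_scaleC.
Qed.

(** The map a |-> a wvec w kills the generators of [J_ideal] modulo t, because beta_(w j) and c_j
    differ by a positive power of t. The normal forms generate [M_mod] over K, and their images are
    independent modulo t by [nf_wvec_lat]. An embedding suffices, the summands being closed under
    subobjects. *)
Lemma M_mod_inj : exists h : {linear M_mod v c -> latq w 1}, injective h.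
Proof.
have [|f fE] := @linear_of A (regmod A) (latq w 1) (fun a => (a : A) *: latq_pi w 1 (wvec w)).
  by move=> a x y; rewrite scalerDl scalerA.
have fX j : f (hX v j - (c j)%:A) = 0.
  rewrite fE scalerBl -!latq_piZ ?wvec_lat // fscale_cst -[X in hX v j *: X]fscale1 hX_wvec mulr1.
  have lb : fscale (beta (w j)) (wvec w) \in lat w 0.
    by apply: lat_O; [exact: deform_O | exact: wvec_lat].
  have lc : fscale (D (c j)) (wvec w) \in lat w 0 by apply: lat_O; [exact: dvr_cst | exact: wvec_lat].
  apply/eqP; rewrite subr_eq0; apply/eqP/(latq_pi_eq 1 lb lc).
  have -> : fscale (beta (w j)) (wvec w) - fscale (D (c j)) (wvec w) = fscale (t ^+ (w j).+1) (wvec w).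
    by apply: coord_inj => u; rewrite !(coordD, coordN, coord_fscale) cE /deform; ring.
  apply: lat_base_lat; apply: (tO_leq (n := (w j).+1)) => //.
  by exists 1; rewrite ?mulr1 //; exact: dvr1.
have [| |N NE] := @submod_of A (regmod A) (fun a => f a = 0).
- exact: linear0.
- by move=> a x y x0 y0; rewrite linearP x0 y0 scaler0 addr0.
have fJ x : x \in J_ideal v c -> f x = 0.
  by move/asboolP => /(_ N) H; apply/NE/H => _ [j ->]; apply/NE.
have [h hE] := quot_lift fJ; exists h.
suff h0 m : h m = 0 -> m = 0 by apply: raddf_inj => m; exact: h0.
have [k ->] := M_mod_span m => hm; rewrite linear_sum in hm.
suff k0 l : (l < r`!)%N -> k l = 0.
  by rewrite big1 // => l _; rewrite k0 // scale0r scale0r scaler0.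
(* A constant divisible by t is 0. *)
move=> lr; have [y Oy yE] : tO D 1 (D (k l)).
  have s0 : \sum_(i < r`!) nf v r i *: fscale (D (k i)) (wvec w) \in lat w 0.
    by apply: (@lat_nf w 0 (fun i => D (k i))); [move=> i; exact: dvr_cst | exact: wvec_lat].
  suff /(latq_pi_eq0 1 s0)/(@nf_wvec_lat w 1 (fun i => D (k i))) H :
      latq_pi w 1 (\sum_(i < r`!) nf v r i *: fscale (D (k i)) (wvec w)) = 0.
    exact: (H l lr).
  rewrite -[RHS]hm latq_pi_sum; last first.
    by move=> i; apply: rpredZ; apply: lat_O; [exact: dvr_cst | exact: wvec_lat].
  apply: eq_bigr => i _; rewrite latq_piZ ?lat_O ?wvec_lat //; last exact: dvr_cst.
  rewrite linearZ_LR linearZ_LR hE fE scale1r -fscale_cst latq_piZ ?wvec_lat //.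
by apply: dvr_cst_tO Oy _; rewrite yE.
Qed.

End WeightModule.

End Lattices.

(** * The localization of K[t] at 0 *)

Section RatioDvr.
Variables (K F : fieldType) (phi : {rmorphism {poly K} -> F}).
Hypotheses (phi_eq0 : forall p, (phi p == 0) = (p == 0))
  (phi_ratio : forall x, exists n d : {poly K}, d != 0 /\ x = phi n / phi d).
Local Notation t := (phi 'X).

Lemma poly_factor_X (p : {poly K}) : p != 0 -> exists n q, q.[0] != 0 /\ p = 'X ^+ n * q.
Proof.
move=> p0; have [n [q]] := multiplicity_XsubC p 0; rewrite p0 subr0 /= => q0 ->.
by exists n, q; rewrite mulrC.
Qed.

Definition local_at0 (x : F) : Prop := exists p q : {poly K}, q.[0] != 0 /\ x = phi p / phi q.

Definition ratio_cst : {rmorphism K -> F} := phi \o @polyC K.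

Lemma at0_neq0 (q : {poly K}) : q.[0] != 0 -> phi q != 0.
Proof. by move=> q0; rewrite phi_eq0; apply: contra_neq q0 => ->; rewrite horner0. Qed.

Lemma local_poly (p : {poly K}) : local_at0 (phi p).
Proof. by exists p, 1; rewrite hornerC oner_neq0 rmorph1 divr1. Qed.

Lemma ratio_valuation (x : F) : x != 0 -> exists m n (p q : {poly K}),
  [/\ p.[0] != 0, q.[0] != 0 & x = (t ^+ m * phi p) / (t ^+ n * phi q)].
Proof.
have [a [d [d0 ->]]] := phi_ratio x => ad.
have a0 : a != 0 by apply: contra_neq ad => ->; rewrite rmorph0 mul0r.
have [m [p [p0 ->]]] := poly_factor_X a0; have [n [q [q0 ->]]] := poly_factor_X d0.
by exists m, n, p, q; rewrite !rmorphM !rmorphXn.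
Qed.

Lemma t_neq0 : t != 0. Proof. by rewrite phi_eq0 polyX_eq0. Qed.

Definition ratio_dvr : dvr K F.
Proof.
apply: (@Dvr K F ratio_cst t local_at0).
- by move=> k; exact: local_poly.
- move=> _ _ [p [q [q0 ->]]] [p' [q' [q0' ->]]]; exists (p * q' + p' * q), (q * q').
  rewrite hornerM mulf_neq0 // rmorphD !rmorphM /=; split=> //.
  by rewrite -addf_div ?at0_neq0.
- move=> _ _ [p [q [q0 ->]]] [p' [q' [q0' ->]]]; exists (p * p'), (q * q').
  by rewrite hornerM mulf_neq0 // !rmorphM /= mulf_div.
- exact: local_poly.
- exact: t_neq0.
- case=> p [q [q0 e]].
  have : phi ('X * p - q) == 0.
    have tF := t_neq0; have qF := at0_neq0 q0; rewrite rmorphB rmorphM subr_eq0 /=.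
    by apply/eqP; transitivity (t * (phi p / phi q) * phi q); [field | rewrite -e; field].
  rewrite phi_eq0 subr_eq0 => /eqP qE.
  by rewrite -qE hornerM hornerX mul0r eqxx in q0.
- move=> x; have [->|x0] := eqVneq x 0; first by left; rewrite -(rmorph0 phi); exact: local_poly.
  have [m [n [p [q [p0 q0 ->]]]]] := ratio_valuation x0.
  have [pF qF] := (at0_neq0 p0, at0_neq0 q0); have tF := t_neq0.
  have [nm|mn] := leqP n m; [left | right].
    exists ('X ^+ (m - n) * p), q; split=> //; rewrite -{1}(subnKC nm) exprD !rmorphM rmorphXn /=.
    by field; rewrite qF expf_neq0.
  (* [dvr_total] splits off one factor t, whence the predecessor in the exponent. *)
  exists (phi ('X ^+ (n - m).-1 * q) / phi p); first by exists ('X ^+ (n - m).-1 * q), p.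
  have -> : n = (m + (n - m).-1.+1)%N by lia.
  rewrite (_ : (m + _ - m).-1 = (n - m).-1); last by lia.
  rewrite exprD exprS !rmorphM !rmorphXn /=.
  by field; rewrite pF qF tF !expf_neq0.
- move=> x; have [->|x0] := eqVneq x 0.
    by exists 0; rewrite mulr0 -(rmorph0 phi); exact: local_poly.
  have [m [n [p [q [p0 q0 ->]]]]] := ratio_valuation x0.
  exists n, ('X ^+ m * p), q; split=> //; rewrite !rmorphM !rmorphXn /=.
  by field; rewrite at0_neq0 // expf_neq0 // t_neq0.
- move=> _ [p [q [q0 ->]]]; have [k kE] : exists k, k * q.[0] = p.[0].
    by exists (p.[0] / q.[0]); rewrite divfK.
  have /factor_theorem[s sE] : root (p - k *: q) 0.
    by rewrite rootE hornerD hornerN hornerZ kE subrr.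
  exists k, (phi s / phi q); split; first by exists s, q.
  have -> : p = k%:P * q + s * 'X.
    by rewrite subr0 -mul_polyC in sE; rewrite -sE addrC subrK.
  rewrite rmorphD !rmorphM /=.
  by field; exact: at0_neq0.
Defined.

End RatioDvr.

Lemma fraction_ratio (R : idomainType) (x : {fraction R}) :
  exists n d : R, d != 0 /\ x = tofrac n / tofrac d.
Proof.
elim/quotW: x => y; exists (frac y).1, (frac y).2.
have d0 := denom_ratioP y; split=> //.
have dF : tofrac (frac y).2 != 0 by rewrite tofrac_eq0.
apply: (mulIf dF); rewrite divfK //; unlock tofrac.
rewrite -[LHS]FracField.pi_mul; apply/eqmodP.
by rewrite /= FracField.equivfE /FracField.mulf !numden_Ratio ?(oner_eq0, mulf_neq0) // !mulr1 mulrC.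
Qed.

Definition fraction_dvr (K : fieldType) : dvr K {fraction {poly K}} :=
  @ratio_dvr K {fraction {poly K}} (@FracField.tofrac {poly K})
    (@tofrac_eq0 {poly K}) (@fraction_ratio {poly K}).

(** * Composition factors *)

Section CompositionFactors.
Variable A : pzRingType.
Implicit Types L M : lmodType A.

Lemma lmod_iso_simple L M : lmod_iso L M -> simple_mod M -> simple_mod L.
Proof.
case=> f /linear_inv[g fK gK] [[m m0] sM]; split.
  by exists (g m); apply: contra_neq m0 => gm; rewrite -[m]gK gm linear0.
move=> N; have [| |N' N'E] := @submod_of A M (fun m => g m \in N).
- by rewrite linear0 rpred0.
- by move=> a x y Nx Ny; rewrite linearP; apply/rpredD/Ny/rpredZ.
have [H|H] := sM N'; [left | right] => x.
  move=> Nx; have : f x = 0 by apply/H/N'E; rewrite fK.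
  by move/(congr1 g); rewrite fK linear0.
by have /N'E := H (f x); rewrite fK.
Qed.

Lemma comp_factor_simple L M : comp_factor L M -> simple_mod L.
Proof. by case=> n [N [[_ _ _ sN] [k kn /lmod_iso_simple]]]; apply; exact: sN. Qed.

Lemma comp_factor_eq_action L M (a a' : A) : comp_factor L M ->
  (forall m : M, a *: m = a' *: m) -> forall l : L, a *: l = a' *: l.
Proof.
case=> n [N [_ [k _ [f /linear_inv[g fK gK]]]]] aM l.
apply: (can_inj fK); rewrite !linearZ_LR.
have [m Nm <-] := sqpi_surj (f l).
by rewrite -!sqpiZ // aM.
Qed.

End CompositionFactors.

Lemma comp_factor_summand (K : fieldType) (A : algType K) (P1 P2 : fdmod A -> Prop)
    (M L : fdmod A) (N0 : submodClosed M) :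
  abelian_subcat P1 -> cat_sum P1 P2 -> P1 M -> comp_factor L (submod N0) -> P1 L.
Proof.
move=> a1 s12 p1 [n [N [_ [k _ [f /linear_inv[g fK gK]]]]]].
have [i iE] := @linear_of A (submod (N k.+1)) M (fun x => val (val x))
  (fun a x y => congr1 val (linearP val a x y)).
have ii : injective i by move=> x y; rewrite !iE => /val_inj/val_inj.
pose S := FdMod (fin_dim_inj ii (fd_dim M)).
have pS : P1 S := summand_sub a1 s12 (L := S) ii p1.
have [h hE] := @linear_of A (submod (N k.+1)) L (fun x => g (qpi (relsub (N k.+1) (N k)) x))
  (fun a x y => etrans (congr1 g (etrans (qpiD _ _ _) (congr2 +%R (esym (qscaleE _ a x)) erefl)))
                       (linearP g a _ _)).
apply: (summand_quot a1 s12 (M := S) (p := h) _ pS) => y.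
by exists (repr (f y)); rewrite hE qpi_repr fK.
Qed.

(** * Weights and central characters of the modules V_s *)

Section Tuples.
Variables (K : fieldType) (v : K) (r : nat).
Hypothesis v_neq0 : v != 0.

Lemma size_seg_seq_flatten (t : seq (segment K)) :
  size (flatten (map (seg_seq v) t)) = (\sum_(s <- t) seg_len s)%N.
Proof.
elim: t => [|s t IH]; first by rewrite big_nil.
by rewrite big_cons /= size_cat IH size_mkseq.
Qed.

Lemma perm_nthP (L L' : seq K) : size L = r -> size L' = r ->
  perm_eq L L' <-> exists w : 'S_r, forall j : 'I_r, nth 0 L j = nth 0 L' (w j).
Proof.
move=> Lr /eqP L'r; have L'E : L' = tval (Tuple L'r) by [].
split=> [|[w wE]]; first rewrite L'E.
  case/tuple_permP=> w ->; exists w => j.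
  by rewrite -tnth_nth tnth_mktuple (tnth_nth 0).
rewrite L'E; apply/tuple_permP; exists w; apply: (@eq_from_nth _ 0) => [|i].
  by rewrite Lr size_tuple.
rewrite Lr => ir; rewrite [LHS](wE (Ordinal ir)).
transitivity (tnth [tuple tnth (Tuple L'r) (w j) | j < r] (Ordinal ir)); last exact: tnth_nth.
by rewrite tnth_mktuple (tnth_nth 0).
Qed.

Definition seg_flat (t : seq (segment K)) : seq K := flatten (map (seg_seq v) t).

Lemma seg_flat_perm t t' : perm_eq t t' -> perm_eq (seg_flat t) (seg_flat t').
Proof. by move=> tt'; apply/perm_flatten/perm_map. Qed.

Lemma seg_flat_neq0 t x : x \in seg_flat t -> x != 0.
Proof.
case/flattenP=> _ /mapP[s _ ->] /mapP[i _ ->].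
rewrite mulf_neq0 ?expfz_neq0 // /seg_center.
by have /andP[] := valP s.
Qed.

Lemma prod_juxt t z : size (seg_flat t) = r ->
  \prod_(j < r) (z - juxt v r t j) = \prod_(x <- seg_flat t) (z - x).
Proof.
move=> sr; rewrite (big_nth 0) sr big_mkord.
by apply: eq_bigr => j _; rewrite ffunE.
Qed.

Lemma juxt_neq0 t j : size (seg_flat t) = r -> juxt v r t j != 0.
Proof. by move=> sr; rewrite ffunE; apply: (@seg_flat_neq0 t); rewrite mem_nth // -/(seg_flat t) sr. Qed.

Lemma size_seg_flat_mseg (s : multisegment K r) t :
  perm_eq t (enum_mset s) -> size (seg_flat t) = r.
Proof.
by move=> ts; rewrite size_seg_seq_flatten (perm_big _ ts) mseg_total.
Qed.

(** The scalar is computed on the generator, a common eigenvector of the [X_j], and centrality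
    extends it to the whole module. *)
Lemma char_X_M_mod (c : {ffun 'I_r -> K}) z (m : M_mod v c) :
  char_X v r z *: m = (\prod_j (z - c j))%:A *: m.
Proof.
have gE : char_X v r z *: qpi (J_ideal v c) (1 : regmod (hecke v r)) =
    (\prod_j (z - c j))%:A *: qpi (J_ideal v c) (1 : regmod (hecke v r)).
  rewrite /char_X; elim: (index_enum _) => [|j s IH]; first by rewrite !big_nil !scale1r.
  rewrite !big_cons -[LHS]scalerA IH alg_scaleC scalerBl M_mod_X -scalerBl -scalerBl.
  by rewrite alg_scaleA mulrC.
rewrite -[m]qpi_repr -M_mod_gen -alg_scaleC -gE.
transitivity ((char_X v r z * (repr m : hecke v r)) *: qpi (J_ideal v c) (1 : regmod (hecke v r))).
  by rewrite -scalerA.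
by rewrite char_X_central // scalerA.
Qed.

Lemma is_V_char_X (s : multisegment K r) (V : lmodType (hecke v r)) z (x : V) : is_V v s V ->
  char_X v r z *: x = (\prod_(y <- seg_flat (enum_mset s)) (z - y))%:A *: x.
Proof.
case=> t [ts cV _]; apply: (comp_factor_eq_action cV) => m.
apply: val_inj; rewrite !linearZ_LR /= char_X_M_mod prod_juxt ?(size_seg_flat_mseg ts) //.
by rewrite (perm_big _ (seg_flat_perm ts)).
Qed.

Lemma is_V_simple (s : multisegment K r) V : is_V v s V -> simple_mod V.
Proof. by case=> t [_ cV _]; exact: comp_factor_simple cV. Qed.

Lemma mseg_tuple_permP (s s' : multisegment K r) :
  (exists sigma : 'S_r, perm_tuple (mseg_tuple v s) sigma = mseg_tuple v s') <->
  perm_eq (seg_flat (enum_mset s')) (seg_flat (enum_mset s)).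
Proof.
have [sr s'r] := (size_seg_flat_mseg (perm_refl (enum_mset s)),
                  size_seg_flat_mseg (perm_refl (enum_mset s'))).
split=> [[w wE]|/(perm_nthP s'r sr)[w wE]].
  apply/(perm_nthP s'r sr); exists w => j.
  by have := congr1 (fun f : {ffun 'I_r -> K} => f j) wE; rewrite !ffunE => ->.
by exists w; apply/ffunP => j; rewrite !ffunE wE.
Qed.

(** One base point a(s) serves both modules: [w0] is 1 for [V_s] itself and the given permutation
    for [V_s'], while the order of the segments chosen in [is_V] only changes [w]. The permutation
    precedes [P1] and [P2], so that the same lattice can be tested against either side. *)
Lemma is_V_summand (s s' : multisegment K r) (V : fdmod (hecke v r)) (w0 : 'S_r) :
  perm_tuple (mseg_tuple v s) w0 = mseg_tuple v s' -> is_V v s' V ->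
  forall s0 : (forall j, mseg_tuple v s j != 0), exists w : 'S_r,
  forall P1 P2, abelian_subcat P1 -> cat_sum P1 P2 ->
    P1 (latq_fd (fraction_dvr K) v_neq0 s0 w 1) -> P1 V.
Proof.
move=> e [t [ts cV _]] s0.
have tr := size_seg_flat_mseg ts.
have s'r := size_seg_flat_mseg (perm_refl (enum_mset s')).
have /(perm_nthP tr s'r)[u uE] := seg_flat_perm ts.
exists (u * w0)%g => P1 P2 a1 s12 pQ.
have cE j : juxt v r t j = mseg_tuple v s ((u * w0)%g j).
  rewrite permM; have := congr1 (fun f : {ffun 'I_r -> K} => f (u j)) e.
  by rewrite [in LHS]ffunE => ->; rewrite !ffunE uE.
pose Mb : fdmod (hecke v r) := FdMod (M_mod_fin_dim v_neq0 s0 cE).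
have [h hi] := M_mod_inj (fraction_dvr K) v_neq0 s0 cE.
have pM : P1 Mb.
  exact: (summand_sub a1 s12 (M := latq_fd (fraction_dvr K) v_neq0 s0 (u * w0)%g 1) (L := Mb) hi pQ).
exact: comp_factor_summand a1 s12 pM cV.
Qed.

End Tuples.

Lemma is_V_same_block (K : fieldType) (v : K) (r : nat) (s s' : multisegment K r)
    (V V' : fdmod (hecke v r)) :
  v != 0 -> is_V v s V -> is_V v s' V' ->
  perm_eq (seg_flat v (enum_mset s')) (seg_flat v (enum_mset s)) -> same_block V V'.
Proof.
move=> v0 hV hV' /mseg_tuple_permP[w' w'E].
have s0 j : mseg_tuple v s j != 0.
  by rewrite /mseg_tuple; apply: juxt_neq0 => //; apply: (@size_seg_flat_mseg _ v _ s).
have idE : perm_tuple (mseg_tuple v s) 1%g = mseg_tuple v s.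
  by apply/ffunP => j; rewrite ffunE perm1.
have [w H] := is_V_summand v0 idE hV s0.
have [u H'] := is_V_summand v0 w'E hV' s0.
have [sV sV'] := (is_V_simple hV, is_V_simple hV').
apply: same_block_simple => // P1 P2 a1 a2 s12 pV pV'; have s21 := cat_sum_sym s12.
have [iV0 iV0'] := ((simple_indecomposable sV).1, (simple_indecomposable sV').1).
have [pw|pw] := latq_summand (fraction_dvr K) v0 s0 a1 a2 s12 w 1; last first.
  exact: iV0 (summand_both s12 pV (H _ _ a2 s21 pw)).
have [pu|pu] := latq_summand (fraction_dvr K) v0 s0 a1 a2 s12 u 1.
  exact: iV0' (summand_both s12 (H' _ _ a1 s12 pu) pV').
exact: latq_linked a1 a2 s12 pw pu.
Qed.

(** Different multisets of weights give different monic polynomials, hence a [z] at which their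
    values differ; then [c] kills [V] and acts on [V'] by a nonzero scalar. *)
Lemma same_block_perm (K : numFieldType) (v : K) (r : nat) (s s' : multisegment K r)
    (V V' : fdmod (hecke v r)) :
  v != 0 -> is_V v s V -> is_V v s' V' -> same_block V V' ->
  perm_eq (seg_flat v (enum_mset s')) (seg_flat v (enum_mset s)).
Proof.
move=> v0 hV hV' sb; apply/negPn/negP => np.
have [z zE] : exists z, \prod_(y <- seg_flat v (enum_mset s')) (z - y) -
    \prod_(y <- seg_flat v (enum_mset s)) (z - y) != 0.
  pose p := \prod_(y <- seg_flat v (enum_mset s')) ('X - y%:P) -
    \prod_(y <- seg_flat v (enum_mset s)) ('X - y%:P) : {poly K}.
  have p0 : p != 0 by rewrite subr_eq0; apply: contra np => /eqP/prod_XsubC_eq.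
  (* In characteristic 0 the integers below [size p] are distinct, and they are too many to be all
     roots of [p]. *)
  have /allPn[_ /mapP[i _ ->] pi] : ~~ all (root p) [seq (i%:R : K) | i <- iota 0 (size p)].
    apply/negP => /(max_poly_roots p0); rewrite size_map size_iota ltnn => H.
    suff : false by []. apply: H; rewrite map_inj_uniq ?iota_uniq // => i j /eqP.
    by rewrite Num.Theory.eqr_nat => /eqP.
  have pE (L : seq K) : (\prod_(y <- L) ('X - y%:P)).[i%:R] = \prod_(y <- L) (i%:R - y).
    by rewrite horner_prod; apply: eq_bigr => y _; rewrite hornerXsubC.
  by exists i%:R; move: pi; rewrite rootE hornerD hornerN !pE.
pose f := \prod_(y <- seg_flat v (enum_mset s)) (z - y).
pose c := char_X v r z - f%:A.
have c_central a : c * a = a * c by rewrite mulrBl mulrBr char_X_central // alg_cst_comm.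
have cV (x : V) : c *: x = 0.
  by rewrite scalerBl (is_V_char_X v0 z x hV) subrr.
pose g := \prod_(y <- seg_flat v (enum_mset s')) (z - y) - f.
have cV' (x : V') : c *: x = g%:A *: x.
  by rewrite scalerBl (is_V_char_X v0 z x hV') -scalerBl -scalerBl.
have [iV iV'] := ((simple_indecomposable (is_V_simple hV)).1,
                  (simple_indecomposable (is_V_simple hV')).1).
apply: (not_same_block (nilpotent_subcat c) (bijective_subcat c)
  (nilpotent_bijective_sum c_central) iV iV' _ _ sb).
  by exists 1 => x; rewrite expr1.
split=> x.
  rewrite cV' => gx; rewrite -[x]scale1r -(scale1r 1) -(mulVf zE) -alg_scaleA.
  by rewrite -/f -/g gx scaler0.
by exists (g^-1%:A *: x); rewrite cV' alg_scaleA mulfV // !scale1r.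
Qed.

Local Open Scope complex_scope.

Theorem theorem7p4 (R : realType) (v : R[i]) (r : nat)
    (v_neq0 : v != 0)
    (v_not_root : forall n : nat, (0 < n)%N -> v ^+ n != 1)
    (r_ge1 : (1 <= r)%N)
    (s s' : multisegment R[i] r)
    (V V' : fdmod (hecke v r))
    (hV : is_V v s V) (hV' : is_V v s' V') :
  same_block V V' <->
  exists sigma : 'S_r, perm_tuple (mseg_tuple v s) sigma = mseg_tuple v s'.
Proof.
split=> [/(same_block_perm v_neq0 hV hV')/mseg_tuple_permP //|/mseg_tuple_permP].
exact: is_V_same_block v_neq0 hV hV'.
Qed.
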